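(* Consider any one of the five methods cFD, cGS, cSS, cRC, cRS described in the context. Suppose Assumptions (A1), (A2), (A3) of the context hold, let $x_0\in\mathbb{R}^d$, $\theta>0$, $\nu>0$, and let $\{x_k\}$ be generated by $x_{k+1}=x_k-\alpha_k g_{S_k,T_k}(x_k)$, where for every $k\in\mathbb{Z}_+$ the sample size $|S_k|$ satisfies the norm condition $$\frac{\mathbb{E}_{T_k}[\mathbb{E}_{\zeta_i}[\|g_{\zeta_i,T_k}(x_k)-g_{T_k}(x_k)\|^2]]}{|S_k|}\le\theta^2\,\mathbb{E}_{T_k}[\|g_{T_k}(x_k)\|^2],$$ the number of directions is constant, $|T_k|=N$ ($N=d$ for cFD), and the step size is constant, $\alpha_k=\bar\alpha$. Here, with $\Omega_1:=\frac{1}{4(1+\theta^2)L_F}$ and $\Omega_2:=\frac{dM_F^2\nu^4}{48}$, the constants $\bar\alpha,\bar\chi$ are - cFD: $\bar\alpha=\Omega_1$, $\bar\chi=\Omega_2$; - cGS: $\bar\alpha=\frac{N}{N+4.5d}\Omega_1$, $\bar\chi=\frac{72Nd+216d^2+(d+2)(d+4)(d+6)}{2(N+4.5d)}\Omega_2$; - cSS: $\bar\alpha=\frac{N}{N+4.5d}\Omega_1$, $\bar\chi=\frac{72N+216d+d^2}{2d(N+4.5d)}\Omega_2$; - cRC and cRS: $\bar\alpha=\frac{N}{d}\Omega_1$, $\bar\chi=\Omega_2$. Then the sequence $\{x_k\}$ converges sublinearly to a neighborhood of the solution in the sense that, for every integer $K\ge1$, $$\min_{0\le k\le K-1}\mathbb{E}[\|\nabla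 F(x_k)\|^2]\le\frac{4(F(x_0)-F^* )}{K\bar\alpha}+4\bar\chi .$$ Moreover, for any $p\in(0,1]$ and every integer $K\ge 1$, with probability at least $1-p$, $$\min_{0\le k\le K-1}\|\nabla F(x_k)\|^2\le\frac{4(F(x_0)-F^* )}{K\bar\alpha p}+\frac{4\bar\chi}{p}.$$
   Context: Problem: minimize $F(x)=\mathbb{E}_\zeta[f(x,\zeta)]$ over $x\in\mathbb{R}^d$, where $\zeta$ is a random variable on a probability space $(\Xi,\mathcal{F},P)$ and $f:\mathbb{R}^d\times\Xi\to\mathbb{R}$. $\|\cdot\|$ is the Euclidean (or spectral) norm; $\mathbb{Z}_+=\{0,1,2,\dots\}$. (A1) $F$ is twice continuously differentiable and bounded below, with $F^*:=\inf_x F(x)>-\infty$. For every $\zeta$, $f(\cdot,\zeta)$ is twice continuously differentiable, and $\|\nabla f(x,\zeta)-\nabla f(y,\zeta)\|\le L_f\|x-y\|$, $\|\nabla^2 f(x,\zeta)-\nabla^2 f(y,\zeta)\|\le M_f\|x-y\|$ for all $x,y$, with $L_f,M_f<\infty$. Consequently $\nabla F$ and $\nabla^2F$ are Lipschitz continuous with constants $L_F\le L_f$ and $M_F\le M_f$ (taken positive). (A2) There are $\beta_1,\beta_2\ge0$ with $\mathbb{E}_{\zeta}[\|\nabla f(x,\zeta)-\nabla F(x)\|^2]\le\beta_1\|\nabla F(x)\|^2+\beta_2$ for all $x\in\mathbb{R}^d$. (A3) At every iteration $k$, $S_k=\{\zeta_1,\dots,\zeta_{|S_k|}\}$ consists of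 i.i.d. samples of $\zeta$ (so $\mathbb{E}_{\zeta_i}[f(x,\zeta_i)]=F(x)$ for all $x$), and the set of vectors $T_k$ is chosen independently of $S_k$. The random draws at iteration $k$ are fresh (independent of earlier iterations); $x_0$, $|T_k|$, $\alpha_k$ are deterministic, and $|S_k|$ is determined by the history up to $x_k$. Gradient estimator: for $\nu>0$, $$g_{S_k,T_k}(x_k):=\gamma_k\sum_{u_j\in T_k}\frac{F_{S_k}(x_k+\nu u_j)-F_{S_k}(x_k-\nu u_j)}{2\nu}u_j,\qquad F_{S_k}(x):=\frac1{|S_k|}\sum_{\zeta_i\in S_k}f(x,\zeta_i),$$ and $g_{\zeta_i,T_k}$ denotes this estimator with $S_k=\{\zeta_i\}$. The methods are: - cFD: $T_k=\{e_1,\dots,e_d\}$ (canonical basis, so $|T_k|=d$), $\gamma_k=1$; - cGS: $T_k$ consists of $|T_k|$ independent $\mathcal{N}(0,I)$ vectors, $\gamma_k=1/|T_k|$; - cSS: $T_k$ consists of $|T_k|$ independent vectors uniform on the unit sphere of $\mathbb{R}^d$, $\gamma_k=d/|T_k|$; - cRC: $T_k$ is a uniformly random subset of size $|T_k|$ of $\{e_1,\dots,e_d\}$, $\gamma_k=d/|T_k|$; - cRS: $T_k$ is a set of $|T_k|$ random orthonormal vectors, namely a uniformly random subset of size $|T_k|$ of a random orthonormal basis $\tilde T_k$ of $\mathbb{R}^d$, $\gamma_k=d/|T_k|$. Conditional expectations: $\mathcal{F}_k$ is the $\sigma$-algebra generated by $x_0$ and all $(T_i,S_i)$ with $i<k$,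 and $\mathcal{F}_{k+1/2}$ is generated by $\mathcal{F}_k$ and $T_k$; $\mathbb{E}_k[\cdot]=\mathbb{E}_{T_k}[\cdot]:=\mathbb{E}[\cdot\mid\mathcal{F}_k]$, $\mathbb{E}_{S_k}[\cdot]:=\mathbb{E}[\cdot\mid\mathcal{F}_{k+1/2}]$; $\mathbb{E}_{\zeta_i}$ is expectation over a single sample $\zeta_i$ with $x_k,T_k$ fixed. Also $g_{T_k}(x_k):=\mathbb{E}_{S_k}[g_{S_k,T_k}(x_k)]$ and $g(x_k):=\mathbb{E}_{T_k}[g_{T_k}(x_k)]$. *)

(* Defs.v *)
From HB Require Import structures.
From mathcomp Require Import all_boot all_order all_algebra.
From mathcomp Require Import all_classical all_reals all_analysis measurable_realfun.

Set Implicit Arguments.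
Unset Strict Implicit.
Unset Printing Implicit Defensive.

Import Order.TTheory GRing.Theory Num.Theory.
Import numFieldNormedType.Exports.

Local Open Scope classical_set_scope.
Local Open Scope ring_scope.

(* Points of R^d are row vectors.  The library norm on 'rV[R]_d is the sup norm,
   so the Euclidean norm is defined here; both induce the same topology, hence
   the library notions of differentiability and continuity are the usual ones. *)
Section calculus.
Context {R : realType} {d : nat}.

Definition enorm (v : 'rV[R]_d) : R := Num.sqrt (\sum_(i < d) v 0 i ^+ 2).

Definition spectral_norm (A : 'M[R]_d) : R :=
  sup [set enorm (v *m A) | v in [set v : 'rV[R]_d | enorm v <= 1]].

Definition grad (phi : 'rV[R]_d -> R) (x : 'rV[R]_d) : 'rV[R]_d :=
  \row_i 'D_(delta_mx 0 i) phi x.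

Definition hess (phi : 'rV[R]_d -> R) (x : 'rV[R]_d) : 'M[R]_d :=
  'J (grad phi) x.

Definition twice_cont_diff (phi : 'rV[R]_d -> R) : Prop :=
  [/\ forall x, differentiable phi x,
      forall x, differentiable (grad phi) x
    & continuous (hess phi)].

Definition grad_lipschitz (L : R) (phi : 'rV[R]_d -> R) : Prop :=
  forall x y, enorm (grad phi x - grad phi y) <= L * enorm (x - y).

Definition hess_lipschitz (M : R) (phi : 'rV[R]_d -> R) : Prop :=
  forall x y, spectral_norm (hess phi x - hess phi y) <= M * enorm (x - y).

Definition central_diff (phi : 'rV[R]_d -> R) (nu : R) (x u : 'rV[R]_d) : R :=
  (phi (x + nu *: u) - phi (x - nu *: u)) / (2 * nu).

Definition grad_est (N : nat) (gamma nu : R) (u : 'I_N -> 'rV[R]_d)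
    (phi : 'rV[R]_d -> R) (x : 'rV[R]_d) : 'rV[R]_d :=
  gamma *: \sum_(j < N) central_diff phi nu x (u j) *: u j.

(* The Borel sets of R^d, as the product sigma-algebra. *)
Definition borel_vec : set (set 'rV[R]_d) :=
  <<s [set A | exists i (B : set R),
         measurable B /\ A = [set v : 'rV[R]_d | B (v 0 i)]] >>.

End calculus.

(* The stochastic problem: f x z with z distributed as Pz, F = E[f(., z)].  That
   F is well defined as a real function is [integrable_loss] below. *)
Section problem.
Context {R : realType} {d : nat} {dXi : measure_display}
  {Xi : measurableType dXi} (Pz : probability Xi R) (f : 'rV[R]_d -> Xi -> R).

Definition objective (x : 'rV[R]_d) : R := fine 'E_Pz[f x].

Definition Fstar : R := inf (range objective).

Definition integrable_loss : Prop :=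
  forall x, Pz.-integrable setT (fun z => (f x z)%:E).

Record assumption_A1 (L_f M_f L_F M_F : R) : Prop := AssumptionA1 {
  A1_F_C2 : twice_cont_diff objective;
  A1_F_bounded_below : has_lbound (range objective);
  A1_f_C2 : forall z, twice_cont_diff (f ^~ z);
  A1_f_grad : forall z, grad_lipschitz L_f (f ^~ z);
  A1_f_hess : forall z, hess_lipschitz M_f (f ^~ z);
  A1_L_F : 0 < L_F <= L_f;
  A1_M_F : 0 < M_F <= M_f;
  A1_F_grad : grad_lipschitz L_F objective;
  A1_F_hess : hess_lipschitz M_F objective
}.

Definition assumption_A2 (beta1 beta2 : R) : Prop :=
  [/\ 0 <= beta1, 0 <= beta2
    & forall x,
        ('E_Pz[(fun z => enorm (grad (f ^~ z) x - grad objective x) ^+ 2)%R]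
          <= (beta1 * enorm (grad objective x) ^+ 2 + beta2)%R%:E)%E].

End problem.

Inductive method := cFD | cGS | cSS | cRC | cRS.

Section constants.
Context {R : realType} (m : method) (d N : nat).

Definition gamma_of : R :=
  match m with
  | cFD => 1
  | cGS => N%:R^-1
  | cSS | cRC | cRS => d%:R / N%:R
  end.

Definition Omega1 (theta L_F : R) : R := (4 * (1 + theta ^+ 2) * L_F)^-1.

Definition Omega2 (M_F nu : R) : R := d%:R * M_F ^+ 2 * nu ^+ 4 / 48.

Definition alpha_bar (theta L_F : R) : R :=
  match m with
  | cFD => Omega1 theta L_F
  | cGS | cSS => N%:R / (N%:R + 9 / 2 * d%:R) * Omega1 theta L_F
  | cRC | cRS => N%:R / d%:R * Omega1 theta L_F
  end.

Definition chi_bar (M_F nu : R) : R :=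
  match m with
  | cFD | cRC | cRS => Omega2 M_F nu
  | cGS =>
      (72 * N%:R * d%:R + 216 * d%:R ^+ 2
        + (d%:R + 2) * (d%:R + 4) * (d%:R + 6))
      / (2 * (N%:R + 9 / 2 * d%:R)) * Omega2 M_F nu
  | cSS =>
      (72 * N%:R + 216 * d%:R + d%:R ^+ 2)
      / (2 * d%:R * (N%:R + 9 / 2 * d%:R)) * Omega2 M_F nu
  end.

End constants.

Section randomness.
Context {R : realType} {d : nat} {dO : measure_display}
  {Omega : measurableType dO} (P : probability Omega R).

(* Y is a version of the conditional expectation of X given the
   sub-sigma-algebra G (X nonnegative or integrable). *)
Definition is_cond_exp (G : set (set Omega)) (X Y : Omega -> \bar R) : Prop :=
  (forall B : set (\bar R), measurable B -> G (Y @^-1` B)) /\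
  (forall A, G A -> (\int[P]_(w in A) Y w = \int[P]_(w in A) X w)%E).

Definition random_vector (u : Omega -> 'rV[R]_d) : Prop :=
  forall C, borel_vec C -> measurable (u @^-1` C).

Definition vec_sigma (I : Type) (U : I -> Omega -> 'rV[R]_d) :
    set (set Omega) :=
  <<s [set A | exists i C, borel_vec C /\ A = U i @^-1` C] >>.

Definition indep_vectors (N : nat) (U : 'I_N -> Omega -> 'rV[R]_d) : Prop :=
  forall C : 'I_N -> set 'rV[R]_d, (forall j, borel_vec (C j)) ->
    (P [set w | forall j, C j (U j w)] =
       \big[*%E/1%E]_(j < N) P [set w | C j (U j w)])%E.

Definition std_gaussian (u : Omega -> 'rV[R]_d) : Prop :=
  forall B : 'I_d -> set R, (forall i, measurable (B i)) ->
    (P [set w | forall i, B i (u w 0%R i)] =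
       \big[*%E/1%E]_(i < d) normal_prob 0%R 1%R (B i))%E.

(* The uniform law on the unit sphere is the unique law on the sphere that is
   invariant under the orthogonal group. *)
Definition uniform_sphere (u : Omega -> 'rV[R]_d) : Prop :=
  {ae P, forall w, enorm (u w) = 1} /\
  forall (O : 'M[R]_d) C, O *m O^T = 1%:M -> borel_vec C ->
    P [set w | C (u w *m O)] = P [set w | C (u w)].

Definition uniform_subset (N : nat) (J : Omega -> {set 'I_d}) : Prop :=
  (forall A, measurable [set w | J w = A]) /\
  (forall A : {set 'I_d}, #|A| = N ->
     P [set w | J w = A] = ('C(d, N)%:R^-1)%:E).

Definition random_basis (b : 'I_d -> Omega -> 'rV[R]_d) : Prop :=
  (forall i, random_vector (b i)) /\
  (forall w i j, b i w *m (b j w)^T = ((i == j)%:R)%:M).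

(* The law of the random direction set T_k = {u_0, .., u_{N-1}} of each method.
   For cRC and cRS the u_j enumerate, in any order, the selected elements of the
   orthonormal basis, and J is the random set of their indices. *)
Definition directions_law (m : method) (N : nat)
    (u : 'I_N -> Omega -> 'rV[R]_d) : Prop :=
  match m with
  | cFD => N = d /\ forall j w, u j w = \row_(i < d) (i == j :> nat)%:R
  | cGS => indep_vectors u /\ forall j, std_gaussian (u j)
  | cSS => indep_vectors u /\ forall j, uniform_sphere (u j)
  | cRC => exists J, uniform_subset N J /\
      {ae P, forall w, perm_eq [seq u j w | j <- enum 'I_N]
                         [seq delta_mx 0 i | i <- enum (J w)]}
  | cRS => exists b J, [/\ random_basis b, uniform_subset N J,
      forall A E, vec_sigma b E ->
        (P ([set w | J w = A] `&` E) = P [set w | J w = A] * P E)%E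
      & {ae P, forall w, perm_eq [seq u j w | j <- enum 'I_N]
                           [seq b i w | i <- enum (J w)]}]
  end.

End randomness.

(* T k j is the j-th direction of T_k, n k = |S_k| (a random integer), and
   S_k = {zeta k 0, .., zeta k (n k - 1)}; zeta k j is irrelevant for j >= n k. *)
Section algorithm.
Context {R : realType} {d : nat}
  {dXi : measure_display} {Xi : measurableType dXi} (Pz : probability Xi R)
  (f : 'rV[R]_d -> Xi -> R)
  {dO : measure_display} {Omega : measurableType dO} (P : probability Omega R)
  (N : nat) (T : nat -> 'I_N -> Omega -> 'rV[R]_d)
  (n : nat -> Omega -> nat) (zeta : nat -> nat -> Omega -> Xi).

(* F_k, generated by T_i and the lists S_i of random length n i, for i < k;
   [half_history k] is F_{k+1/2}. *)
Definition history (k : nat) : set (set Omega) :=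
  <<s [set A | exists i, (i < k)%N /\
         (vec_sigma (T i) A \/
          exists j C, measurable C /\
            A = [set w | (j < n i w)%N /\ C (zeta i j w)])] >>.

Definition half_history (k : nat) : set (set Omega) :=
  <<s history k `|` vec_sigma (T k) >>.

(* As n k depends on the history, "S_k is an i.i.d. sample independent of the
   history and of T_k" is stated on each event {n k = s}: given F_{k+1/2} and
   n k = s, the s entries of S_k are independent with law Pz. *)
Record assumption_A3 : Prop := AssumptionA3 {
  A3_T_random : forall k j, random_vector (T k j);
  A3_zeta_random : forall k j, measurable_fun setT (zeta k j);
  A3_n_gt0 : forall k w, (0 < n k w)%N;
  A3_n_history : forall k s, history k [set w | n k w = s];
  A3_T_fresh : forall k A B, history k A -> vec_sigma (T k) B ->
    (P (A `&` B) = P A * P B)%E;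
  A3_S_iid : forall k s (C : nat -> set Xi) A,
    (forall j, measurable (C j)) -> half_history k A ->
    (P (A `&` [set w | n k w = s]
          `&` [set w | forall j, (j < s)%N -> C j (zeta k j w)]) =
     P (A `&` [set w | n k w = s]) * \big[*%E/1%E]_(j < s) Pz (C j))%E
}.

Definition sample_average (k : nat) (w : Omega) (x : 'rV[R]_d) : R :=
  (n k w)%:R^-1 * \sum_(j < n k w) f x (zeta k j w).

Definition directions (k : nat) (w : Omega) (j : 'I_N) : 'rV[R]_d := T k j w.

Context (gamma nu : R) (x : nat -> Omega -> 'rV[R]_d).

(* g_{S_k,T_k}(x_k) *)
Definition g_ST (k : nat) (w : Omega) : 'rV[R]_d :=
  grad_est gamma nu (directions k w) (sample_average k w) (x k w).

(* g_{z,T_k}(x_k) *)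
Definition g_zT (k : nat) (w : Omega) (z : Xi) : 'rV[R]_d :=
  grad_est gamma nu (directions k w) (f ^~ z) (x k w).

Definition generates (x0 : 'rV[R]_d) (alpha : R) : Prop :=
  (forall w, x 0%N w = x0) /\
  (forall k w, x k.+1 w = x k w - alpha *: g_ST k w).

(* g_T is (a version of) g_{T_k}(x_k) = E_{S_k}[g_{S_k,T_k}(x_k)], V of
   E_{T_k}[E_z[|g_{z,T_k}(x_k) - g_{T_k}(x_k)|^2]] and W of
   E_{T_k}[|g_{T_k}(x_k)|^2]. *)
Definition norm_condition (theta : R) (k : nat) : Prop :=
  exists (g_T : Omega -> 'rV[R]_d) (V W : Omega -> \bar R),
  [/\ forall i, is_cond_exp P (half_history k)
        (fun w => (g_ST k w 0 i)%:E) (fun w => (g_T w 0 i)%:E),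
      is_cond_exp P (history k)
        (fun w => 'E_Pz[(fun z => enorm (g_zT k w z - g_T w) ^+ 2)%R])%E V,
      is_cond_exp P (history k) (fun w => (enorm (g_T w) ^+ 2)%R%:E) W
    & {ae P, forall w,
        (V w * ((n k w)%:R^-1)%R%:E <= (theta ^+ 2)%R%:E * W w)%E}].

End algorithm.

(* Main.v *)
(* The descent lemma gives
     F(x_{k+1}) <= F(x_k) - alpha <grad F(x_k), g> + (L_F alpha^2 / 2) |g|^2,  g = g_{S_k,T_k}(x_k).
   Averaging over the samples replaces g by its mean over zeta, the finite-difference
   estimator of F itself, at the price of the sampling variance, which the norm
   condition absorbs into a factor 1 + theta^2 on |g|^2.  Averaging over the directions,
   it remains to show, for x fixed, a = grad F(x) and G the estimator of F at x,
     - <a, E G> + (c / 8) E|G|^2 <= - |a|^2 / 4 + chi,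
   where c is the ratio of alpha to Omega1.  For independent Gaussian or spherical
   directions this follows from bounds on the bias (Stein's lemma, respectively a
   reflection argument) and on the second moment of one direction.  For random
   subsets of an orthonormal basis |G|^2 is the sum of the squared central differences
   along the selected directions, and the bound is proved direction by direction; cFD
   is the case where the subset is the whole canonical basis.  Summing the resulting
   E[F(x_{k+1}) - F*] + (alpha / 4) E|grad F(x_k)|^2 <= E[F(x_k) - F*] + alpha chi
   over k gives the first claim, and Markov's inequality applied to the sum of the
   |grad F(x_k)|^2 gives the second. *)
Require Import Defs.
From HB Require Import structures.
From mathcomp Require Import all_boot all_order all_algebra.
From mathcomp Require Import all_classical all_reals all_analysis measurable_realfun.
From mathcomp Require Import ring lra.

Set Implicit Arguments.
Unset Strict Implicit.
Unset Printing Implicit Defensive.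

Import Order.TTheory GRing.Theory Num.Theory.
Import numFieldNormedType.Exports.

Local Open Scope classical_set_scope.
Local Open Scope ring_scope.

(** * Euclidean norm and Taylor estimates *)

(** Finiteness of the expectations of [F(x_k)] and of the squared estimators along the iteration is
    not given, so infinite values are never subtracted. As soon as the quadratic coefficient is at
    least [L / 2 * alpha ^+ 2], the upper model of [F(x - alpha v) - F*] is nonnegative for every
    [v]; Tonelli then applies to it, and the decrease term is added to the left instead of being
    subtracted on the right. Conditioning is replaced by redrawing: of two independent sources of
    randomness one is integrated while the other is frozen. As |S_k| is random, samples are redrawn
    on each event [n k = s], under the law conditioned on that event, and the pieces are summed. The
    version of the conditional mean supplied by the norm condition is first identified, almost
    everywhere, with the estimator of [F]. The constant 9/2 comes from (y + r)^2 <= 3/2 y^2 + 3 r^2,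
    with y the linear part and r the remainder of a central difference, and from 3/2 (d + 2) <= 9/2
    d. *)

Section euclid.
Context {R : realType} {d : nat}.
Implicit Types (u v w x y h : 'rV[R]_d).

Definition dot u v : R := \sum_(i < d) u 0 i * v 0 i.

Lemma dotC u v : dot u v = dot v u.
Proof. by apply: eq_bigr => i _; rewrite mulrC. Qed.

Lemma dotDl u v w : dot (u + v) w = dot u w + dot v w.
Proof. by rewrite -big_split; apply: eq_bigr => i _; rewrite mxE mulrDl. Qed.

Lemma dotZl (c : R) u w : dot (c *: u) w = c * dot u w.
Proof. by rewrite /dot big_distrr; apply: eq_bigr => i _; rewrite mxE -mulrA. Qed.

Lemma dotNl u w : dot (- u) w = - dot u w.
Proof. by rewrite -scaleN1r dotZl mulN1r. Qed.

Lemma dotBl u v w : dot (u - v) w = dot u w - dot v w.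
Proof. by rewrite dotDl dotNl. Qed.

Lemma dotDr u v w : dot w (u + v) = dot w u + dot w v.
Proof. by rewrite dotC dotDl !(dotC _ w). Qed.

Lemma dotZr (c : R) u w : dot w (c *: u) = c * dot w u.
Proof. by rewrite dotC dotZl dotC. Qed.

Lemma dotNr u w : dot w (- u) = - dot w u.
Proof. by rewrite dotC dotNl dotC. Qed.

Definition dotE := (dotDl, dotDr, dotZl, dotZr, dotNl, dotNr).

Lemma dot0l u : dot 0 u = 0.
Proof. by rewrite -(scale0r 0) dotZl mul0r. Qed.

Lemma dot_suml (I : Type) (r : seq I) (Q : pred I) (E : I -> 'rV[R]_d) w :
  dot (\sum_(i <- r | Q i) E i) w = \sum_(i <- r | Q i) dot (E i) w.
Proof.
elim/big_rec2: _ => [|i a b _ <-]; first by rewrite dot0l.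
by rewrite dotDl.
Qed.

Lemma dot_sumr (I : Type) (r : seq I) (Q : pred I) (E : I -> 'rV[R]_d) w :
  dot w (\sum_(i <- r | Q i) E i) = \sum_(i <- r | Q i) dot w (E i).
Proof. by rewrite dotC dot_suml; apply: eq_bigr => i _; rewrite dotC. Qed.

Lemma dot_delta u i : dot u (delta_mx 0 i) = u 0 i.
Proof.
rewrite /dot (bigD1 i)//= mxE !eqxx mulr1 big1 ?addr0// => j /negPf ji.
by rewrite mxE ji andbF mulr0.
Qed.

Lemma dot_mul_tr u v : u *m v^T = (dot u v)%:M.
Proof.
apply/matrixP => i j; rewrite !ord1 !mxE eqxx.
by apply: eq_bigr => k _; rewrite mxE.
Qed.

Lemma dot_mulmx u v (A : 'M[R]_d) : dot (u *m A) v = dot u (v *m A^T).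
Proof.
have : (u *m A) *m v^T = u *m (v *m A^T)^T by rewrite trmx_mul trmxK mulmxA.
by rewrite !dot_mul_tr => /matrixP/(_ 0 0); rewrite !mxE eqxx.
Qed.

Lemma dot_ge0 u : 0 <= dot u u.
Proof. by apply: sumr_ge0 => i _; rewrite -expr2 sqr_ge0. Qed.

Lemma enorm_ge0 u : 0 <= enorm u.
Proof. exact: sqrtr_ge0. Qed.

Lemma enorm_sqr u : enorm u ^+ 2 = dot u u.
Proof.
rewrite sqr_sqrtr; last by apply: sumr_ge0 => i _; rewrite sqr_ge0.
by apply: eq_bigr => i _; rewrite expr2.
Qed.

Lemma enormE u : enorm u = Num.sqrt (dot u u).
Proof. by rewrite -enorm_sqr sqrtr_sqr ger0_norm// enorm_ge0. Qed.

Lemma enormZ (c : R) u : enorm (c *: u) = `|c| * enorm u.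
Proof.
by rewrite !enormE dotZl dotZr mulrA -expr2 sqrtrM ?sqr_ge0// sqrtr_sqr.
Qed.

Lemma enormN u : enorm (- u) = enorm u.
Proof. by rewrite -scaleN1r enormZ normrN1 mul1r. Qed.

Lemma enorm_eq0 u : enorm u = 0 -> u = 0.
Proof.
move=> u0; apply/rowP => i; rewrite mxE; apply/eqP.
have : dot u u == 0 by rewrite -enorm_sqr u0 expr0n.
rewrite psumr_eq0; last by move=> j _; rewrite -expr2 sqr_ge0.
by move=> /allP/(_ i (mem_index_enum _)) /=; rewrite mulf_eq0 orbb.
Qed.

Lemma coord_le_enorm u i : `|u 0 i| <= enorm u.
Proof.
rewrite -(sqrtr_sqr (u 0 i)) enormE ler_wsqrtr// /dot (bigD1 i)//= -expr2 lerDl.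
by apply: sumr_ge0 => j _; rewrite -expr2 sqr_ge0.
Qed.

(** Cauchy-Schwarz: the square of [enorm v *: u - enorm u *: v] is nonnegative, and it expands to
    [2 * enorm u * enorm v] times the gap between the two sides. *)
Lemma dot_le_enorm u v : dot u v <= enorm u * enorm v.
Proof.
have [u0|u0] := eqVneq (enorm u) 0.
  by rewrite u0 mul0r (enorm_eq0 u0) dot0l.
have [v0|v0] := eqVneq (enorm v) 0.
  by rewrite v0 mulr0 (enorm_eq0 v0) dotC dot0l.
have : 0 <= dot (enorm v *: u - enorm u *: v) (enorm v *: u - enorm u *: v).
  exact: dot_ge0.
rewrite !dotE (dotC v u) -!enorm_sqr => H.
have u1 : 0 < enorm u by rewrite lt_def u0 enorm_ge0.
have v1 : 0 < enorm v by rewrite lt_def v0 enorm_ge0.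
have uv : 0 < enorm u * enorm v by rewrite mulr_gt0.
by rewrite -subr_ge0 -(pmulr_rge0 _ uv); nra.
Qed.

Lemma normr_dot_le u v : `|dot u v| <= enorm u * enorm v.
Proof.
by rewrite ler_norml dot_le_enorm andbT lerNl -dotNl -(enormN u) dot_le_enorm.
Qed.

Lemma enorm_triangle u v : enorm (u + v) <= enorm u + enorm v.
Proof.
rewrite -(ler_pXn2r (n := 2))// ?nnegrE ?addr_ge0 ?enorm_ge0//.
rewrite enorm_sqr !dotE (dotC v u) sqrrD -!enorm_sqr.
have := dot_le_enorm u v; lra.
Qed.

Lemma enorm_sum (I : Type) (r : seq I) (E : I -> 'rV[R]_d) :
  enorm (\sum_(i <- r) E i) <= \sum_(i <- r) enorm (E i).
Proof.
elim/big_rec2: _ => [|i a b _ H].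
  by rewrite enormE dot0l sqrtr0.
by apply: (le_trans (enorm_triangle _ _)); rewrite lerD2l.
Qed.

Lemma enorm_le_sum u : enorm u <= \sum_i `|u 0 i|.
Proof.
have {1}-> : u = \sum_i u 0 i *: delta_mx 0 i by rewrite -row_sum_delta.
apply: (le_trans (enorm_sum _ _)); apply: ler_sum => i _.
by rewrite enormZ ler_piMr// enormE dot_delta mxE !eqxx sqrtr1.
Qed.

(** Testing against [w = v] is enough. This turns a norm bound on a vector-valued mean into scalar
    bounds, which commute with integration. *)
Lemma enorm_le_of_dot v (c : R) : 0 <= c ->
  (forall w, dot v w <= c * enorm w) -> enorm v <= c.
Proof.
move=> c0 H; have [v0|v0] := eqVneq (enorm v) 0; first by rewrite v0.
have v1 : 0 < enorm v by rewrite lt_def v0 enorm_ge0.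
by have := H v; rewrite -enorm_sqr expr2 ler_pM2r.
Qed.

(** A [sup] bounds its set only once that set is known to be bounded, hence the crude entrywise
    bound [vA]; then [v] is rescaled to the unit sphere. *)
Lemma mul_spectral_norm v (A : 'M[R]_d) :
  enorm (v *m A) <= spectral_norm A * enorm v.
Proof.
have vA w : enorm w <= 1 -> enorm (w *m A) <= \sum_i \sum_j `|A j i|.
  move=> w1; apply: (le_trans (enorm_le_sum _)); apply: ler_sum => i _.
  rewrite mxE; apply: (le_trans (ler_norm_sum _ _ _)).
  apply: ler_sum => j _; rewrite normrM ler_piMl//.
  exact: le_trans (coord_le_enorm _ _) w1.
have bd : has_sup [set enorm (w *m A) | w in [set w : 'rV[R]_d | enorm w <= 1]].
  split.
    exists (enorm (0 *m A)), 0 => //=.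
    by rewrite enormE dot0l sqrtr0.
  by exists (\sum_i \sum_j `|A j i|) => _ [w /= w1 <-]; exact: vA.
have [v0|v0] := eqVneq (enorm v) 0.
  by rewrite v0 mulr0 (enorm_eq0 v0) mul0mx enormE dot0l sqrtr0.
have v1 : 0 < enorm v by rewrite lt_def v0 enorm_ge0.
rewrite -ler_pdivrMr// mulrC -[X in X * _]ger0_norm ?invr_ge0 ?enorm_ge0//.
rewrite -enormZ scalemxAl; apply: sup_upper_bound => //.
exists ((enorm v)^-1 *: v) => //=.
by rewrite enormZ ger0_norm ?invr_ge0 ?enorm_ge0// mulVf.
Qed.

End euclid.

(** * Derivatives along segments and the resulting Taylor bounds *)

Section line_calculus.
Context {R : realType} {d : nat}.
Implicit Types (u v w x y h : 'rV[R]_d).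

Lemma dot_grad (phi : 'rV[R]_d -> R) x h :
  differentiable phi x -> 'd phi x h = dot (grad phi x) h.
Proof.
move=> dphi; rewrite [in LHS](row_sum_delta h) linear_sum.
by apply: eq_bigr => i _; rewrite linearZ /= mulrC mxE deriveE.
Qed.

Lemma is_derive_line (W : normedModType R) (phi : 'rV[R]_d -> W) x h (t : R) :
  differentiable phi (x + t *: h) ->
  is_derive t (1 : R) (fun s : R => phi (x + s *: h)) ('d phi (x + t *: h) h).
Proof.
move=> dphi.
have H : is_diff t (fun s : R => x + s *: h) ( *:%R ^~ h).
  have /= := is_diffD (is_diff_cst x t) (is_diff_scalel t h).
  by rewrite add0r.
have /= := is_diff_comp H (differentiableP dphi).
move=> K; apply: DeriveDef.
  by apply/derivable1_diffP; exact: ex_diff.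
by rewrite deriveE ?diff_val/= ?scale1r//; exact: ex_diff.
Qed.

Lemma is_derive_line_fun (phi : 'rV[R]_d -> R) x h (t : R) :
  (forall y, differentiable phi y) ->
  is_derive t (1 : R) (fun s : R => phi (x + s *: h))
    (dot (grad phi (x + t *: h)) h).
Proof. by move=> dphi; rewrite -dot_grad//; exact: is_derive_line. Qed.

Lemma is_derive_line_grad (phi : 'rV[R]_d -> R) x h v (t : R) :
  (forall y, differentiable (grad phi) y) ->
  is_derive t (1 : R) (fun s : R => dot (grad phi (x + s *: h)) v)
    (dot (h *m hess phi (x + t *: h)) v).
Proof.
move=> dphi.
have -> : (fun s : R => dot (grad phi (x + s *: h)) v) =
          \sum_i (fun s : R => v 0 i *: (grad phi (x + s *: h)) 0 i).
  apply/funext => s; rewrite fct_sumE; apply: eq_bigr => i _.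
  by rewrite mulrC.
rewrite [X in is_derive _ _ _ X](_ : _ =
    \sum_i v 0 i *: (h *m hess phi (x + t *: h)) 0 i); last first.
  by apply: eq_bigr => i _; rewrite mulrC.
apply: is_derive_sum => i; apply: is_deriveZ.
have dc y : differentiable (fun z => grad phi z 0 i) y.
  apply: (@differentiable_comp _ _ _ _ (grad phi) (fun M : 'rV[R]_d => M 0 i)) => //.
  exact: differentiable_coord.
have := is_derive_line (h := h) (dc (x + t *: h)).
rewrite /hess /jacobian mul_rV_lin1.
rewrite (_ : 'd (fun z => grad phi z 0 i) (x + t *: h) h =
  'd (grad phi) (x + t *: h) h 0 i)//.
rewrite (@diff_comp _ _ _ _ (grad phi) (fun M : 'rV[R]_d => M 0 i))//=; last exact: differentiable_coord.
(* The coordinate map is repackaged as a linear map, so that it is its own differential. *)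
have lc : linear (fun M : 'rV[R]_d => M 0 i : R) by move=> k p q; rewrite !mxE.
pose C := GRing.isLinear.Build _ _ _ _ _ lc.
pose c : {linear 'rV[R]_d -> R} := HB.pack (fun M : 'rV[R]_d => M 0 i : R) C.
have := @diff_lin _ _ _ c (grad phi (x + t *: h)) (@coord_continuous _ _ _ 0 i).
by move=> ->.
Qed.

(** The Taylor bounds below subtract their claimed remainder as a polynomial in [t] and check the
    sign of the derivative; the mean value theorem thus replaces integral remainders. *)
Lemma le_of_derive_le0 (f f' : R -> R) (s : R) : 0 <= s ->
  (forall t, is_derive t (1 : R) f (f' t)) -> (forall t, 0 <= t <= s -> f' t <= 0) ->
  f s <= f 0.
Proof.
move=> s0 df f'0.
have cf : {within `[0, s], continuous f}.
  by apply: derivable_within_continuous => z _; exact: ex_derive.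
have [c cs H] := @MVT_segment R f f' 0 s s0 (fun z _ => df z) cf.
by rewrite -subr_le0 H subr0 mulr_le0_ge0// f'0.
Qed.

Lemma scaleRE (a b : R) : a *: (b : R^o) = a * b.
Proof. by []. Qed.

Lemma is_derive_pow (n : nat) (t : R) :
  is_derive t (1 : R) (fun s : R => s ^+ n.+1) (n.+1%:R * t ^+ n).
Proof.
have := @is_deriveX R R id n.+1 t 1 1 (is_derive_id t 1).
by rewrite exprfctE scaleRE mulr1.
Qed.

Section C2.
Variables (phi : 'rV[R]_d -> R) (L M : R).
Hypothesis dphi : forall y, differentiable phi y.
Hypothesis dgrad : forall y, differentiable (grad phi) y.

(** The descent lemma: along the segment, the Lipschitz bound on the gradient increment is exactly
    the derivative of the quadratic term. *)
Lemma grad_lipschitz_descent x h : grad_lipschitz L phi ->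
  phi (x + h) <= phi x + dot (grad phi x) h + L / 2 * dot h h.
Proof.
move=> lphi.
pose f (t : R) := phi (x + t *: h) - (dot (grad phi x) h *: t + (L / 2 * dot h h) *: t ^+ 2).
pose f' (t : R) := dot (grad phi (x + t *: h)) h -
  (dot (grad phi x) h *: 1 + (L / 2 * dot h h) *: (2%:R * t ^+ 1)).
have df t : is_derive t (1 : R) f (f' t).
  apply: is_deriveB; first exact: is_derive_line_fun.
  apply: is_deriveD; apply: is_deriveZ.
  exact: is_derive_pow.
have f'0 t : 0 <= t <= 1 -> f' t <= 0.
  move=> /andP[t0 _]; rewrite /f' !scaleRE expr1 mulr1.
  have := dot_le_enorm (grad phi (x + t *: h) - grad phi x) h.
  rewrite dotBl => /le_trans/(_ (ler_wpM2r (enorm_ge0 h) (lphi _ _))).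
  rewrite (addrC x) addrK enormZ ger0_norm// -enorm_sqr.
  lra.
have := @le_of_derive_le0 f f' 1 ler01 df f'0.
rewrite /f scale1r scale0r /GRing.scale/= addr0 expr1n !expr0n/= !mulr0 !mulr1.
lra.
Qed.

Section hess.
Hypothesis lhess : hess_lipschitz M phi.

(** The two gradients move in opposite directions, so the derivative in [t] involves the difference
    of the Hessians at two points [2 t h] apart; it is at most [2 M t |h|^2 |v|]. *)
Lemma grad_second_diff x h v :
  dot (grad phi (x + h) + grad phi (x - h) - 2 *: grad phi x) v <=
  M * dot h h * enorm v.
Proof.
pose f (t : R) := dot (grad phi (x + t *: h)) v +
  dot (grad phi (x + t *: - h)) v - (M * dot h h * enorm v) *: t ^+ 2.
pose f' (t : R) := dot (h *m hess phi (x + t *: h)) v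
  + dot (- h *m hess phi (x + t *: - h)) v
  - (M * dot h h * enorm v) *: (2%:R * t ^+ 1).
have df t : is_derive t (1 : R) f (f' t).
  apply: is_deriveB; first by apply: is_deriveD; exact: is_derive_line_grad.
  by apply: is_deriveZ; exact: is_derive_pow.
have f'0 t : 0 <= t <= 1 -> f' t <= 0.
  move=> /andP[t0 _]; rewrite /f' !scaleRE expr1.
  rewrite mulNmx dotNl -dotBl -mulmxBr.
  rewrite subr_le0; apply: (le_trans (dot_le_enorm _ _)).
  rewrite -enorm_sqr [leRHS](_ : _ =
    M * enorm (x + t *: h - (x + t *: - h)) * enorm h * enorm v).
    rewrite ler_wpM2r ?enorm_ge0//; apply: (le_trans (mul_spectral_norm _ _)).
    by rewrite ler_wpM2r ?enorm_ge0.
  have -> : x + t *: h - (x + t *: - h) = (2 * t) *: h.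
    by apply/rowP => i; rewrite !mxE; ring.
  by rewrite !enormZ !ger0_norm ?mulr_ge0//; ring.
have := @le_of_derive_le0 f f' 1 ler01 df f'0.
rewrite /f !scale1r !scale0r !addr0 expr1n expr0n/= !scaleRE ?mulr0.
rewrite !dotE; lra.
Qed.

Lemma enorm_grad_second_diff x h : 0 <= M ->
  enorm (grad phi (x + h) + grad phi (x - h) - 2 *: grad phi x) <=
  M * dot h h.
Proof.
move=> M0; apply: enorm_le_of_dot; first by rewrite mulr_ge0 ?dot_ge0.
by move=> w; exact: grad_second_diff.
Qed.

(** The derivative in [t] is a symmetric second difference of the gradient, at most [M t^2 |h|^3];
    integrating [t^2] yields the 1/3. *)
Lemma central_diff_ub x h :
  phi (x + h) - phi (x - h) - 2 * dot (grad phi x) h <= M / 3 * enorm h ^+ 3.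
Proof.
pose f (t : R) := phi (x + t *: h) - phi (x + t *: - h)
  - ((2 * dot (grad phi x) h) *: t + (M / 3 * enorm h ^+ 3) *: t ^+ 3).
pose f' (t : R) := dot (grad phi (x + t *: h)) h
  - dot (grad phi (x + t *: - h)) (- h)
  - ((2 * dot (grad phi x) h) *: 1 + (M / 3 * enorm h ^+ 3) *: (3%:R * t ^+ 2)).
have df t : is_derive t (1 : R) f (f' t).
  apply: is_deriveB; first by apply: is_deriveB; exact: is_derive_line_fun.
  apply: is_deriveD; apply: is_deriveZ.
  exact: is_derive_pow.
have f'0 t : 0 <= t <= 1 -> f' t <= 0.
  move=> /andP[t0 _]; rewrite /f' !scaleRE mulr1.
  have := grad_second_diff x (t *: h) h.
  rewrite scalerN !dotE -enorm_sqr; lra.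
have := @le_of_derive_le0 f f' 1 ler01 df f'0.
rewrite /f !scale1r !scale0r !addr0 expr1n expr0n/= !scaleRE ?mulr0.
lra.
Qed.

Lemma central_diff_err x h :
  `|phi (x + h) - phi (x - h) - 2 * dot (grad phi x) h| <= M / 3 * enorm h ^+ 3.
Proof.
rewrite ler_norml central_diff_ub andbT.
have := central_diff_ub x (- h); rewrite opprK enormN dotNr; lra.
Qed.

(* Moving h along a segment orthogonal to w, this compares the central differences
   at h + w and at its mirror image w - h; the bound is linear in |h|. *)
Lemma central_diff_reflect x h w : 0 <= M -> dot h w = 0 ->
  phi (x + (h + w)) - phi (x - (h + w)) - (phi (x + (w - h)) - phi (x - (w - h)))
    - 4 * dot (grad phi x) h <= 2 * M * enorm h * dot (h + w) (h + w).
Proof.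
move=> M0 hw.
pose g (t : R) := phi (x + w + t *: h) - phi (x - w + t *: - h)
  - (phi (x + w + t *: - h) - phi (x - w + t *: h)).
pose g' (t : R) := dot (grad phi (x + w + t *: h)) h
  - dot (grad phi (x - w + t *: - h)) (- h)
  - (dot (grad phi (x + w + t *: - h)) (- h) - dot (grad phi (x - w + t *: h)) h).
pose f (t : R) := g t - (4 * dot (grad phi x) h +
  2 * M * enorm h * dot (h + w) (h + w)) *: t.
pose f' (t : R) := g' t - (4 * dot (grad phi x) h +
  2 * M * enorm h * dot (h + w) (h + w)) *: 1.
have df t : is_derive t (1 : R) f (f' t).
  apply: is_deriveB.
  by apply: is_deriveB; apply: is_deriveB; exact: is_derive_line_fun.
have f'0 t : 0 <= t <= 1 -> f' t <= 0.
  move=> /andP[t0 t1]; rewrite /f' /g' !scaleRE mulr1.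
  (* The four gradients pair up into second differences at [w + t h] and [w - t h]; by orthogonality
     the squared lengths of these add up to [2 |w|^2 + 2 t^2 |h|^2]. *)
  have := grad_second_diff x (w + t *: h) h.
  have := grad_second_diff x (w - t *: h) h.
  rewrite !opprD !opprK !addrA !scalerN !dotE hw (dotC w h) hw.
  have : M * t ^+ 2 * dot h h * enorm h <= M * dot h h * enorm h.
    rewrite ler_wpM2r ?enorm_ge0// ler_wpM2r ?dot_ge0// ler_piMr ?expr_le1//.
  rewrite !mulr0.
  lra.
have := @le_of_derive_le0 f f' 1 ler01 df f'0.
rewrite /f /g !scale1r !scale0r !addr0 !scaleRE mulr0 mulr1 subr0.
rewrite (addrC h w) !opprD !opprK !addrA.
lra.
Qed.

End hess.
End C2.
End line_calculus.

(** * Measurability, independence, integration *)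

Section caratheodory.
Context {R : realType} {d : nat} {dY : measure_display} {Y : measurableType dY}.

Lemma measurable_rV_preimage (f : Y -> 'rV[R]_d) (B : 'I_d -> set R) :
  (forall i, measurable_fun setT (fun y => f y 0 i)) ->
  (forall i, measurable (B i)) ->
  measurable [set y | forall i, B i (f y 0 i)].
Proof.
move=> mf mB.
have -> : [set y | forall i, B i (f y 0 i)] =
    \bigcap_(i in [set: 'I_d]) ((fun y => f y 0 i) @^-1` B i).
  apply/seteqP; split => y /=.
    by move=> H i _; exact: H.
  by move=> H i; exact: H.
apply: fin_bigcap_measurable => // i _; rewrite -[X in measurable X]setTI.
exact: mf.
Qed.

(** The loss is evaluated at a random point and at a random sample at once, while continuity in the
    point and measurability in the sample are known only separately. *)
Lemma measurable_caratheodory (g : 'rV[R]_d -> Y -> R) (f : Y -> 'rV[R]_d) :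
  (forall y, continuous (g ^~ y)) -> (forall x, measurable_fun setT (g x)) ->
  (forall i, measurable_fun setT (fun y => f y 0 i)) ->
  measurable_fun setT (fun y => g (f y) y).
Proof.
move=> cg mg mf.
(* Round f down to the grid of mesh 1/(n+1): g o r is measurable, having countably many pieces. *)
pose r n (z : 'rV[int]_d) : 'rV[R]_d := \row_i ((z 0 i)%:~R / n.+1%:R).
pose Z n y : 'rV[int]_d := \row_i Num.floor (n.+1%:R * f y 0 i).
have mZ n z : measurable [set y | Z n y = z].
  have -> : [set y | Z n y = z] = [set y | forall i,
      `[(z 0 i)%:~R / n.+1%:R, (z 0 i + 1)%:~R / n.+1%:R[%classic (f y 0 i)].
    apply/seteqP; split => y /=.
      move=> <- i; rewrite in_itv/= mxE; have := floor_itv (n.+1%:R * f y 0 i).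
      by rewrite ler_pdivrMr// ltr_pdivlMr// mulrC.
    move=> H; apply/rowP => i; rewrite mxE; apply: floor_def.
    have := H i; rewrite in_itv/= ler_pdivrMr// ltr_pdivlMr//.
    by rewrite mulrC.
  apply: (@measurable_rV_preimage f (fun i =>
    `[(z 0 i)%:~R / n.+1%:R, (z 0 i + 1)%:~R / n.+1%:R[%classic)) => // i.
apply: (@measurable_fun_cvg _ _ _ setT (fun n y => g (r n (Z n y)) y)).
  move=> n _ B mB; rewrite setTI.
  have -> : (fun y => g (r n (Z n y)) y) @^-1` B =
      \bigcup_z ([set y | Z n y = z] `&` g (r n z) @^-1` B).
    apply/seteqP; split => y /=.
      by move=> By; exists (Z n y).
    by move=> [z _ [<-]].
  apply: countable_bigcupT_measurable; first exact: countableP.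
  move=> z; apply: measurableI => //; rewrite -[X in measurable X]setTI.
  exact: mg.
move=> y _; apply: (@cvg_comp _ _ _ (fun n => r n (Z n y)) (g ^~ y)); last exact: cg.
apply/cvgrPdist_le => e e0; near=> n.
rewrite [leLHS]mx_normrE; apply: bigmax_le; first exact: ltW.
move=> [i j] _ /=; rewrite !mxE ord1.
have /andP[H1 H2] := floor_itv (n.+1%:R * f y 0 j).
set k := Num.floor _ in H1 H2 *.
have n0 : 0 < n.+1%:R :> R by [].
apply: (@le_trans _ _ n.+1%:R^-1).
  rewrite -(ler_pM2l n0) divff ?gt_eqF// -[X in X * _]ger0_norm ?ltW//.
  rewrite -normrM mulrBr mulrCA divff ?gt_eqF// mulr1.
  rewrite ger0_norm ?subr_ge0//.
  by move: H2; rewrite intrD => H2; lra.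
near: n; exists (Num.truncn e^-1) => // n /= ne.
rewrite invf_ple ?posrE//.
apply: ltW; apply: (lt_le_trans (truncnS_gt _)).
by rewrite ler_nat ltnS.
Unshelve. all: by end_near. Qed.

Lemma measurable_continuous_comp (g : 'rV[R]_d -> R) (f : Y -> 'rV[R]_d) :
  continuous g -> (forall i, measurable_fun setT (fun y => f y 0 i)) ->
  measurable_fun setT (fun y => g (f y)).
Proof.
by move=> cg mf; apply: (@measurable_caratheodory (fun x _ => g x)).
Qed.

Lemma measurable_grad_comp (phi : 'rV[R]_d -> R) (f : Y -> 'rV[R]_d) i :
  (forall y, differentiable (grad phi) y) ->
  (forall i, measurable_fun setT (fun y => f y 0 i)) ->
  measurable_fun setT (fun y => grad phi (f y) 0 i).
Proof.
move=> dgrad mf; apply: (measurable_continuous_comp (g := fun v => grad phi v 0 i)) => // v.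
apply: (@continuous_comp _ _ _ (grad phi) (fun w : 'rV[R]_d => w 0 i)).
  exact: (differentiable_continuous (dgrad v)).
exact: coord_continuous.
Qed.

End caratheodory.

(** * Independence, used as the right to redraw one of two variables *)

Section independence.
Context {R : realType} {dO : measure_display} {Omega : measurableType dO}
  (P : probability Omega R).

(** [Y1] and [Y2] may be [Omega] under smaller sigma-algebras, with [X] or [Z] the identity:
    independence of sigma-algebras is expressed in this way later. *)
Definition independent_maps {d1 d2} {Y1 : measurableType d1} {Y2 : measurableType d2}
    (X : Omega -> Y1) (Z : Omega -> Y2) : Prop :=
  forall A B, measurable A -> measurable B ->
    P (X @^-1` A `&` Z @^-1` B) = (P (X @^-1` A) * P (Z @^-1` B))%E.

Section tonelli.
Context {d1 d2} {Y1 : measurableType d1} {Y2 : measurableType d2}.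
Variables (X : Omega -> Y1) (Z : Omega -> Y2).
Hypotheses (mX : measurable_fun setT X) (mZ : measurable_fun setT Z).
Hypothesis XZ : independent_maps X Z.

Let X' : {mfun Omega >-> Y1} := HB.pack X (isMeasurableFun.Build _ _ _ _ _ mX).
Let Z' : {mfun Omega >-> Y2} := HB.pack Z (isMeasurableFun.Build _ _ _ _ _ mZ).
Let mXZ : measurable_fun setT (fun w => (X w, Z w)).
Proof. exact: measurable_fun_pair. Qed.
Let W' : {mfun Omega >-> (Y1 * Y2)%type} :=
  HB.pack (fun w => (X w, Z w)) (isMeasurableFun.Build _ _ _ _ _ mXZ).

Section ge0.
Variable H : Y1 * Y2 -> \bar R.
Hypotheses (mH : measurable_fun setT H) (H0 : forall y, (0 <= H y)%E).

Let tonelli_inner : fubini_F (distribution P Z') H =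
  fun y => (\int[P]_w' H (y, Z w'))%E.
Proof.
apply/funext => y; rewrite /fubini_F ge0_integral_distribution//.
exact: measurableT_comp mH (pair1_measurable y).
Qed.

Lemma measurable_independent_section :
  measurable_fun setT (fun y => (\int[P]_w' H (y, Z w'))%E).
Proof. rewrite -tonelli_inner; exact: measurable_fun_fubini_tonelli_F. Qed.

(** The law of the pair and the product of the two laws agree on rectangles, hence everywhere. In
    use, [Z] is redrawn while [X] stays frozen. *)
Lemma independent_tonelli :
  (\int[P]_w H (X w, Z w) = \int[P]_w \int[P]_w' H (X w, Z w'))%E.
Proof.
transitivity (\int[distribution P W']_z H z)%E.
  by rewrite ge0_integral_distribution.
transitivity (\int[distribution P X' \x distribution P Z']_z H z)%E.
  apply: eq_measure_integral => A mA _; apply/esym.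
  exact: product_measure_unique.
rewrite fubini_tonelli1// tonelli_inner ge0_integral_distribution//.
  exact: measurable_independent_section.
by move=> y; exact: integral_ge0.
Qed.

End ge0.

Lemma independent_fubini (H : Y1 * Y2 -> \bar R) : measurable_fun setT H ->
  P.-integrable setT (fun w => H (X w, Z w)) ->
  (\int[P]_w H (X w, Z w) = \int[P]_w \int[P]_w' H (X w, Z w'))%E.
Proof.
move=> mH iH.
have mp := measurable_funepos mH; have mn := measurable_funeneg mH.
have compE (U : Type) (g : U -> Y1 * Y2) :
    ((H \o g)^\+ = H^\+ \o g)%E /\ ((H \o g)^\- = H^\- \o g)%E.
  by split; apply/funext => u; rewrite /= !(funeposE, funenegE).
rewrite integralE (compE _ (fun w => (X w, Z w))).1 (compE _ (fun w => (X w, Z w))).2.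
(* Integrability of [H (X, Z)] makes the iterated integrals of both parts finite, so their
   difference may be taken under the outer integral. *)
rewrite !independent_tonelli// -integralB//.
- apply: eq_integral => w _; rewrite [RHS]integralE.
  by rewrite (compE _ (fun w' => (X w, Z w'))).1 (compE _ (fun w' => (X w, Z w'))).2.
- apply/integrableP; split.
    exact: measurableT_comp (measurable_independent_section mp _) mX.
  under eq_integral do rewrite gee0_abs ?integral_ge0//.
  rewrite -independent_tonelli//.
  have := integral_funepos_lt_pinfty measurableT iH.
  by rewrite (compE _ (fun w => (X w, Z w))).1.
- apply/integrableP; split.
    exact: measurableT_comp (measurable_independent_section mn _) mX.
  under eq_integral do rewrite gee0_abs ?integral_ge0//.
  rewrite -independent_tonelli//.
  have := integral_funeneg_lt_pinfty measurableT iH.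
  by rewrite (compE _ (fun w => (X w, Z w))).2.
Qed.

End tonelli.

(** Tonelli applied to [|X| |Y|] gives integrability of the product, after which Fubini factors the
    mean. *)
Lemma independent_mul (X Y : Omega -> R) : independent_maps X Y ->
  P.-integrable setT (EFin \o X) -> P.-integrable setT (EFin \o Y) ->
  P.-integrable setT (EFin \o (fun w => X w * Y w)) /\
  Rintegral P setT (fun w => X w * Y w) = Rintegral P setT X * Rintegral P setT Y.
Proof.
move=> XY iX iY.
have mX : measurable_fun setT X by apply/measurable_EFinP; exact: measurable_int iX.
have mY : measurable_fun setT Y by apply/measurable_EFinP; exact: measurable_int iY.
have iXY : P.-integrable setT (EFin \o (fun w => X w * Y w)).
  apply/integrableP; split; first exact/measurable_EFinP/measurable_funM.
  under eq_integral do rewrite /= normrM.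
  rewrite (independent_tonelli mX mY XY (H := fun z => (`|z.1| * `|z.2|)%:E))//=; last first.
    by apply/measurable_EFinP/measurable_funM; apply: measurableT_comp.
  under eq_integral => w _.
    under eq_integral do rewrite EFinM.
    rewrite ge0_integralZl//; last exact/measurable_EFinP/measurableT_comp.
    over.
  rewrite ge0_integralZr//; last 2 first.
  - exact/measurable_EFinP/measurableT_comp.
  - exact: integral_ge0.
  have /integrableP[_ /= iX1] := iX; have /integrableP[_ /= iY1] := iY.
  by rewrite lte_mul_pinfty ?integral_ge0// ge0_fin_numE// integral_ge0.
split => //.
have /= H := independent_fubini mX mY XY (H := fun z => (z.1 * z.2)%:E).
rewrite /Rintegral H//; last exact/measurable_EFinP/measurable_funM.
have E w : (\int[P]_w' (X w * Y w')%:E = (X w)%:E * \int[P]_w' (Y w')%:E)%E.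
  by under eq_integral do rewrite EFinM; rewrite integralZl.
rewrite (_ : (\int[P]_w \int[P]_w' (X w * Y w')%:E =
    \int[P]_w ((X w)%:E * \int[P]_w' (Y w')%:E))%E); last first.
  by apply: eq_integral => w _; exact: E.
have := integrable_fin_num measurableT iY; rewrite /=.
case: (\int[P]_w' (Y w')%:E)%E => //= r _.
by rewrite integralZr// fineM// integrable_fin_num.
Qed.

End independence.

Section real_integral.
Context {R : realType} {dO : measure_display} {Omega : measurableType dO}
  (P : probability Omega R).

Lemma integrable_dominated (f g : Omega -> R) : measurable_fun setT f ->
  (forall w, `|f w| <= g w) -> P.-integrable setT (EFin \o g) ->
  P.-integrable setT (EFin \o f).
Proof.
move=> mf fg; apply: le_integrable => //; first exact/measurable_EFinP.
by move=> w _; rewrite /= lee_fin ler_normr fg.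
Qed.

Lemma measurable_of_integrable (f : Omega -> R) :
  P.-integrable setT (EFin \o f) -> measurable_fun setT f.
Proof. by move=> /measurable_int/measurable_EFinP. Qed.

Lemma integrable_bounded (f : Omega -> R) (c : R) : measurable_fun setT f ->
  (forall w, `|f w| <= c) -> P.-integrable setT (EFin \o f).
Proof.
move=> mf fc; apply: (integrable_dominated (g := cst c)) => //.
exact: finite_measure_integrable_cst.
Qed.

Lemma integrable_EFinD (f g : Omega -> R) : P.-integrable setT (EFin \o f) ->
  P.-integrable setT (EFin \o g) ->
  P.-integrable setT (EFin \o (fun w => f w + g w)).
Proof. by move=> fi gi; have := integrableD measurableT fi gi. Qed.

Lemma integrable_EFinB (f g : Omega -> R) : P.-integrable setT (EFin \o f) ->
  P.-integrable setT (EFin \o g) ->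
  P.-integrable setT (EFin \o (fun w => f w - g w)).
Proof. by move=> fi gi; have := integrableB measurableT fi gi. Qed.

Lemma integrable_EFinZ (c : R) (f : Omega -> R) : P.-integrable setT (EFin \o f) ->
  P.-integrable setT (EFin \o (fun w => c * f w)).
Proof. by move=> fi; have := integrableZl measurableT c fi. Qed.

Lemma integrable_EFin_sum (I : Type) (s : seq I) (Q : pred I) (f : I -> Omega -> R) :
  (forall i, Q i -> P.-integrable setT (EFin \o f i)) ->
  P.-integrable setT (EFin \o (fun w => \sum_(i <- s | Q i) f i w)).
Proof.
move=> fi.
have -> : EFin \o (fun w => \sum_(i <- s | Q i) f i w) =
    fun w => (\sum_(i <- s | Q i) (f i w)%:E)%E.
  by apply/funext => w /=; rewrite sumEFin.
exact: integrable_sum.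
Qed.

Lemma Rintegral_sum (I : Type) (s : seq I) (Q : pred I) (f : I -> Omega -> R) :
  (forall i, Q i -> P.-integrable setT (EFin \o f i)) ->
  Rintegral P setT (fun w => \sum_(i <- s | Q i) f i w) =
  \sum_(i <- s | Q i) Rintegral P setT (f i).
Proof.
move=> fi; elim: s => [|a s IH].
  by rewrite big_nil; under eq_Rintegral do rewrite big_nil; rewrite Rintegral_cst// mul0r.
rewrite big_cons; under eq_Rintegral do rewrite big_cons.
case: ifPn => Qa; last exact: IH.
by rewrite RintegralD ?IH//; [exact: fi|exact: integrable_EFin_sum].
Qed.

Lemma EFin_Rintegral (f : Omega -> R) : P.-integrable setT (EFin \o f) ->
  (\int[P]_w (f w)%:E)%E = (Rintegral P setT f)%:E.
Proof. by move=> fi; rewrite /Rintegral fineK//; exact: integrable_fin_num. Qed.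

Lemma Rintegral_probability_cst (c : R) : Rintegral P setT (cst c) = c.
Proof. by have := @Rintegral_cst _ _ _ P setT measurableT c; rewrite [X in fine X](_ : _ = 1%E) ?mulr1//; exact: probability_setT. Qed.

Lemma Rintegral_le (f g : Omega -> R) : P.-integrable setT (EFin \o f) ->
  P.-integrable setT (EFin \o g) -> (forall w, f w <= g w) ->
  Rintegral P setT f <= Rintegral P setT g.
Proof. by move=> fi gi fg; apply: le_Rintegral. Qed.

End real_integral.

Section same_law.
Context {R : realType} {d1 d2 dY : measure_display} {O1 : measurableType d1}
  {O2 : measurableType d2} {Y : measurableType dY}
  (P1 : probability O1 R) (P2 : probability O2 R) (Z1 : O1 -> Y) (Z2 : O2 -> Y).
Hypotheses (mZ1 : measurable_fun setT Z1) (mZ2 : measurable_fun setT Z2).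
Hypothesis law : forall B, measurable B -> P1 (Z1 @^-1` B) = P2 (Z2 @^-1` B).

Let Z1' : {mfun O1 >-> Y} := HB.pack Z1 (isMeasurableFun.Build _ _ _ _ _ mZ1).
Let Z2' : {mfun O2 >-> Y} := HB.pack Z2 (isMeasurableFun.Build _ _ _ _ _ mZ2).

(** Two sample spaces are allowed, because a coordinate of a Gaussian vector is compared with
    [normal_prob] and a sample under a conditional law with [Pz]. *)
Lemma same_law_integral (H : Y -> \bar R) : measurable_fun setT H ->
  (forall y, 0 <= H y)%E ->
  (\int[P1]_w H (Z1 w) = \int[P2]_w H (Z2 w))%E.
Proof.
move=> mH H0.
transitivity (\int[distribution P1 Z1']_y H y)%E.
  by rewrite ge0_integral_distribution.
transitivity (\int[distribution P2 Z2']_y H y)%E.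
  by apply: eq_measure_integral => A mA _; exact: law.
by rewrite ge0_integral_distribution.
Qed.

Lemma same_law_integrable (H : Y -> R) : measurable_fun setT H ->
  P1.-integrable setT (fun w => (H (Z1 w))%:E) ->
  P2.-integrable setT (fun w => (H (Z2 w))%:E).
Proof.
move=> mH /integrableP[_ i1]; apply/integrableP; split.
  exact/measurable_EFinP/measurableT_comp.
rewrite /= -(@same_law_integral (fun y => `|H y|%:E))//.
by apply/measurable_EFinP/measurableT_comp.
Qed.

Lemma same_law_Rintegral (H : Y -> R) : measurable_fun setT H ->
  P1.-integrable setT (fun w => (H (Z1 w))%:E) ->
  Rintegral P1 setT (fun w => H (Z1 w)) = Rintegral P2 setT (fun w => H (Z2 w)).
Proof.
move=> mH i1; have i2 := same_law_integrable mH i1.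
have mEH : measurable_fun setT (EFin \o H) by exact/measurable_EFinP.
congr fine.
transitivity (\int[distribution P1 Z1']_y (EFin \o H) y)%E.
  by rewrite integral_distribution.
transitivity (\int[distribution P2 Z2']_y (EFin \o H) y)%E.
  by apply: eq_measure_integral => A mA _; exact: law.
by rewrite integral_distribution.
Qed.

End same_law.

Section square_sum.
Context {R : realType} {d : nat} {dO : measure_display} {Omega : measurableType dO}
  (P : probability Omega R).

Definition mean (X : Omega -> 'rV[R]_d) : 'rV[R]_d :=
  \row_i Rintegral P setT (fun w => X w 0 i).

Definition square_integrable (X : Omega -> 'rV[R]_d) : Prop :=
  (forall i, measurable_fun setT (fun w => X w 0 i)) /\
  P.-integrable setT (EFin \o (fun w => dot (X w) (X w))).

Lemma measurable_dot (X Y : Omega -> 'rV[R]_d) :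
  (forall i, measurable_fun setT (fun w => X w 0 i)) ->
  (forall i, measurable_fun setT (fun w => Y w 0 i)) ->
  measurable_fun setT (fun w => dot (X w) (Y w)).
Proof. by move=> mX mY; apply: measurable_sum => i; exact: measurable_funM. Qed.

Lemma square_integrable_coord (X : Omega -> 'rV[R]_d) i : square_integrable X ->
  P.-integrable setT (EFin \o (fun w => X w 0 i)).
Proof.
move=> [mX iX]; apply: (integrable_dominated (g := fun w => 1 + dot (X w) (X w))) => //.
  move=> w; apply: (le_trans (coord_le_enorm _ _)); rewrite -enorm_sqr.
  by have := sqr_ge0 (enorm (X w) - 1); have := enorm_ge0 (X w); nra.
by apply: integrable_EFinD => //; exact: finite_measure_integrable_cst.
Qed.

Lemma integrable_dot (X Y : Omega -> 'rV[R]_d) : square_integrable X ->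
  square_integrable Y -> P.-integrable setT (EFin \o (fun w => dot (X w) (Y w))).
Proof.
move=> [mX iX] [mY iY].
apply: (integrable_dominated (g := fun w => dot (X w) (X w) + dot (Y w) (Y w))).
- exact: measurable_dot.
- move=> w; apply: (le_trans (normr_dot_le _ _)); rewrite -!enorm_sqr.
  have := sqr_ge0 (enorm (X w) - enorm (Y w)).
  by have := enorm_ge0 (X w); have := enorm_ge0 (Y w); nra.
- exact: integrable_EFinD.
Qed.

Lemma Rintegral_dot_cst (X : Omega -> 'rV[R]_d) (a : 'rV[R]_d) :
  square_integrable X ->
  Rintegral P setT (fun w => dot a (X w)) = dot a (mean X).
Proof.
move=> iX; rewrite Rintegral_sum => [|i _]; last first.
  by apply: integrable_EFinZ; exact: square_integrable_coord.
apply: eq_bigr => i _; rewrite RintegralZl ?mxE//.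
exact: square_integrable_coord.
Qed.

Lemma Rintegral_dot_independent (X Y : Omega -> 'rV[R]_d) :
  square_integrable X -> square_integrable Y ->
  (forall i, independent_maps P (fun w => X w 0 i) (fun w => Y w 0 i)) ->
  Rintegral P setT (fun w => dot (X w) (Y w)) = dot (mean X) (mean Y).
Proof.
move=> iX iY XY.
have H i := independent_mul (XY i) (square_integrable_coord i iX)
  (square_integrable_coord i iY).
rewrite Rintegral_sum => [|i _]; last by case: (H i).
by apply: eq_bigr => i _; rewrite (H i).2 !mxE.
Qed.

Lemma square_integrable_sum (n : nat) (X : 'I_n -> Omega -> 'rV[R]_d) :
  (forall j, square_integrable (X j)) ->
  square_integrable (fun w => \sum_j X j w).
Proof.
move=> iX; split.
  move=> i; under eq_fun do rewrite summxE.
  by apply: measurable_sum => j; exact: (iX j).1.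
under eq_fun do rewrite /= dot_suml.
apply: integrable_EFin_sum => j _; under eq_fun do rewrite /= dot_sumr.
by apply: integrable_EFin_sum => k _; exact: integrable_dot.
Qed.

(** Cross terms factor, coordinate by coordinate, into products of means. For centred samples they
    vanish; for biased directions they remain to be bounded. *)
Lemma Rintegral_square_sum (n : nat) (X : 'I_n -> Omega -> 'rV[R]_d) :
  (forall j, square_integrable (X j)) ->
  (forall j k, j != k -> forall i,
    independent_maps P (fun w => X j w 0 i) (fun w => X k w 0 i)) ->
  Rintegral P setT (fun w => dot (\sum_j X j w) (\sum_j X j w)) =
  \sum_j (Rintegral P setT (fun w => dot (X j w) (X j w)) +
          \sum_(k | k != j) dot (mean (X j)) (mean (X k))).
Proof.
move=> iX XI; under eq_Rintegral do rewrite dot_suml.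
have iXX j k := integrable_dot (iX j) (iX k).
rewrite Rintegral_sum => [|j _]; last first.
  under eq_fun do rewrite /= dot_sumr.
  by apply: integrable_EFin_sum => k _.
apply: eq_bigr => j _; under eq_Rintegral do rewrite dot_sumr.
rewrite Rintegral_sum => [|k _]//.
rewrite (bigD1 j)//=; congr (_ + _); apply: eq_bigr => k kj.
by apply: Rintegral_dot_independent => //; apply: XI; rewrite eq_sym.
Qed.

End square_sum.

(** * The law conditioned on a single event *)

Section conditional_probability.
Context {R : realType} {dO : measure_display} {Omega : measurableType dO}
  (P : probability Omega R) (E : set Omega) (mE : measurable E).

(** For a null event the normalisation falls back on [P] itself, which is why the results on it
    assume [P E != 0]. *)
Definition cond_prob : probability Omega R := mnormalize (mrestr P mE) P.

Hypothesis PE0 : P E != 0%E.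

Lemma cond_probE A : measurable A ->
  cond_prob A = (P (A `&` E) * (fine (P E))^-1%:E)%E.
Proof.
move=> mA.
have e : (mrestr P mE : {measure set Omega -> \bar R}) setT = P E.
  by rewrite /= /mrestr setTI.
rewrite /cond_prob /= /mnormalize e (negPf PE0)/=.
by rewrite lt_eqF// -ge0_fin_numE// fin_num_measure.
Qed.

Lemma cond_prob_integral (f : Omega -> \bar R) : measurable_fun setT f ->
  (forall w, 0 <= f w)%E ->
  (\int[P]_(w in E) f w = P E * \int[cond_prob]_w f w)%E.
Proof.
move=> mf f0.
have PEf : P E = (fine (P E))%:E by rewrite fineK// fin_num_measure.
have PE1 : (0 < fine (P E)).
  by rewrite fine_gt0// lt0e PE0 measure_ge0 -ge0_fin_numE// fin_num_measure.
have k0 : 0 <= (fine (P E))^-1 by rewrite invr_ge0 ltW.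
pose k := NngNum k0.
transitivity (P E * \int[mscale k P]_(w in E) f w)%E.
  rewrite ge0_integral_mscale//; last exact: measurable_funTS.
  by rewrite muleA PEf -EFinM divff ?gt_eqF// mul1e.
congr (_ * _)%E; transitivity (\int[cond_prob]_(w in E) f w)%E.
  apply: eq_measure_integral => A mA AE.
  apply/esym; etransitivity; first exact: (cond_probE mA).
  by rewrite setIidl// muleC.
(* No conditional mass lies outside [E], so enlarging the domain from [E] to the whole space changes
   nothing. *)
have cE : cond_prob (~` E) = 0%E.
  by rewrite cond_probE ?setICl ?measure0 ?mul0e//; exact: measurableC.
rewrite [RHS](ge0_negligible_integral (measurableC mE) measurableT mf _ cE)//.
by rewrite setTD setCK.
Qed.

End conditional_probability.

(** * Gaussian and spherical directions *)

Section normal_expectation.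
Context {R : realType}.
Notation mu := (@lebesgue_measure R).
Notation gauss := (@normal_prob R 0 1).

Lemma normal_pdf01E (t : R) :
  normal_pdf 0 1 t = normal_peak 1 * expR (- (t ^+ 2 / 2)).
Proof. by rewrite normal_pdfE ?oner_neq0// /normal_fun subr0 expr1n mulNr. Qed.

(** The Radon-Nikodym derivative of [normal_prob] is an abstract function; it equals [normal_pdf]
    almost everywhere because both have the same integral over every measurable set. *)
Lemma ge0_integral_normal (f : R -> \bar R) : measurable_fun setT f ->
  (forall t, 0 <= f t)%E ->
  (\int[gauss]_t f t = \int[mu]_t (f t * (normal_pdf 0 1 t)%:E))%E.
Proof.
move=> mf f0; have dom := @normal_prob_dominates R 0 1.
rewrite -(Radon_Nikodym_SigmaFinite.change_of_variables dom f0)//.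
have mg := measurable_int _ (Radon_Nikodym_SigmaFinite.f_integrable dom).
apply: ae_eq_integral => //.
- exact: emeasurable_funM.
- apply: emeasurable_funM => //; apply/measurable_EFinP.
  exact: measurable_normal_pdf.
- apply: ae_eqe_mul2l; apply: integral_ae_eq => //.
  + exact: Radon_Nikodym_SigmaFinite.f_integrable.
  + by apply/measurable_EFinP; exact: measurable_normal_pdf.
  + by move=> A _ mA; rewrite -Radon_Nikodym_SigmaFinite.f_integral.
Qed.

(* The density of N(0, 2) absorbs every polynomial factor of that of N(0, 1). *)
Lemma powerD1_normal_pdf_le (p : nat) : exists2 C : R, 0 <= C &
  forall t, (1 + t ^+ 2) ^+ p * normal_pdf 0 1 t <= C * normal_pdf 0 (Num.sqrt 2) t.
Proof.
wlog : p / (0 < p)%N => [H|].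
  have [C C0 HC] := H p.+1 isT; exists C => // t; apply: le_trans (HC t).
  rewrite ler_wpM2r ?normal_pdf_ge0// (exprS (1 + t ^+ 2) p) ler_peMl//.
  - by rewrite exprn_ge0// addr_ge0// sqr_ge0.
  - by rewrite lerDl sqr_ge0.
case: p => // p _.
have s20 : Num.sqrt 2 != 0 :> R by rewrite sqrtr_eq0 -ltNge.
(* From x^(p+1) <= (p+1)! e^x at x = (1 + t^2)/4: the factor e^(t^2/4) turns the exponent of
   variance 1 into that of variance 2, and the peaks renormalise. *)
pose C : R := 4 ^+ p.+1 * p.+1`!%:R * expR (1 / 4) * normal_peak 1 / normal_peak (Num.sqrt 2).
have k0 : 0 < normal_peak (Num.sqrt 2 : R) by exact: normal_peak_gt0.
exists C.
  by rewrite !(divr_ge0, mulr_ge0, normal_peak_ge0, expR_ge0, exprn_ge0).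
move=> t; rewrite normal_pdf01E [in leRHS]normal_pdfE// /normal_fun subr0 sqr_sqrtr//.
set q : R := normal_peak 1 in C *.
have q0 : 0 <= q by exact: normal_peak_ge0.
have x0 : 0 <= (1 + t ^+ 2) / 4 by rewrite divr_ge0// addr_ge0// sqr_ge0.
have H1 : (1 + t ^+ 2) ^+ p.+1 <= 4 ^+ p.+1 * p.+1`!%:R * expR ((1 + t ^+ 2) / 4).
  have := expR_ge1Dxn p x0; rewrite expr_div_n.
  set e := expR _; set b := (1 + t ^+ 2) ^+ _ => H.
  have f0 : 0 < p.+1`!%:R :> R by rewrite ltr0n fact_gt0.
  have g0 : 0 < 4 ^+ p.+1 :> R by rewrite exprn_gt0.
  have : b / 4 ^+ p.+1 / p.+1`!%:R <= e by apply: le_trans H; rewrite lerDr.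
  rewrite ler_pdivrMr// ler_pdivrMr// => {}H.
  have -> : 4 ^+ p.+1 * p.+1`!%:R * e = e * p.+1`!%:R * 4 ^+ p.+1 by ring.
  exact: H.
have -> : C * (normal_peak (Num.sqrt 2) * expR (- t ^+ 2 / (2 *+ 2))) =
   (4 ^+ p.+1 * p.+1`!%:R * expR ((1 + t ^+ 2) / 4)) * (q * expR (- (t ^+ 2 / 2))).
  have -> : - t ^+ 2 / (2 *+ 2) = - (1 / 4) + ((1 + t ^+ 2) / 4 + - (t ^+ 2 / 2)).
    by rewrite mulr2n; field.
  rewrite !expRD !expRN /C; field.
  by rewrite !gt_eqF// expR_gt0.
by rewrite ler_wpM2r// mulr_ge0 ?expR_ge0.
Qed.

(** The base [1 + t ^+ 2] is at least 1, so bounds with different exponents can be combined. *)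
Definition poly_bounded1 (f : R -> R) := exists C : R, exists p : nat,
  forall t, `|f t| <= C * (1 + t ^+ 2) ^+ p.

Lemma integrable_poly_normal_pdf (f : R -> R) : measurable_fun setT f ->
  poly_bounded1 f -> mu.-integrable setT (EFin \o (fun t => f t * normal_pdf 0 1 t)).
Proof.
move=> mf [C [p fC]]; have [D D0 HD] := powerD1_normal_pdf_le p.
have iD : mu.-integrable setT
    (fun t => (`|C| * D)%:E * (normal_pdf 0 (Num.sqrt 2) t)%:E)%E.
  by apply: integrableZl => //; exact: integrable_normal_pdf.
apply: (le_integrable _ _ _ iD) => //.
- by apply/measurable_EFinP/measurable_funM => //; exact: measurable_normal_pdf.
- move=> t _; rewrite /= lee_fin normrM (ger0_norm (normal_pdf_ge0 _ _ _)).
  rewrite [leRHS]ger0_norm ?mulr_ge0 ?normal_pdf_ge0// -mulrA.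
  apply: le_trans (ler_wpM2l (normr_ge0 C) (HD t)); rewrite mulrA.
  rewrite ler_wpM2r ?normal_pdf_ge0//; apply: (le_trans (fC t)).
  by rewrite ler_wpM2r ?ler_norm// exprn_ge0// addr_ge0// sqr_ge0.
Qed.

Lemma integrable_poly_normal (f : R -> R) : measurable_fun setT f ->
  poly_bounded1 f -> gauss.-integrable setT (EFin \o f).
Proof.
move=> mf fb; apply/integrableP; split; first exact/measurable_EFinP.
rewrite ge0_integral_normal//; last first.
  by apply/measurable_EFinP; exact: measurableT_comp.
have /integrableP[_] := integrable_poly_normal_pdf mf fb.
apply: le_lt_trans; rewrite le_eqVlt; apply/orP; left; apply/eqP.
apply: eq_integral => t _; rewrite /= normrM EFinM.
by rewrite (ger0_norm (normal_pdf_ge0 _ _ _)).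
Qed.

Lemma Rintegral_normal (f : R -> R) : measurable_fun setT f -> poly_bounded1 f ->
  Rintegral gauss setT f = Rintegral mu setT (fun t => f t * normal_pdf 0 1 t).
Proof.
move=> mf fb; congr fine; have mEf : measurable_fun setT (EFin \o f) by exact/measurable_EFinP.
have mp := measurable_funepos mEf; have mn := measurable_funeneg mEf.
rewrite integralE [RHS]integralE !ge0_integral_normal//.
by congr (_ - _)%E; apply: eq_integral => t _;
  rewrite !(funeposE, funenegE)/= -?EFinN -!EFin_max -EFinM maxr_pMl ?normal_pdf_ge0// mul0r ?mulNr.
Qed.

End normal_expectation.

(** * Stein's identity, first on the line and then coordinate by coordinate *)

Section stein1.
Context {R : realType}.
Notation mu := (@lebesgue_measure R).
Notation gauss := (@normal_prob R 0 1).

Lemma is_derive_normal_pdf (t : R) :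
  is_derive t (1 : R) (normal_pdf 0 1) (- t * normal_pdf 0 1 t).
Proof.
have -> : normal_pdf 0 1 = fun t : R => normal_peak 1 *: (expR \o (fun t => (- 2^-1) *: t ^+ 2)) t.
  by apply/funext => u; rewrite normal_pdf01E scaleRE /= scaleRE mulNr mulrC [2^-1 * _]mulrC mulrC.
have H : is_derive t (1 : R) (fun t : R => (- 2^-1) *: t ^+ 2) ((- 2^-1) *: (2%:R * t ^+ 1)).
  by apply: is_deriveZ; exact: is_derive_pow.
have H2 := is_derive1_comp (is_derive_expR _) H.
have := is_deriveZ (normal_peak 1) H2.
rewrite !scaleRE expr1 /= scaleRE.
rewrite (_ : normal_peak 1 * _ = - t * (normal_peak 1 * expR (- 2^-1 * t ^+ 2)))//.
by field.
Qed.

Lemma poly_bounded1_mulX_sub (f g : R -> R) : poly_bounded1 f -> poly_bounded1 g ->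
  poly_bounded1 (fun t => t * f t - g t).
Proof.
move=> [C1 [p1 H1]] [C2 [p2 H2]]; exists (`|C1| + `|C2|), (p1.+1 + p2)%N => t.
have b1 : 1 <= 1 + t ^+ 2 by rewrite lerDl sqr_ge0.
have b0 : 0 <= 1 + t ^+ 2 by apply: le_trans b1.
have tb : `|t| <= 1 + t ^+ 2.
  rewrite -(real_normK (num_real t)).
  by have := sqr_ge0 (`|t| - 1); have := normr_ge0 t; nra.
have bn p : 0 <= (1 + t ^+ 2) ^+ p by rewrite exprn_ge0.
have bn1 p : 1 <= (1 + t ^+ 2) ^+ p by exact: exprn_ege1.
have F1 : `|f t| <= `|C1| * (1 + t ^+ 2) ^+ p1.
  by apply: (le_trans (H1 t)); rewrite ler_wpM2r ?ler_norm.
have F2 : `|g t| <= `|C2| * (1 + t ^+ 2) ^+ p2.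
  by apply: (le_trans (H2 t)); rewrite ler_wpM2r ?ler_norm.
rewrite mulrDl; apply: (le_trans (ler_normB _ _)); apply: lerD.
  rewrite normrM exprD (exprS _ p1).
  apply: (@le_trans _ _ ((1 + t ^+ 2) * (`|C1| * (1 + t ^+ 2) ^+ p1))).
    by apply: ler_pM.
  rewrite mulrCA !mulrA ler_peMr// !mulr_ge0//.
apply: (le_trans F2); rewrite ler_wpM2l// exprD ler_peMl//.
Qed.

Lemma cvg_poly_normal_pdf (f : R -> R) (e : R) : `|e| = 1 -> poly_bounded1 f ->
  (f (e * n.+1%:R) * normal_pdf 0 1 (e * n.+1%:R)) @[n --> \oo] --> (0 : R).
Proof.
move=> e1 [C [p H]].
(* One power more than the growth of [f]: the spare factor [1 + x ^+ 2] provides the decay in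
   [n]. *)
have [D D0 HD] := @powerD1_normal_pdf_le R p.+1.
pose K := normal_peak (Num.sqrt 2 : R).
apply: (@squeeze_cvgr _ _ _ _ (fun n => - (`|C| * D * K * n.+1%:R^-1))
  (fun n => `|C| * D * K * n.+1%:R^-1)).
- apply: nearW => n; rewrite -ler_norml normrM (ger0_norm (normal_pdf_ge0 _ _ _)).
  set x := e * _.
  have x2 : x ^+ 2 = n.+1%:R ^+ 2 by rewrite exprMn -(real_normK (num_real e)) e1 expr1n mul1r.
  have n1 : 0 < n.+1%:R :> R by [].
  have b0 : 0 < 1 + x ^+ 2 by rewrite ltr_pwDl// sqr_ge0.
  rewrite ler_pdivlMr//.
  apply: (@le_trans _ _ (`|C| * ((1 + x ^+ 2) ^+ p.+1 * normal_pdf 0 1 x))).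
    rewrite (exprSr (1 + x ^+ 2) p) mulrAC !mulrA.
    rewrite ler_wpM2r ?normal_pdf_ge0//; apply: ler_pM => //.
      by apply: (le_trans (H x)); rewrite ler_wpM2r ?ler_norm// exprn_ge0// ltW.
    rewrite x2; have := sqr_ge0 (n.+1%:R - 1 : R); nra.
  rewrite -[leRHS]mulrA ler_wpM2l//; apply: (le_trans (HD x)).
  rewrite ler_wpM2l//; apply: normal_pdf_ub.
  by rewrite sqrtr_eq0 -ltNge.
- rewrite -oppr0; apply: cvgN; rewrite -[X in _ --> X](mulr0 (`|C| * D * K)).
  by apply: cvgMr; exact: cvg_harmonic.
- rewrite -[X in _ --> X](mulr0 (`|C| * D * K)).
  by apply: cvgMr; exact: cvg_harmonic.
Qed.

(** The derivative of the density is [- t] times the density, so the integrand times the density is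
    the derivative of [k], and the boundary values of [k] vanish at infinity by polynomial
    growth. *)
Lemma stein1 (f f' : R -> R) : continuous f' ->
  (forall t, is_derive t (1 : R) f (f' t)) -> poly_bounded1 f -> poly_bounded1 f' ->
  Rintegral gauss setT (fun t => t * f t - f' t) = 0.
Proof.
move=> cf' df pf pf'.
have cf : continuous f.
  by move=> t; apply/differentiable_continuous/derivable1_diffP; exact: ex_derive.
have cpdf := @continuous_normal_pdf R 0 1 (oner_neq0 R).
have mf := continuous_measurable_fun cf; have mf' := continuous_measurable_fun cf'.
have mh : measurable_fun setT (fun t : R => t * f t - f' t).
  by apply: measurable_funB => //; exact: measurable_funM.
have pb := poly_bounded1_mulX_sub pf pf'.
rewrite Rintegral_normal//.
set h := fun t => _ * normal_pdf 0 1 t.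
have ih : mu.-integrable setT (EFin \o h) by exact: integrable_poly_normal_pdf.
pose k (t : R) := - (f t * normal_pdf 0 1 t).
have dk t : is_derive t (1 : R) k (h t).
  have := is_deriveN (is_deriveM (df t) (is_derive_normal_pdf t)).
  rewrite !scaleRE (_ : - (_ + _) = h t)//.
  by rewrite /h; ring.
have ch : continuous h.
  move=> t; apply: cvgM; last exact: cpdf.
  apply: cvgB; last exact: cf'.
  by apply: cvgM; [exact: cvg_id|exact: cf].
have mEh : measurable_fun setT (EFin \o h) by apply/measurable_EFinP; exact: continuous_measurable_fun.
(* Over these growing intervals the fundamental theorem gives boundary values, while dominated
   convergence recovers the full integral. *)
pose I (n : nat) := `[- n.+1%:R, n.+1%:R]%classic : set R.
pose hn (n : nat) := (EFin \o h) \_ (I n).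
have mhn n : measurable_fun setT (hn n).
  by apply/(measurable_restrictT _ (measurable_itv _)); exact: measurable_funTS.
have hnh : {ae mu, forall t, setT t -> hn ^~ t @ \oo --> (EFin \o h) t}.
  apply: aeW => t _; apply: cvg_near_cst; exists (Num.truncn `|t|) => // n /= tn.
  have It : I n t.
    rewrite /I /= in_itv/= -ler_norml.
    apply: ltW; apply: (lt_le_trans (truncnS_gt _)).
    by rewrite ler_nat ltnS.
  by rewrite /hn patchE mem_set.
have hnb : {ae mu, forall t n, setT t -> (`|hn n t| <= (abse \o (EFin \o h)) t)%E}.
  by apply: aeW => t n _; rewrite /hn patchE; case: ifPn => _ //=; rewrite lee_fin normr0.
have [_ _ cI] := @dominated_convergence _ _ _ mu setT measurableT
  hn _ _ mhn mEh hnh (integrable_abse ih) hnb.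
have FTC n : (\int[mu]_t hn n t = (k n.+1%:R)%:E - (k (- n.+1%:R))%:E)%E.
  rewrite /hn -integral_mkcond; apply: continuous_FTC2.
  - by rewrite -subr_gt0 opprK addr_gt0.
  - exact: continuous_subspaceT.
  - have ck : continuous k.
      by move=> t; apply/differentiable_continuous/derivable1_diffP; exact: ex_derive.
    split => [t _||]; first exact: ex_derive.
      by apply: cvg_at_right_filter; exact: ck.
    by apply: cvg_at_left_filter; exact: ck.
  - by move=> t _; rewrite derive1E derive_val.
have k0 : (k n.+1%:R - k (- n.+1%:R)) @[n --> \oo] --> (0 : R).
  have c1 := cvg_poly_normal_pdf (normr1 _) pf.
  have c2 := cvg_poly_normal_pdf (normrN1 _) pf.
  have -> : (fun n => k n.+1%:R - k (- n.+1%:R)) = (fun n =>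
      f (-1 * n.+1%:R) * normal_pdf 0 1 (-1 * n.+1%:R) -
      f (1 * n.+1%:R) * normal_pdf 0 1 (1 * n.+1%:R)).
    by apply/funext => n; rewrite /k mul1r mulN1r opprK addrC.
  by have := cvgB c2 c1; rewrite subr0; apply.
have : (\int[mu]_t (EFin \o h) t = 0)%E.
  apply: (cvg_unique _ cI) => //.
  rewrite (_ : (fun n => _) = EFin \o (fun n => k n.+1%:R - k (- n.+1%:R))); last first.
    by apply/funext => n; exact: FTC.
  by apply: cvg_EFin k0; exact: nearW.
by rewrite /Rintegral => ->.
Qed.

End stein1.

Section independence_extension.
Context {R : realType} {dO : measure_display} {Omega : measurableType dO}
  (P : probability Omega R).

(** As functions of [A] both sides are finite measures that agree on the pi-system [G], hence on the
    sigma-algebra it generates. *)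
Lemma independent_sigma (G : set (set Omega)) (E : set Omega) :
  G `<=` measurable -> setI_closed G -> G setT -> measurable E ->
  (forall A, G A -> P (A `&` E) = P A * P E)%E ->
  forall A, <<s G >> A -> (P (A `&` E) = P A * P E)%E.
Proof.
move=> mG IG GT mE H A sA.
have PE : P E = (fine (P E))%:E by rewrite fineK// fin_num_measure.
have k0 : 0 <= fine (P E) by rewrite fine_ge0.
pose k := NngNum k0.
rewrite [in RHS]PE muleC.
apply: (@g_sigma_algebra_measure_unique _ _ _ G mG (fun=> setT) (fun=> GT) _
  (mrestr P mE) (mscale k P)) => //.
- by rewrite bigcup_const//; exists 0%N.
- move=> B GB; rewrite /= /mrestr /mscale/= H// [in LHS]PE muleC//.
- move=> _; rewrite /= /mrestr; apply: le_lt_trans (ltry 1).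
  by apply: probability_le1; exact: measurableI.
Qed.

End independence_extension.

Section stein.
Context {R : realType} {d : nat}.
Hypothesis hd : (0 < d)%N.
Implicit Types (x y : 'rV[R]_d).

Definition poly_bounded (g : 'rV[R]_d -> R) := exists C : R, exists p : nat,
  forall x, `|g x| <= C * (1 + dot x x) ^+ p.

Lemma poly_bounded_powD1 (g : 'rV[R]_d -> R) : poly_bounded g ->
  exists C : R, exists p : nat, 0 <= C /\ forall x, `|g x| <= C * (1 + dot x x) ^+ p.
Proof.
move=> [C [p H]]; exists `|C|, p; split => // x; apply: (le_trans (H x)).
by rewrite ler_wpM2r ?ler_norm// exprn_ge0// addr_ge0// dot_ge0.
Qed.

Lemma poly_bounded_mul (f g : 'rV[R]_d -> R) : poly_bounded f -> poly_bounded g ->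
  poly_bounded (fun x => f x * g x).
Proof.
move=> [C [p H]] [D [q K]]; exists (C * D), (p + q)%N => x.
by rewrite normrM exprD mulrACA ler_pM.
Qed.

Lemma poly_bounded_add (f g : 'rV[R]_d -> R) : poly_bounded f -> poly_bounded g ->
  poly_bounded (fun x => f x + g x).
Proof.
move=> /poly_bounded_powD1[C [p [C0 H]]] /poly_bounded_powD1[D [q [D0 K]]].
exists (C + D), (p + q)%N => x; apply: (le_trans (ler_normD _ _)).
have b1 : 1 <= 1 + dot x x by rewrite lerDl dot_ge0.
rewrite mulrDl; apply: lerD; [apply: (le_trans (H x))|apply: (le_trans (K x))];
  by rewrite ler_wpM2l// ler_weXn2l// ?leq_addr// leq_addl.
Qed.

Lemma poly_bounded_cst (c : R) : poly_bounded (fun _ => c).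
Proof. by exists `|c|, 0%N => x; rewrite expr0 mulr1. Qed.

Lemma poly_bounded_of_le (f : 'rV[R]_d -> R) (C : R) (p : nat) : 0 <= C ->
  (forall x, `|f x| <= C * enorm x ^+ p) -> poly_bounded f.
Proof.
move=> C0 H; exists C, p => x; apply: (le_trans (H x)).
rewrite ler_wpM2l// lerXn2r ?nnegrE ?enorm_ge0 ?addr_ge0 ?dot_ge0//.
by rewrite -enorm_sqr; have := sqr_ge0 (enorm x - 1); have := enorm_ge0 x; nra.
Qed.

Lemma poly_bounded_dotl (a : 'rV[R]_d) : poly_bounded (dot a).
Proof.
apply: (@poly_bounded_of_le _ (enorm a) 1) => [|x]; first exact: enorm_ge0.
by rewrite expr1 normr_dot_le.
Qed.

Lemma poly_bounded_dot : poly_bounded (fun x => dot x x).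
Proof.
apply: (@poly_bounded_of_le _ 1 2) => // x.
by rewrite mul1r enorm_sqr ger0_norm ?dot_ge0.
Qed.

Lemma poly_bounded_exp (f : 'rV[R]_d -> R) m : poly_bounded f ->
  poly_bounded (fun x => f x ^+ m).
Proof.
move=> pf; elim: m => [|m IH]; first exact: poly_bounded_cst.
by under eq_fun do rewrite exprS; exact: poly_bounded_mul.
Qed.

Lemma poly_bounded_coord i : poly_bounded (fun x => x 0 i).
Proof.
by apply: (@poly_bounded_of_le _ 1 1) => // x; rewrite mul1r expr1 coord_le_enorm.
Qed.

Lemma continuous_dotl (a : 'rV[R]_d) : continuous (dot a).
Proof.
apply: (@continuous_big R^o); first exact: (@add_continuous R^o).
by move=> i _ x; apply: continuousM; [exact: cst_continuous|exact: coord_continuous].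
Qed.

Lemma continuous_dot : continuous (fun x : 'rV[R]_d => dot x x).
Proof.
apply: (@continuous_big R^o); first exact: (@add_continuous R^o).
by move=> i _ x; apply: continuousM; exact: coord_continuous.
Qed.

Lemma is_derive_line_dotl (a x h : 'rV[R]_d) (t : R) :
  is_derive t (1 : R) (fun s => dot a (x + s *: h)) (dot a h).
Proof.
have -> : (fun s => dot a (x + s *: h)) = (fun s => dot a x + dot a h *: s).
  by apply/funext => s; rewrite !dotE scaleRE mulrC.
rewrite -[X in is_derive _ _ _ X]add0r -[X in is_derive _ _ _ (_ + X)]mulr1.
by apply: is_deriveD; apply: is_deriveZ.
Qed.

Lemma is_derive_line_dot (x h : 'rV[R]_d) (t : R) :
  is_derive t (1 : R) (fun s => dot (x + s *: h) (x + s *: h))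
    (2 * dot (x + t *: h) h).
Proof.
have -> : (fun s => dot (x + s *: h) (x + s *: h)) =
    (fun s => dot x x + ((2 * dot x h) *: s + dot h h *: s ^+ 2)).
  by apply/funext => s; rewrite !dotE !scaleRE (dotC h x); ring.
rewrite [X in is_derive _ _ _ X](_ : _ =
    0 + ((2 * dot x h) *: 1 + dot h h *: (2%:R * t ^+ 1))).
  by apply: is_deriveD; apply: is_deriveD; apply: is_deriveZ; exact: is_derive_pow.
by rewrite !scaleRE !dotE; ring.
Qed.

Context {dO : measure_display} {Omega : measurableType dO} (P : probability Omega R).
Variable u : Omega -> 'rV[R]_d.
Hypothesis mu : forall i, measurable_fun setT (fun w => u w 0 i).
Hypothesis gu : std_gaussian P u.

Lemma std_gaussian_coord i B : measurable B ->
  P ((fun w => u w 0 i) @^-1` B) = normal_prob 0 1 B.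
Proof.
move=> mB; have := gu (B := fun j => if j == i then B else setT).
rewrite (bigD1 i)//= eqxx big1 ?mule1; last first.
  by move=> j /negPf->; exact: probability_setT.
move=> <-; last by move=> j; case: ifP.
congr (P _); apply/seteqP; split => w /=; last by move/(_ i); rewrite eqxx.
by move=> Bw j; case: eqP => // ->.
Qed.

Lemma integrable_gaussian_coord (f : R -> R) i : measurable_fun setT f ->
  poly_bounded1 f -> P.-integrable setT (EFin \o (fun w => f (u w 0 i))).
Proof.
move=> mf pf.
have := @same_law_integrable _ _ _ _ _ _ _ (normal_prob 0 1) P id
  (fun w => u w 0 i) (@measurable_id _ _ _) (mu i) _ f mf.
apply; first by move=> B mB; rewrite std_gaussian_coord.
exact: integrable_poly_normal.
Qed.

Lemma integrable_gaussian (g : 'rV[R]_d -> R) : continuous g -> poly_bounded g ->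
  P.-integrable setT (EFin \o (fun w => g (u w))).
Proof.
move=> cg /poly_bounded_powD1[C [p [C0 H]]].
apply: (integrable_dominated (g := fun w =>
  C * \sum_k (d.+1%:R ^+ p * (1 + u w 0 k ^+ 2) ^+ p))).
- exact: measurable_continuous_comp.
- move=> w; apply: (le_trans (H _)); rewrite ler_wpM2l//.
  set i0 := Ordinal hd; set x := u w.
  (* For the largest coordinate, [1 + |x|^2 <= (d + 1) (1 + x_k^2)]; summing over all [k] removes
     the dependence of [k] on the outcome and leaves one-dimensional integrals. *)
  pose k := [arg max_(k > i0) (x 0 k ^+ 2)]%O.
  have kP j : x 0 j ^+ 2 <= x 0 k ^+ 2.
    by rewrite /k; case: Order.TotalTheory.arg_maxP => // k' _; apply.
  rewrite (bigD1 k)//=; apply: (@le_trans _ _ (d.+1%:R ^+ p * (1 + x 0 k ^+ 2) ^+ p)); last first.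
    by rewrite lerDl sumr_ge0// => j _; rewrite mulr_ge0// exprn_ge0// addr_ge0// sqr_ge0.
  rewrite -exprMn lerXn2r ?nnegrE ?addr_ge0 ?mulr_ge0 ?dot_ge0 ?addr_ge0 ?sqr_ge0//.
  rewrite mulrDr mulr1; apply: lerD; first by rewrite ler1n.
  apply: (@le_trans _ _ (\sum_(j < d) x 0 k ^+ 2)).
    by apply: ler_sum => j _; rewrite -expr2.
  rewrite sumr_const card_ord -[leLHS]mulr_natl ler_wpM2r ?sqr_ge0//.
  by rewrite ler_nat.
- apply: integrable_EFinZ; apply: integrable_EFin_sum => k _.
  apply: integrable_EFinZ.
  apply: (@integrable_gaussian_coord (fun t => (1 + t ^+ 2) ^+ p)).
    by apply: measurable_funX; apply: measurable_funD => //; exact: measurable_funX.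
  by exists 1, p => t; rewrite mul1r ger0_norm// exprn_ge0// addr_ge0// sqr_ge0.
Qed.

Section coordinate.
Variable i : 'I_d.
Let e : 'rV[R]_d := delta_mx 0 i.

(** Cylinder events on the coordinates other than [i]: a pi-system, so that independence from
    coordinate [i] extends to the sigma-algebra they generate. *)
Let rest : set (set Omega) := [set A | exists B : 'I_d -> set R,
  (forall j, measurable (B j)) /\
  A = [set w | forall j, j != i -> B j (u w 0 j)]].

Let rest_measurable : rest `<=` measurable.
Proof.
move=> _ [B [mB ->]].
have -> : [set w | forall j, j != i -> B j (u w 0 j)] =
    [set w | forall j, (if j == i then setT else B j) (u w 0 j)].
  apply/seteqP; split => w /= H j; first by case: eqP => // /eqP; exact: H.
  by move=> /negPf ji; have := H j; rewrite ji.
apply: (@measurable_rV_preimage _ _ _ _ u (fun j => if j == i then setT else B j)) => // j.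
by case: ifP.
Qed.

Let rest_setI : setI_closed rest.
Proof.
move=> _ _ [B [mB ->]] [C [mC ->]]; exists (fun j => B j `&` C j).
split; first by move=> j; exact: measurableI.
by apply/seteqP; split => w /=; [move=> [H K] j ji; split; [exact: H|exact: K]|
  move=> H; split => j /H[]].
Qed.

Let rest_setT : rest setT.
Proof. by exists (fun=> setT); split => //; apply/seteqP; split. Qed.

Let rest_independent (A : set Omega) (B : set R) : <<s rest >> A -> measurable B ->
  P (A `&` (fun w => u w 0 i) @^-1` B) = (P A * P ((fun w => u w 0%R i) @^-1` B))%E.
Proof.
move=> sA mB; apply: (@independent_sigma _ _ _ _ rest) => //.
  by rewrite -[X in measurable X]setTI; exact: mu.
move=> _ [C [mC ->]].
have PC : P [set w | forall j, j != i -> C j (u w 0 j)] =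
    (\big[*%E/1]_(j < d | j != i) normal_prob 0 1 (C j))%E.
  have := gu (B := fun j => if j == i then setT else C j).
  rewrite (bigD1 i)//= eqxx probability_setT mul1e => H.
  rewrite (eq_bigr (fun j => normal_prob 0 1 (if j == i then setT else C j))); last first.
    by move=> j /negPf->.
  rewrite -H; last by move=> j; case: ifP.
  congr (P _); apply/seteqP; split => w /= K j.
    by case: eqP => // /eqP; exact: K.
  by move=> /negPf ji; have := K j; rewrite ji.
rewrite PC std_gaussian_coord// muleC.
have := gu (B := fun j => if j == i then B else C j).
rewrite (bigD1 i)//= eqxx => H.
rewrite (eq_bigr (fun j => normal_prob 0 1 (if j == i then B else C j))); last first.
  by move=> j /negPf->.
rewrite -H; last by move=> j; case: ifP.
congr (P _); apply/seteqP; split => w /=.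
  by move=> [K Bw] j; case: eqP => [->//|/eqP]; exact: K.
move=> K; split; last by have := K i; rewrite eqxx.
by move=> j /negPf ji; have := K j; rewrite ji.
Qed.

(** By independence the other coordinates are frozen, and the inner integral over coordinate [i] is
    zero by [stein1]. *)
Lemma gaussian_stein (g g' : 'rV[R]_d -> R) : continuous g -> continuous g' ->
  (forall x t, is_derive t (1 : R) (fun s => g (x + s *: e)) (g' (x + t *: e))) ->
  poly_bounded g -> poly_bounded g' ->
  Rintegral P setT (fun w => u w 0 i * g (u w)) = Rintegral P setT (fun w => g' (u w)).
Proof.
move=> cg cg' dg pg pg'.
(* This is [u] with coordinate [i] set to zero, hence measurable for the sigma-algebra generated by
   [rest]. *)
pose y w := u w - u w 0 i *: e.
have yE w : y w + u w 0 i *: e = u w by rewrite subrK.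
have y_i w : y w 0 i = 0 by rewrite !mxE !eqxx mulr1 subrr.
have y_j w j : j != i -> y w 0 j = u w 0 j.
  by move=> /negPf ji; rewrite !mxE ji andbF mulr0 subr0.
pose Y1 := g_sigma_algebraType rest.
have mid : measurable_fun setT (id : Omega -> Y1).
  move=> _ A sA; rewrite setTI preimage_id.
  by apply: smallest_sub sA => //; exact: sigma_algebra_measurable.
have my j : measurable_fun setT (fun w : Y1 => y w 0 j).
  have [->|ji] := eqVneq j i.
    by under eq_fun do rewrite y_i; exact: measurable_cst.
  move=> _ B mB; rewrite setTI; apply: sub_sigma_algebra.
  exists (fun k => if k == j then B else setT); split; first by move=> k; case: ifP.
  apply/seteqP; split => w /=.
    by rewrite y_j// => Bw k ki; case: eqP => // ->.
  by move=> /(_ j ji); rewrite eqxx y_j.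
have XZ : independent_maps P (id : Omega -> Y1) (fun w => u w 0 i).
  by move=> A B mA mB; exact: rest_independent.
pose H (z : Y1 * R) := z.2 * g (y z.1 + z.2 *: e) - g' (y z.1 + z.2 *: e).
have mc j : measurable_fun setT (fun z : Y1 * R => (y z.1 + z.2 *: e) 0 j).
  under eq_fun do rewrite mxE [X in _ + X]mxE.
  apply: measurable_funD.
    exact: (measurableT_comp (my j) measurable_fst).
  exact: measurable_funM.
have mH : measurable_fun setT H.
  apply: measurable_funB; last exact: measurable_continuous_comp.
  by apply: measurable_funM => //; exact: measurable_continuous_comp.
have iug : P.-integrable setT (EFin \o (fun w => u w 0 i * g (u w))).
  apply: (@integrable_gaussian (fun x => x 0 i * g x)).
    by move=> x; apply: continuousM; [exact: coord_continuous|exact: cg].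
  by apply: poly_bounded_mul => //; exact: poly_bounded_coord.
have ig' := integrable_gaussian cg' pg'.
have iH : P.-integrable setT (fun w => (H (id w, u w 0 i))%:E).
  rewrite [X in P.-integrable _ X](_ : _ = EFin \o (fun w => u w 0 i * g (u w) - g' (u w))).
    exact: integrable_EFinB.
  by apply/funext => w; rewrite /H /= yE.
(* As [y w] is orthogonal to [e], the base [1 + |y w|^2 + t^2] is at most
   [(1 + |y w|^2) (1 + t^2)]. *)
have pb (h : 'rV[R]_d -> R) w : poly_bounded h -> poly_bounded1 (fun t => h (y w + t *: e)).
  move=> /poly_bounded_powD1[C [p [C0 K]]].
  exists (C * (1 + dot (y w) (y w)) ^+ p), p => t.
  apply: (le_trans (K _)); rewrite -mulrA -exprMn ler_wpM2l//.
  rewrite lerXn2r ?nnegrE ?mulr_ge0 ?addr_ge0 ?dot_ge0 ?sqr_ge0//.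
  have -> : dot (y w + t *: e) (y w + t *: e) = dot (y w) (y w) + t ^+ 2.
    move: (y w) (y_i w) => z zi.
    by rewrite /e !dotE (dotC (delta_mx 0 i) z) !dot_delta zi mxE !eqxx /=; ring.
  have := dot_ge0 (y w); have := sqr_ge0 t; nra.
apply/eqP; rewrite -subr_eq0 -RintegralB//; apply/eqP.
have mEH : measurable_fun setT (EFin \o H) by exact/measurable_EFinP.
have := independent_fubini mid (mu i) XZ mEH iH.
rewrite /Rintegral => E0.
rewrite (_ : (\int[P]_w (u w 0 i * g (u w) - g' (u w))%R%:E =
   \int[P]_w (EFin \o H) (id w, u w 0%R i))%E); last first.
  by apply: eq_integral => w _; rewrite /= /H/= yE.
rewrite E0; suff E1 w : (\int[P]_w' (EFin \o H) (id w, u w' 0%R i) = 0)%E.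
  by under eq_integral do rewrite E1; rewrite integral0.
have mHw : measurable_fun setT (fun t : R => H (w, t)).
  exact: (measurableT_comp mH (pair1_measurable w)).
have pHw : poly_bounded1 (fun t : R => H (w, t)).
  by apply: poly_bounded1_mulX_sub; [exact: (pb g)|exact: (pb g')].
have iHw : (@normal_prob R 0 1).-integrable setT (EFin \o (fun t : R => H (w, t))).
  exact: integrable_poly_normal.
have law B : measurable B -> normal_prob 0 1 (id @^-1` B) =
    P ((fun w => u w 0 i) @^-1` B).
  by move=> mB; rewrite std_gaussian_coord.
have RE := same_law_Rintegral (P1 := normal_prob 0 1) (@measurable_id _ _ _) (mu i) law mHw iHw.
have iHu := same_law_integrable (P1 := normal_prob 0 1) (@measurable_id _ _ _) (mu i) law mHw iHw.
rewrite (EFin_Rintegral iHu) -RE; congr EFin.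
apply: (stein1 (f := fun t => g (y w + t *: e)) (f' := fun t => g' (y w + t *: e))).
- move=> t; apply: continuous_comp; last exact: cg'.
  apply: continuousD; first exact: cst_continuous.
  by apply: (@scalel_continuous R 'rV[R]_d).
- exact: (pb g w pg).
- exact: (pb g' w pg').
Qed.

End coordinate.
End stein.

Section continuity.
Context {R : realType} {U : topologicalType}.
Implicit Types f g : U -> R.

Lemma continuous_mul f g : continuous f -> continuous g ->
  continuous (fun y => f y * g y).
Proof. by move=> cf cg y; apply: continuousM; [exact: cf|exact: cg]. Qed.

Lemma continuous_add f g : continuous f -> continuous g ->
  continuous (fun y => f y + g y).
Proof. by move=> cf cg y; apply: continuousD; [exact: cf|exact: cg]. Qed.

Lemma continuous_const (c : R) : continuous (fun _ : U => c).
Proof. exact: cst_continuous. Qed.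

Lemma continuous_affine_comp {d : nat} (g : 'rV[R]_d -> U) (x : 'rV[R]_d) (k : R) :
  continuous g -> continuous (fun v : 'rV[R]_d => g (x + k *: v)).
Proof.
move=> cg v; apply: (@continuous_comp _ _ _ (fun v : 'rV[R]_d => x + k *: v) g); last exact: cg.
by apply: (@continuousD _ _ _ (fun=> x)); [exact: cst_continuous|exact: scaler_continuous].
Qed.

End continuity.

(** * Deterministic bounds on central differences *)

Section central_difference.
Context {R : realType} {d : nat}.
Variables (phi : 'rV[R]_d -> R) (M nu : R) (x : 'rV[R]_d).
Hypothesis dphi : forall y, differentiable phi y.
Hypothesis dgrad : forall y, differentiable (grad phi) y.
Hypothesis lhess : hess_lipschitz M phi.
Hypotheses (M0 : 0 <= M) (nu0 : 0 < nu).

Lemma central_diff_remainder u :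
  `|central_diff phi nu x u - dot (grad phi x) u| <= M * nu ^+ 2 / 6 * enorm u ^+ 3.
Proof.
have := central_diff_err dphi dgrad lhess x (nu *: u).
rewrite enormZ (gtr0_norm nu0) dotZr /central_diff.
have -> : phi (x + nu *: u) - phi (x - nu *: u) - 2 * (nu * dot (grad phi x) u) =
    (2 * nu) * ((phi (x + nu *: u) - phi (x - nu *: u)) / (2 * nu) - dot (grad phi x) u).
  by field; rewrite gt_eqF.
rewrite normrM gtr0_norm ?mulr_gt0// => H.
by rewrite -(ler_pM2l (mulr_gt0 (ltr0Sn R 1) nu0)); apply: (le_trans H); rewrite exprMn; lra.
Qed.

Lemma continuous_central_diff : continuous (central_diff phi nu x).
Proof.
have cphi : continuous phi by move=> y; exact: differentiable_continuous.
have cd : continuous (fun v : 'rV[R]_d => phi (x - nu *: v)).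
  by under eq_fun do rewrite -scaleNr; exact: continuous_affine_comp.
apply: continuous_mul; last exact: continuous_const.
by move=> v; apply: continuousB; [exact: (continuous_affine_comp cphi)|exact: cd].
Qed.

(** With [y] the linear part and [r] the remainder, [3/2 y^2 + 3 r^2 - (y + r)^2] is the perfect
    square [(y - 2 r)^2 / 2]; the uneven weights keep the leading coefficient small. *)
Lemma central_diff_sqr_le u : central_diff phi nu x u ^+ 2 <=
  3 / 2 * dot (grad phi x) u ^+ 2 + 3 * (M ^+ 2 * nu ^+ 4 / 36) * dot u u ^+ 3.
Proof.
set r := central_diff phi nu x u - dot (grad phi x) u.
have -> : central_diff phi nu x u = dot (grad phi x) u + r by rewrite /r; ring.
have : r ^+ 2 <= (M * nu ^+ 2 / 6 * enorm u ^+ 3) ^+ 2.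
  rewrite -real_normK ?num_real// lerXn2r ?nnegrE ?central_diff_remainder//.
  by rewrite !mulr_ge0// ?exprn_ge0 ?enorm_ge0// ltW.
have -> : (M * nu ^+ 2 / 6 * enorm u ^+ 3) ^+ 2 = M ^+ 2 * nu ^+ 4 / 36 * dot u u ^+ 3.
  by rewrite -enorm_sqr; field.
have := sqr_ge0 (dot (grad phi x) u - 2 * r).
move: (dot (grad phi x) u) (dot u u ^+ 3) => y S; lra.
Qed.

(** The averaged gradient is the gradient of [central_diff] in the direction variable, and its
    deviation becomes the bias of the Gaussian estimator. *)
Lemma enorm_avg_grad u :
  enorm (2^-1 *: (grad phi (x + nu *: u) + grad phi (x - nu *: u)) - grad phi x) <=
  M * nu ^+ 2 / 2 * dot u u.
Proof.
have -> : 2^-1 *: (grad phi (x + nu *: u) + grad phi (x - nu *: u)) - grad phi x =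
    2^-1 *: (grad phi (x + nu *: u) + grad phi (x - nu *: u) - 2 *: grad phi x).
  by rewrite scalerBr scalerA mulVf// scale1r.
rewrite enormZ ger0_norm ?invr_ge0//.
have := enorm_grad_second_diff dgrad lhess x (nu *: u) M0.
by rewrite dotZl dotZr; nra.
Qed.

End central_difference.

Section gaussian_moments.
Context {R : realType} {d : nat}.
Hypothesis hd : (0 < d)%N.
Context {dO : measure_display} {Omega : measurableType dO} (P : probability Omega R).
Variable u : Omega -> 'rV[R]_d.
Hypothesis mu : forall i, measurable_fun setT (fun w => u w 0 i).
Hypothesis gu : std_gaussian P u.
Notation E f := (Rintegral P setT (fun w => f (u w))).

Lemma continuous_dot_exp m : continuous (fun y : 'rV[R]_d => dot y y ^+ m).
Proof.
move=> y; apply: (@continuous_comp _ _ _ (fun y : 'rV[R]_d => dot y y) (fun t : R => t ^+ m)).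
  exact: continuous_dot.
exact: exprn_continuous.
Qed.

Lemma is_derive_line_dot_exp (y h : 'rV[R]_d) m (t : R) :
  is_derive t (1 : R) (fun s => dot (y + s *: h) (y + s *: h) ^+ m)
    (m%:R * dot (y + t *: h) (y + t *: h) ^+ m.-1 * (2 * dot (y + t *: h) h)).
Proof.
have := @is_deriveX R R (fun s => dot (y + s *: h) (y + s *: h)) m t 1 _ (is_derive_line_dot y h t).
by rewrite exprfctE scaleRE.
Qed.

Lemma integrable_gaussian_dot_exp m :
  P.-integrable setT (EFin \o (fun w => dot (u w) (u w) ^+ m)).
Proof.
apply: (integrable_gaussian hd mu gu (g := fun y => dot y y ^+ m)).
  exact: continuous_dot_exp.
by apply: poly_bounded_exp; exact: poly_bounded_dot.
Qed.

(** Stein's identity in coordinate [i] for [a_i <a, y> |y|^(2m)], summed over [i]. At [m = 0] the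
    exponent [m.-1] is 0, and its coefficient vanishes. *)
Lemma gaussian_quadratic_moment (a : 'rV[R]_d) m :
  E (fun y => dot a y ^+ 2 * dot y y ^+ m) =
  dot a a * E (fun y => dot y y ^+ m) +
  2 * m%:R * E (fun y => dot a y ^+ 2 * dot y y ^+ m.-1).
Proof.
pose g i (y : 'rV[R]_d) := a 0 i * (dot a y * dot y y ^+ m).
pose g' i (y : 'rV[R]_d) := a 0 i * (dot a y * (m%:R * dot y y ^+ m.-1 * (2 * y 0 i))
  + dot y y ^+ m * a 0 i).
have cc (i : 'I_d) : continuous (fun y : 'rV[R]_d => y 0 i) by exact: coord_continuous.
have cS k := @continuous_dot_exp k.
have ca := @continuous_dotl R d a.
have cg i : continuous (g i).
  exact: (continuous_mul (@continuous_const R _ (a 0 i)) (continuous_mul ca (cS m))).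
have cg' i : continuous (g' i).
  exact: (continuous_mul (@continuous_const R _ (a 0 i)) (continuous_add (continuous_mul ca
    (continuous_mul (continuous_mul (@continuous_const R _ (m%:R : R)) (cS m.-1))
       (continuous_mul (@continuous_const R _ (2 : R)) (cc i))))
    (continuous_mul (cS m) (@continuous_const R _ (a 0 i))))).
have pS k : poly_bounded (fun y : 'rV[R]_d => dot y y ^+ k).
  by apply: poly_bounded_exp; exact: poly_bounded_dot.
have pc := @poly_bounded_coord R d.
have pk (c : R) := @poly_bounded_cst R d c.
have pa := @poly_bounded_dotl R d a.
have pg i : poly_bounded (g i) by apply: poly_bounded_mul => //; exact: poly_bounded_mul.
have pg' i : poly_bounded (g' i).
  apply: poly_bounded_mul => //; apply: poly_bounded_add; last exact: poly_bounded_mul.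
  apply: poly_bounded_mul => //.
  by apply: poly_bounded_mul; apply: poly_bounded_mul.
have dg i (y : 'rV[R]_d) (t : R) : is_derive t (1 : R)
    (fun s : R => g i (y + s *: delta_mx 0 i)) (g' i (y + t *: delta_mx 0 i)).
  have D1 := is_derive_line_dotl a y (delta_mx 0 i) t.
  have := is_deriveZ (a 0 i) (is_deriveM D1 (is_derive_line_dot_exp y (delta_mx 0 i) m t)).
  rewrite !scaleRE !dot_delta; exact.
have st i := gaussian_stein hd mu gu (cg i) (cg' i) (dg i) (pg i) (pg' i).
have iq k : P.-integrable setT (EFin \o (fun w => dot a (u w) ^+ 2 * dot (u w) (u w) ^+ k)).
  apply: (integrable_gaussian hd mu gu (g := fun y => dot a y ^+ 2 * dot y y ^+ k)).
    exact: (continuous_mul (continuous_mul ca ca) (cS k)).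
  by apply: poly_bounded_mul => //; exact: poly_bounded_exp.
transitivity (\sum_i E (fun y : 'rV[R]_d => y 0 i * g i y)).
  rewrite -Rintegral_sum => [|i _].
    apply: eq_Rintegral => w _; rewrite expr2 -mulrA [X in X * _]/dot mulr_suml.
    by apply: eq_bigr => i _; rewrite /g; ring.
  apply: (integrable_gaussian hd mu gu (g := fun y => y 0 i * g i y)).
    exact: (continuous_mul (cc i) (cg i)).
  by apply: poly_bounded_mul.
under eq_bigr do rewrite st.
rewrite -Rintegral_sum => [|i _]; last exact: (integrable_gaussian hd mu gu (g := g' i)).
have iS := integrable_gaussian_dot_exp.
rewrite -!RintegralZl// -RintegralD//; last 2 first.
- exact: (integrable_EFinZ _ (iS m)).
- exact: (integrable_EFinZ _ (iq m.-1)).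
apply: eq_Rintegral => w _; rewrite /g'.
under eq_bigr do rewrite mulrDr.
rewrite big_split/= addrC; congr (_ + _).
  by rewrite [in RHS]/dot mulr_suml; apply: eq_bigr => i _; ring.
transitivity (2 * m%:R * (dot a (u w) * dot (u w) (u w) ^+ m.-1) * dot a (u w)); last by ring.
by rewrite [X in _ = _ * X]/dot mulr_sumr; apply: eq_bigr => i _; ring.
Qed.

(** The quadratic identity for each canonical basis vector, summed: the squared coordinates add up
    to [|y|^2] on both sides. *)
Lemma gaussian_moment m :
  E (fun y => dot y y ^+ m.+1) = (d + 2 * m)%:R * E (fun y => dot y y ^+ m).
Proof.
have iq i k : P.-integrable setT
    (EFin \o (fun w => dot (delta_mx 0 i) (u w) ^+ 2 * dot (u w) (u w) ^+ k)).
  apply: (integrable_gaussian hd mu gu (g := fun y => dot (delta_mx 0 i) y ^+ 2 * dot y y ^+ k)).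
    apply: continuous_mul; last exact: continuous_dot_exp.
    by apply: continuous_mul; exact: continuous_dotl.
  apply: poly_bounded_mul; apply: poly_bounded_exp; [exact: poly_bounded_dotl|].
  exact: poly_bounded_dot.
have sumE k : E (fun y => dot y y ^+ k.+1) =
    \sum_i E (fun y => dot (delta_mx 0 i) y ^+ 2 * dot y y ^+ k).
  rewrite -Rintegral_sum => [|i _]; last exact: iq.
  apply: eq_Rintegral => w _; rewrite exprS mulr_suml.
  by apply: eq_bigr => i _; rewrite dotC dot_delta expr2.
rewrite sumE; under eq_bigr do rewrite gaussian_quadratic_moment dot_delta mxE !eqxx mul1r.
rewrite big_split/= sumr_const card_ord -mulr_sumr natrD natrM.
case: m => [|m]; first by rewrite mulr0 mul0r !addr0 mulr_natl.
by rewrite -sumE [in RHS]mulrDl [in RHS]mulr_natl.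
Qed.

(** The fourth power arises in the second moment of [cd u *: u]: the squared remainder grows like
    [|u|^6], and the direction contributes [|u|^2]. *)
Lemma gaussian_moments : [/\ E (fun y => dot y y) = d%:R &
  E (fun y => dot y y ^+ 4) = d%:R * (d%:R + 2) * (d%:R + 4) * (d%:R + 6)].
Proof.
have H0 : E (fun y => dot y y ^+ 0) = 1.
  by under eq_Rintegral do rewrite expr0; exact: Rintegral_probability_cst.
have H1 := gaussian_moment 0.
split.
  under eq_Rintegral do rewrite -[dot _ _]expr1.
  by rewrite H1 H0 mulr1 muln0 addn0.
rewrite !gaussian_moment H0 !natrD !natrM; ring.
Qed.

Lemma gaussian_quadratic (a : 'rV[R]_d) :
  E (fun y => dot a y ^+ 2 * dot y y) = (d%:R + 2) * dot a a.
Proof.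
have H0 : E (fun y => dot y y ^+ 0) = 1.
  by under eq_Rintegral do rewrite expr0; exact: Rintegral_probability_cst.
have [HS _] := gaussian_moments.
have E0 := gaussian_quadratic_moment a 0; have E1 := gaussian_quadratic_moment a 1.
rewrite H0 mulr0 mul0r addr0 mulr1 in E0.
rewrite /= E0 in E1.
have {}E1 : E (fun y => dot a y ^+ 2 * dot y y) =
    dot a a * E (fun y => dot y y) + 2 * 1%:R * dot a a := E1.
by rewrite E1 HS; ring.
Qed.

End gaussian_moments.

Section borel_vectors.
Context {R : realType} {d : nat}.

Lemma borel_vec_coord i (B : set R) : measurable B ->
  borel_vec [set v : 'rV[R]_d | B (v 0 i)].
Proof. by move=> mB; apply: sub_sigma_algebra; exists i, B. Qed.

(** [borel_vec] is generated by coordinates rather than by open sets; the grid approximation behind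
    [measurable_continuous_comp] bridges the two. *)
Lemma borel_vec_continuous (g : 'rV[R]_d -> R) (B : set R) : continuous g ->
  measurable B -> borel_vec (g @^-1` B).
Proof.
move=> cg mB.
pose Y := g_sigma_algebraType [set A | exists i (B : set R),
  measurable B /\ A = [set v : 'rV[R]_d | B (v 0 i)]].
have mc i : measurable_fun setT (fun v : Y => (v : 'rV[R]_d) 0 i).
  by move=> _ C mC; rewrite setTI; exact: borel_vec_coord.
have := @measurable_continuous_comp R d _ Y g id cg mc measurableT B mB.
by rewrite setTI.
Qed.

Lemma random_vector_coord {dO : measure_display} {Omega : measurableType dO}
    (u : Omega -> 'rV[R]_d) i : random_vector u -> measurable_fun setT (fun w => u w 0 i).
Proof.
by move=> ru _ B mB; rewrite setTI; exact: (ru _ (borel_vec_coord i mB)).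
Qed.

End borel_vectors.

Section ae_integrable.
Context {R : realType} {dO : measure_display} {Omega : measurableType dO}
  (P : probability Omega R).

Lemma ae_eq_integrable (f g : Omega -> R) : measurable_fun setT f ->
  P.-integrable setT (EFin \o g) -> {ae P, forall w, f w = g w} ->
  P.-integrable setT (EFin \o f).
Proof.
move=> mf /integrableP[mg ig] fg; apply/integrableP; split; first exact/measurable_EFinP.
rewrite (@ge0_ae_eq_integral _ _ _ P setT _ (fun w => `|(g w)%:E|%E))//.
- by apply: measurableT_comp => //; exact/measurable_EFinP.
- exact: measurableT_comp.
- by apply: filterS fg => w fgw _; rewrite /= fgw.
Qed.

Lemma ae_eq_Rintegral (f g : Omega -> R) : measurable_fun setT f ->
  measurable_fun setT g -> {ae P, forall w, f w = g w} ->
  Rintegral P setT f = Rintegral P setT g.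
Proof.
move=> mf mg fg; congr fine; apply: ae_eq_integral => //.
- exact/measurable_EFinP.
- exact/measurable_EFinP.
- by apply: filterS fg => w -> _.
Qed.

Lemma ae_bounded_integrable (f : Omega -> R) (c : R) : measurable_fun setT f ->
  {ae P, forall w, `|f w| <= c} -> P.-integrable setT (EFin \o f).
Proof.
(* Truncation between [- c] and [c] changes [f] only on a null set and makes it bounded
   everywhere. *)
move=> mf fc; pose g w := Num.max (- c) (Num.min c (f w)).
have mg : measurable_fun setT g.
  by apply: measurable_maxr => //; exact: measurable_minr.
apply: (@ae_eq_integrable _ g) => //.
  apply: (@integrable_bounded _ _ _ _ _ `|c|) => // w.
  rewrite /g; have := ler_norm c; have := ler_normr (- c) c.
  rewrite ler_norml; move: (normr_ge0 c) => c0 _ cc.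
  have cc' : - c <= `|c| by rewrite -normrN ler_norm.
  rewrite le_max ge_max ge_min cc cc' /= andbT.
  by rewrite lerN2 cc.
apply: filterS fc => w; rewrite ler_norml => /andP[c1 c2].
by rewrite /g min_r// max_r.
Qed.

End ae_integrable.

(** * Reflections and the moments of the uniform law on the sphere *)

Section reflection.
Context {R : realType} {d : nat}.
Implicit Types (v y z : 'rV[R]_d).

(** The Householder matrix of the hyperplane orthogonal to [y], acting on row vectors from the
    right. *)
Definition reflection y : 'M[R]_d := 1%:M - (2 / dot y y) *: (y^T *m y).

Lemma mul_reflection y v : v *m reflection y = v - (2 * dot v y / dot y y) *: y.
Proof.
rewrite mulmxBr mulmx1 -scalemxAr mulmxA dot_mul_tr mul_scalar_mx scalerA.
by rewrite mulrAC.
Qed.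

Lemma reflection_tr y : (reflection y)^T = reflection y.
Proof. by rewrite /reflection linearB/= trmx1 linearZ/= trmx_mul trmxK. Qed.

Lemma reflection_orthogonal y : dot y y != 0 -> reflection y *m (reflection y)^T = 1%:M.
Proof.
move=> y0; rewrite reflection_tr; apply/row_matrixP => i.
rewrite row_mul mul_reflection row1 rowE mul_reflection.
set e := delta_mx 0 i; rewrite !dotE.
have -> : (2 * (dot e y - 2 * dot e y / dot y y * dot y y) / dot y y) = - (2 * dot e y / dot y y).
  by field.
by rewrite scaleNr opprK subrK.
Qed.

(** Equal lengths give [2 <v, v - z> = |v - z|^2], so the reflection subtracts exactly [v - z] from
    [v]. *)
Lemma reflection_swap v z : dot v v = dot z z -> v != z ->
  v *m reflection (v - z) = z /\ dot (v - z) (v - z) != 0.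
Proof.
move=> vz vnz.
have y0 : dot (v - z) (v - z) != 0.
  apply: contraNneq vnz => y0; rewrite -subr_eq0; apply/eqP/enorm_eq0.
  by rewrite enormE y0 sqrtr0.
split=> //; rewrite mul_reflection.
have -> : 2 * dot v (v - z) = dot (v - z) (v - z).
  by rewrite !dotE (dotC z v) -vz; ring.
by rewrite divff// scale1r opprB addrC subrK.
Qed.

End reflection.

Section sphere.
Context {R : realType} {d : nat}.
Hypothesis hd : (0 < d)%N.
Context {dO : measure_display} {Omega : measurableType dO} (P : probability Omega R).
Variable u : Omega -> 'rV[R]_d.
Hypothesis mu : forall i, measurable_fun setT (fun w => u w 0 i).
Hypothesis su : uniform_sphere P u.
Notation E f := (Rintegral P setT (fun w => f (u w))).

Lemma sphere_ae : {ae P, forall w, dot (u w) (u w) = 1}.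
Proof. by case: su => + _; apply: filterS => w; rewrite -enorm_sqr => ->; rewrite expr1n. Qed.

Lemma integrable_sphere (g : 'rV[R]_d -> R) : continuous g -> poly_bounded g ->
  P.-integrable setT (EFin \o (fun w => g (u w))).
Proof.
move=> cg [C [p H]]; apply: (@ae_bounded_integrable _ _ _ _ _ (C * (1 + 1) ^+ p)).
  exact: measurable_continuous_comp.
by apply: filterS sphere_ae => w uw; rewrite -{2}uw; exact: H.
Qed.

(** Invariance is assumed for events; applied to preimages under [g], it says that [g (u w)] and
    [g (u w *m O)] have the same law on the line. *)
Lemma sphere_invariant (g : 'rV[R]_d -> R) (O : 'M[R]_d) : continuous g -> poly_bounded g ->
  O *m O^T = 1%:M ->
  P.-integrable setT (EFin \o (fun w => g (u w *m O))) /\ E (fun y => g (y *m O)) = E g.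
Proof.
move=> cg pg OO.
have mg : measurable_fun setT (fun w => g (u w)) by exact: measurable_continuous_comp.
have mgO : measurable_fun setT (fun w => g (u w *m O)).
  apply: measurable_continuous_comp => // i; under eq_fun do rewrite mxE.
  by apply: measurable_sum => j; exact: measurable_funM.
have law (B : set R) : measurable B ->
    P ((fun w => g (u w)) @^-1` B) = P ((fun w => g (u w *m O)) @^-1` B).
  move=> mB; case: su => _ /(_ O (g @^-1` B) OO (borel_vec_continuous cg mB)).
  by move=> /esym.
have ig := integrable_sphere cg pg.
split; first exact: (same_law_integrable mg mgO law (H := id)).
by apply/esym; exact: (same_law_Rintegral mg mgO law (H := id)).
Qed.

Let poly_quad (v z : 'rV[R]_d) : continuous (fun y => dot v y * dot z y) /\
  poly_bounded (fun y => dot v y * dot z y).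
Proof.
split; first exact: (continuous_mul (@continuous_dotl R d v) (@continuous_dotl R d z)).
by apply: poly_bounded_mul; exact: poly_bounded_dotl.
Qed.

(* A reflection exchanges v and z. *)
Lemma sphere_square_eq (v z : 'rV[R]_d) : dot v v = dot z z ->
  E (fun y => dot v y * dot v y) = E (fun y => dot z y * dot z y).
Proof.
move=> vz; have [->//|vnz] := eqVneq v z.
have [sw y0] := reflection_swap vz vnz.
have [c p] := poly_quad v v.
rewrite -(sphere_invariant c p (reflection_orthogonal y0)).2.
apply: eq_Rintegral => w _.
by rewrite dotC dot_mulmx reflection_tr sw dotC.
Qed.

(** Vectors of equal length have equal second moments, and those of the coordinates add up to
    [E |u|^2 = 1], so each is [1 / d]. *)
Lemma sphere_square (v : 'rV[R]_d) :
  E (fun y => dot v y * dot v y) = dot v v / d%:R.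
Proof.
have d0 : d%:R != 0 :> R by rewrite pnatr_eq0 -lt0n.
apply: (mulfI d0); rewrite mulrCA divff// mulr1.
have H i : E (fun y => dot v y * dot v y) = dot v v * E (fun y => y 0 i * y 0 i).
  rewrite (@sphere_square_eq v (enorm v *: delta_mx 0 i)).
    rewrite -RintegralZl//; last first.
      apply: (@integrable_sphere (fun y => y 0 i * y 0 i)).
        by apply: continuous_mul; exact: coord_continuous.
      by apply: poly_bounded_mul; exact: poly_bounded_coord.
    apply: eq_Rintegral => w _.
    by rewrite !dotZl (dotC (delta_mx 0 i)) dot_delta -enorm_sqr; ring.
  rewrite -!enorm_sqr enormZ exprMn real_normK ?num_real// enorm_sqr.
  rewrite [X in _ * X](_ : _ = 1) ?mulr1//.
  by rewrite enorm_sqr dot_delta mxE !eqxx.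
rewrite mulr_natl -[X in _ *+ X]card_ord -sumr_const.
rewrite (eq_bigr _ (fun i _ => H i)) -mulr_sumr -Rintegral_sum => [|i _]; last first.
  apply: (@integrable_sphere (fun y => y 0 i * y 0 i)).
    by apply: continuous_mul; exact: coord_continuous.
  by apply: poly_bounded_mul; exact: poly_bounded_coord.
rewrite (@ae_eq_Rintegral _ _ _ _ _ (cst 1)) ?Rintegral_probability_cst ?mulr1//.
  exact: measurable_dot.
exact: sphere_ae.
Qed.

(** Polarisation, from the squares of [v + z], [v] and [z]. *)
Lemma sphere_bilinear (v z : 'rV[R]_d) :
  E (fun y => dot v y * dot z y) = dot v z / d%:R.
Proof.
have i1 (a b : 'rV[R]_d) : P.-integrable setT (EFin \o (fun w => dot a (u w) * dot b (u w))).
  by have [c p] := poly_quad a b; exact: (integrable_sphere c p).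
have H : E (fun y => dot (v + z) y * dot (v + z) y) =
    E (fun y => dot v y * dot v y) + E (fun y => dot z y * dot z y)
    + 2 * E (fun y => dot v y * dot z y).
  rewrite -RintegralZl// -RintegralD// -RintegralD//; last 2 first.
  - exact: integrable_EFinD.
  - exact: integrable_EFinZ.
  by apply: eq_Rintegral => w _; rewrite !dotE; ring.
move: H; rewrite !sphere_square !dotE (dotC z v) => H.
have : 2 * E (fun y => dot v y * dot z y) = 2 * (dot v z / d%:R) by lra.
by move/mulfI; apply.
Qed.

End sphere.

Section single_direction.
Context {R : realType} {d : nat}.
Hypothesis hd : (0 < d)%N.
Variables (phi : 'rV[R]_d -> R) (M nu : R) (x : 'rV[R]_d).
Hypothesis dphi : forall y, differentiable phi y.
Hypothesis dgrad : forall y, differentiable (grad phi) y.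
Hypothesis lhess : hess_lipschitz M phi.
Hypotheses (M0 : 0 <= M) (nu0 : 0 < nu).
Context {dO : measure_display} {Omega : measurableType dO} (P : probability Omega R).
Variable u : Omega -> 'rV[R]_d.
Hypothesis mu : forall i, measurable_fun setT (fun w => u w 0 i).
Notation E f := (Rintegral P setT (fun w => f (u w))).
Notation cd := (central_diff phi nu x).
Notation a := (grad phi x).

Lemma central_diff_le y : `|cd y| <= enorm a * enorm y + M * nu ^+ 2 / 6 * enorm y ^+ 3.
Proof.
rewrite -[cd y](subrK (dot a y)) addrC; apply: (le_trans (ler_normD _ _)).
by apply: lerD; [exact: normr_dot_le|exact: central_diff_remainder].
Qed.

(** At most cubic growth puts [cd] in the class covered by Gaussian integrability and Stein's
    identity. *)
Lemma poly_bounded_central_diff : poly_bounded cd.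
Proof.
have k0 : 0 <= M * nu ^+ 2 / 6 by rewrite !mulr_ge0// ltW.
have [C [p H]] : poly_bounded (fun y : 'rV[R]_d =>
    enorm a * enorm y + M * nu ^+ 2 / 6 * enorm y ^+ 3).
  apply: poly_bounded_add.
    apply: (@poly_bounded_of_le _ _ _ (enorm a) 1) => [|y]; first exact: enorm_ge0.
    by rewrite expr1 ger0_norm// mulr_ge0// enorm_ge0.
  apply: (@poly_bounded_of_le _ _ _ (M * nu ^+ 2 / 6) 3) => // y.
  by rewrite ger0_norm// mulr_ge0// exprn_ge0// enorm_ge0.
exists C, p => y; apply: (le_trans (central_diff_le y)).
exact: (le_trans (ler_norm _)).
Qed.

Let ccd : continuous cd. Proof. exact: continuous_central_diff. Qed.

Lemma continuous_central_diff_coord i : continuous (fun y : 'rV[R]_d => cd y * y 0 i).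
Proof. by apply: continuous_mul => //; exact: coord_continuous. Qed.

Lemma continuous_central_diff_sqr :
  continuous (fun y : 'rV[R]_d => cd y ^+ 2 * dot y y).
Proof. exact: (continuous_mul (continuous_mul ccd ccd) (@continuous_dot R d)). Qed.

Lemma poly_bounded_central_diff_sqr :
  poly_bounded (fun y : 'rV[R]_d => cd y ^+ 2 * dot y y).
Proof.
apply: poly_bounded_mul; last exact: poly_bounded_dot.
by apply: poly_bounded_exp; exact: poly_bounded_central_diff.
Qed.

Lemma square_integrable_central_diff (k : R) :
  P.-integrable setT (EFin \o (fun w => cd (u w) ^+ 2 * dot (u w) (u w))) ->
  square_integrable P (fun w => k *: (cd (u w) *: u w)).
Proof.
move=> iq; split.
  move=> i; under eq_fun do rewrite mxE [X in _ * X]mxE.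
  apply: measurable_funM => //.
  exact: (measurable_continuous_comp (@continuous_central_diff_coord i)).
have := integrable_EFinZ (k ^+ 2) iq; congr (_.-integrable _ _).
by apply/funext => w /=; rewrite !dotE; congr EFin; ring.
Qed.

Section gaussian.
Hypothesis gu : std_gaussian P u.

(** The factor [1] is the scale of one direction once [N%:R^-1] is taken out of the estimator; on
    the sphere it is [d], and both cases then feed the same bound on averages. *)
Lemma gaussian_square_integrable : square_integrable P (fun w => 1 *: (cd (u w) *: u w)).
Proof.
apply: square_integrable_central_diff.
apply: (integrable_gaussian hd mu gu (g := fun y => cd y ^+ 2 * dot y y)).
  exact: continuous_central_diff_sqr.
exact: poly_bounded_central_diff_sqr.
Qed.

Lemma gaussian_second_moment :
  Rintegral P setT (fun w => dot (1 *: (cd (u w) *: u w)) (1 *: (cd (u w) *: u w))) <=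
  9 / 2 * d%:R * dot a a + 3 * (M ^+ 2 * nu ^+ 4 / 36) *
    (d%:R * (d%:R + 2) * (d%:R + 4) * (d%:R + 6)).
Proof.
have [_ H4] := gaussian_moments hd mu gu.
have H2 := gaussian_quadratic hd mu gu a.
rewrite -H4.
have i1 : P.-integrable setT (EFin \o (fun w => dot a (u w) ^+ 2 * dot (u w) (u w))).
  apply: (integrable_gaussian hd mu gu (g := fun y => dot a y ^+ 2 * dot y y)).
    exact: (continuous_mul (continuous_mul (@continuous_dotl R d a) (@continuous_dotl R d a))
      (@continuous_dot R d)).
  apply: poly_bounded_mul; last exact: poly_bounded_dot.
  by apply: poly_bounded_exp; exact: poly_bounded_dotl.
have i4 := integrable_gaussian_dot_exp hd mu gu 4.
pose K := 3 * (M ^+ 2 * nu ^+ 4 / 36).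
apply: (@le_trans _ _ (Rintegral P setT (fun w =>
  3 / 2 * (dot a (u w) ^+ 2 * dot (u w) (u w)) + K * dot (u w) (u w) ^+ 4))).
  apply: Rintegral_le.
  - exact: gaussian_square_integrable.2.
  - by apply: integrable_EFinD; exact: integrable_EFinZ.
  move=> w; rewrite !dotE !mul1r mulrA -expr2.
  have := central_diff_sqr_le x dphi dgrad lhess M0 nu0 (u w).
  move/(ler_wpM2r (dot_ge0 (u w)))/le_trans; apply.
  by rewrite le_eqVlt; apply/orP; left; apply/eqP; rewrite /K; ring.
rewrite RintegralD//; last 2 first.
- exact: integrable_EFinZ.
- exact: integrable_EFinZ.
rewrite !RintegralZl// H2 lerD2r.
(* Here [3/2 (d + 2) <= 9/2 d] is used, which holds from [d = 1] on. *)
have d1 : 1 <= d%:R :> R by rewrite ler1n.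
by have := dot_ge0 a; nra.
Qed.

(* By Stein's lemma the mean of cd(u) u is that of the gradient of cd at u, i.e.
   of the average of grad phi over x + nu u and x - nu u. *)
Lemma gaussian_bias :
  enorm (mean P (fun w => 1 *: (cd (u w) *: u w)) - a) <= M * nu ^+ 2 / 2 * d%:R.
Proof.
have [HS _] := gaussian_moments hd mu gu.
pose q y := 2^-1 *: (grad phi (x + nu *: y) + grad phi (x - nu *: y)).
have cgr : continuous (grad phi) by move=> y; exact: differentiable_continuous.
have cq : continuous q.
  have cgm : continuous (fun v : 'rV[R]_d => grad phi (x - nu *: v)).
    by under eq_fun do rewrite -scaleNr; exact: continuous_affine_comp.
  move=> y; apply: (@continuous_comp _ _ _
    (fun y : 'rV[R]_d => grad phi (x + nu *: y) + grad phi (x - nu *: y))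
    (fun v : 'rV[R]_d => 2^-1 *: v)); last exact: scaler_continuous.
  by apply: continuousD; [exact: (continuous_affine_comp cgr)|exact: cgm].
have cqi i : continuous (fun y => q y 0 i).
  move=> y; apply: (@continuous_comp _ _ _ q (fun v : 'rV[R]_d => v 0 i)); first exact: cq.
  exact: coord_continuous.
have K0 : 0 <= M * nu ^+ 2 / 2 by rewrite !mulr_ge0// ltW.
have pqi i : poly_bounded (fun y => q y 0 i).
  have [C [p H]] : poly_bounded (fun y : 'rV[R]_d => enorm a + M * nu ^+ 2 / 2 * dot y y).
    apply: poly_bounded_add; first exact: poly_bounded_cst.
    by apply: poly_bounded_mul; [exact: poly_bounded_cst|exact: poly_bounded_dot].
  exists C, p => y; apply: le_trans (H y); apply: le_trans (ler_norm _).
  apply: (le_trans (coord_le_enorm _ _)); rewrite -[q y](subrK a) addrC.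
  apply: (le_trans (enorm_triangle _ _)); rewrite lerD2l.
  exact: enorm_avg_grad.
have dcd i (y : 'rV[R]_d) (t : R) : is_derive t (1 : R)
    (fun s : R => cd (y + s *: delta_mx 0 i)) (q (y + t *: delta_mx 0 i) 0 i).
  have e1 (s : R) : x + nu *: (y + s *: delta_mx 0 i) =
      (x + nu *: y) + s *: (nu *: delta_mx 0 i).
    by apply/rowP => j; rewrite !mxE; ring.
  have e2 (s : R) : x - nu *: (y + s *: delta_mx 0 i) =
      (x - nu *: y) + s *: - (nu *: delta_mx 0 i).
    by apply/rowP => j; rewrite !mxE; ring.
  have -> : (fun s : R => cd (y + s *: delta_mx 0 i)) =
      fun s : R => (2 * nu)^-1 *: (phi ((x + nu *: y) + s *: (nu *: delta_mx 0 i))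
        - phi ((x - nu *: y) + s *: - (nu *: delta_mx 0 i))).
    by apply/funext => s; rewrite /central_diff e1 e2 scaleRE mulrC.
  have := is_deriveZ (2 * nu)^-1 (is_deriveB
    (is_derive_line_fun (x + nu *: y) (nu *: delta_mx 0 i) t dphi)
    (is_derive_line_fun (x - nu *: y) (- (nu *: delta_mx 0 i)) t dphi)).
  rewrite -e1 -e2 scaleRE dotNr opprK !dotZr.
  rewrite !dot_delta; congr (is_derive _ _ _ _); rewrite /q [in RHS]mxE [X in _ = _ * X]mxE.
  by field; rewrite gt_eqF.
have mE v : dot (mean P (fun w => 1 *: (cd (u w) *: u w))) v = E (fun y => dot (q y) v).
  rewrite Rintegral_sum => [|i _]; last first.
    have := integrable_EFinZ (v 0 i) (integrable_gaussian hd mu gu (cqi i) (pqi i)).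
    by congr (_.-integrable _ _); apply/funext => w /=; rewrite mulrC.
  apply: eq_bigr => i _; rewrite mxE.
  have iqi := integrable_gaussian hd mu gu (cqi i) (pqi i).
  rewrite RintegralZr//; congr (_ * _).
  rewrite -(gaussian_stein hd mu gu ccd (cqi i) (dcd i)
    poly_bounded_central_diff (pqi i)).
  by apply: eq_Rintegral => w _; rewrite scale1r mxE mulrC.
have iS : P.-integrable setT (EFin \o (fun w => dot (u w) (u w))).
  exact: (integrable_gaussian_dot_exp hd mu gu 1).
apply: enorm_le_of_dot => [|v]; first by rewrite mulr_ge0.
have iqv : P.-integrable setT (EFin \o (fun w => dot (q (u w)) v)).
  apply: integrable_EFin_sum => i _.
  have := integrable_EFinZ (v 0 i) (integrable_gaussian hd mu gu (cqi i) (pqi i)).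
  by congr (_.-integrable _ _); apply/funext => w /=; rewrite mulrC.
(* Tested against [v], the bias is the mean of [<q u - a, v>], bounded pointwise by a multiple of
   [|u|^2 |v|], and [E |u|^2 = d]. *)
rewrite dotBl mE -(Rintegral_probability_cst P (dot a v)) -RintegralB//; last first.
  exact: finite_measure_integrable_cst.
rewrite -HS -mulrA [X in _ <= _ * X]mulrC mulrA -RintegralZl//.
apply: Rintegral_le.
- apply: integrable_EFinB => //; exact: finite_measure_integrable_cst.
- exact: integrable_EFinZ.
move=> w; rewrite -dotBl; apply: (le_trans (dot_le_enorm _ _)).
rewrite [leRHS]mulrAC ler_wpM2r ?enorm_ge0//.
exact: enorm_avg_grad.
Qed.

End gaussian.

Section sphere.
Hypothesis su : uniform_sphere P u.

Lemma sphere_square_integrable :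
  square_integrable P (fun w => d%:R *: (cd (u w) *: u w)).
Proof.
apply: square_integrable_central_diff.
apply: (integrable_sphere mu su (g := fun y => cd y ^+ 2 * dot y y)).
  exact: continuous_central_diff_sqr.
exact: poly_bounded_central_diff_sqr.
Qed.

(** As [|u| = 1] almost surely, it is enough to bound the mean of [cd u ^+ 2], where the mean of
    [<a, u>^2] is [|a|^2 / d]. The resulting 3/2 is relaxed to 9/2 to match the Gaussian bound. *)
Lemma sphere_second_moment :
  Rintegral P setT (fun w => dot (d%:R *: (cd (u w) *: u w)) (d%:R *: (cd (u w) *: u w))) <=
  9 / 2 * d%:R * dot a a + 3 * (M ^+ 2 * nu ^+ 4 / 36) * d%:R ^+ 2.
Proof.
pose K := 3 * (M ^+ 2 * nu ^+ 4 / 36).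
have i1 : P.-integrable setT (EFin \o (fun w => dot a (u w) * dot a (u w))).
  apply: (integrable_sphere mu su (g := fun y => dot a y * dot a y)).
    exact: (continuous_mul (@continuous_dotl R d a) (@continuous_dotl R d a)).
  by apply: poly_bounded_mul; exact: poly_bounded_dotl.
have ic : P.-integrable setT (EFin \o (cst K)) by exact: finite_measure_integrable_cst.
have mcd : measurable_fun setT (fun w => cd (u w)) by exact: measurable_continuous_comp.
have icd : P.-integrable setT (EFin \o (fun w => cd (u w) ^+ 2)).
  apply: (integrable_sphere mu su (g := fun y => cd y ^+ 2)).
    exact: (continuous_mul ccd ccd).
  by apply: poly_bounded_exp; exact: poly_bounded_central_diff.
rewrite (@ae_eq_Rintegral _ _ _ _ _ (fun w => d%:R ^+ 2 * cd (u w) ^+ 2)); last 3 first.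
- exact: measurable_dot sphere_square_integrable.1 sphere_square_integrable.1.
- by apply: measurable_funM => //; exact: measurable_funX.
- by apply: filterS (sphere_ae su) => w uw; rewrite !dotE uw; ring.
have le1 : Rintegral P setT (fun w => cd (u w) ^+ 2) <=
    Rintegral P setT (fun w => 3 / 2 * (dot a (u w) * dot a (u w)) + K * dot (u w) (u w) ^+ 3).
  apply: Rintegral_le => //.
  - apply: integrable_EFinD; first exact: integrable_EFinZ.
    apply: integrable_EFinZ.
    apply: (integrable_sphere mu su (g := fun y => dot y y ^+ 3)).
      exact: continuous_dot_exp.
    by apply: poly_bounded_exp; exact: poly_bounded_dot.
  - by move=> w; rewrite -expr2; exact: central_diff_sqr_le.
have eK : Rintegral P setT (fun w => 3 / 2 * (dot a (u w) * dot a (u w)) + K * dot (u w) (u w) ^+ 3) =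
    3 / 2 * (dot a a / d%:R) + K.
  rewrite (@ae_eq_Rintegral _ _ _ _ _ (fun w => 3 / 2 * (dot a (u w) * dot a (u w)) + K)).
  - rewrite RintegralD//; last exact: integrable_EFinZ.
    by rewrite RintegralZl// sphere_square// Rintegral_probability_cst.
  - apply: measurable_funD; apply: measurable_funM => //.
      by apply: measurable_funM; exact: (measurable_continuous_comp (@continuous_dotl R d a)).
    by apply: measurable_funX; exact: measurable_dot.
  - apply: measurable_funD => //; apply: measurable_funM => //.
    by apply: measurable_funM; exact: (measurable_continuous_comp (@continuous_dotl R d a)).
  - by apply: filterS (sphere_ae su) => w ->; rewrite expr1n mulr1.
rewrite RintegralZl//.
have d0 : 0 < d%:R :> R by rewrite ltr0n.
have := le1; rewrite eK => /(ler_wpM2l (sqr_ge0 (d%:R : R)))/le_trans; apply.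
have -> : d%:R ^+ 2 * (3 / 2 * (dot a a / d%:R) + K) = 3 / 2 * d%:R * dot a a + K * d%:R ^+ 2.
  by field; rewrite gt_eqF.
rewrite lerD2r; have := dot_ge0 a; nra.
Qed.

(** Split [y] into its projection [h] on [v] and the orthogonal rest [w]: the mirror image is
    [w - h] and [|h|] is [|<v, y>| / |v|], so [central_diff_reflect] applies to [nu h] and
    [nu w]. *)
Lemma remainder_reflection v y : dot v v != 0 ->
  `|(cd y - dot a y) - (cd (y *m reflection v) - dot a (y *m reflection v))| <=
  M * nu ^+ 2 * (`|dot v y| / enorm v) * dot y y.
Proof.
move=> v0; have nv0 : 0 < enorm v.
  rewrite lt_def enorm_ge0 andbT; apply: contra_neq v0 => v0.
  by rewrite -enorm_sqr v0 expr0n.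
pose h := (dot y v / dot v v) *: v; pose w := y - h.
have yE : y = h + w by rewrite /w addrC subrK.
have hw : dot h w = 0.
  by rewrite /w /h !dotE (dotC v y); field.
have yO : y *m reflection v = w - h.
  rewrite mul_reflection /w /h -addrA -opprD -scalerDl; congr (_ - _ *: _).
  by field.
have nh : enorm h = `|dot v y| / enorm v.
  rewrite /h enormZ normrM dotC -mulrA; congr (_ * _).
  by rewrite normfV -enorm_sqr ger0_norm ?sqr_ge0//; field; rewrite gt_eqF.
have ort (p q : 'rV[R]_d) : dot p q = 0 -> dot (q - p) (q - p) = dot (p + q) (p + q).
  by move=> pq; rewrite !dotE (dotC q p) pq; ring.
have wh := ort h w hw.
rewrite -nh yO.
have -> : dot y y = dot (h + w) (h + w) by rewrite -yE.
have -> : cd y - dot a y = cd (h + w) - dot a (h + w) by rewrite -yE.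
move: hw wh {yE yO nh}; move: h w => h w hw wh.
have sc (z : 'rV[R]_d) : phi (x + nu *: z) - phi (x - nu *: z) = 2 * nu * cd z.
  by rewrite /central_diff; field; rewrite gt_eqF.
(* Used at [h] and at [- h], for the two signs of the absolute value. *)
have key (k : 'rV[R]_d) : dot k w = 0 ->
    cd (k + w) - cd (w - k) - 2 * dot a k <= M * nu ^+ 2 * enorm k * dot (k + w) (k + w).
  move=> kw.
  have kw' : dot (nu *: k) (nu *: w) = 0 by rewrite !dotE kw !mulr0.
  have := central_diff_reflect dphi dgrad lhess x M0 kw'.
  rewrite -scalerDr -scalerBr !sc enormZ gtr0_norm// !dotZr dotZl => H.
  rewrite -(ler_pM2l (mulr_gt0 (ltr0Sn R 1) nu0)).
  by apply: le_trans (le_trans _ H) _; rewrite le_eqVlt; apply/orP; left; apply/eqP; ring.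
have k1 := key h hw.
have hw' : dot (- h) w = 0 by rewrite dotNl hw oppr0.
have k2 := key (- h) hw'.
rewrite opprK enormN dotNr (addrC (- h)) (addrC w h) wh in k2.
rewrite (dotDr h w a) (dotDr w (- h) a) dotNr ler_norml; apply/andP; split; lra.
Qed.

(* The remainder r = cd - dot a is small along the reflection in v: pairing y with its
   mirror image replaces r(y) (v.y) by half the difference of r times v.y, which gains
   the factor |v.y| / |v| whose mean square is 1/d. *)
Lemma sphere_bias :
  enorm (mean P (fun w => d%:R *: (cd (u w) *: u w)) - a) <= M * nu ^+ 2 / 2.
Proof.
have k0 : 0 <= M * nu ^+ 2 by rewrite !mulr_ge0// ltW.
have d0 : 0 < d%:R :> R by rewrite ltr0n.
apply: enorm_le_of_dot => [|v]; first by rewrite divr_ge0.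
have [v0|v0] := eqVneq (dot v v) 0.
  by rewrite enormE v0 sqrtr0 mulr0 (enorm_eq0 (_ : enorm v = 0)) ?enormE ?v0 ?sqrtr0// dotC dot0l.
have nv0 : 0 < enorm v.
  rewrite lt_def enorm_ge0 andbT; apply: contra_neq v0 => v0.
  by rewrite -enorm_sqr v0 expr0n.
pose r (y : 'rV[R]_d) := cd y - dot a y.
have cl (b : 'rV[R]_d) := @continuous_dotl R d b.
have pl (b : 'rV[R]_d) := @poly_bounded_dotl R d b.
have ccv : continuous (fun y => cd y * dot v y) by exact: continuous_mul.
have pcv : poly_bounded (fun y => cd y * dot v y).
  by apply: poly_bounded_mul => //; exact: poly_bounded_central_diff.
have cav : continuous (fun y => dot a y * dot v y) by exact: continuous_mul.
have pav : poly_bounded (fun y => dot a y * dot v y) by exact: poly_bounded_mul.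
have icv := integrable_sphere mu su ccv pcv.
have iav := integrable_sphere mu su cav pav.
have cG : continuous (fun y => r y * dot v y).
  have -> : (fun y => r y * dot v y) = (fun y => cd y * dot v y + -1 * (dot a y * dot v y)).
    by apply/funext => y; rewrite /r; ring.
  exact: (continuous_add ccv (continuous_mul (@continuous_const R _ (-1)) cav)).
have pG : poly_bounded (fun y => r y * dot v y).
  have -> : (fun y => r y * dot v y) = (fun y => cd y * dot v y + -1 * (dot a y * dot v y)).
    by apply/funext => y; rewrite /r; ring.
  by apply: poly_bounded_add => //; apply: poly_bounded_mul => //; exact: poly_bounded_cst.
have iG := integrable_sphere mu su cG pG.
have eG : dot (mean P (fun w => d%:R *: (cd (u w) *: u w)) - a) v =
    d%:R * E (fun y => r y * dot v y).
  rewrite dotBl (dotC _ v) -(Rintegral_dot_cst _ sphere_square_integrable).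
  have -> : dot a v = d%:R * E (fun y => dot a y * dot v y).
    by rewrite sphere_bilinear//; field; rewrite gt_eqF.
  have -> : E (fun y => dot v (d%:R *: (cd y *: y))) = d%:R * E (fun y => cd y * dot v y).
    by rewrite -RintegralZl//; apply: eq_Rintegral => w _; rewrite !dotZr.
  rewrite -mulrBr; congr (_ * _); rewrite -RintegralB//.
  by apply: eq_Rintegral => w _; rewrite /r mulrBl.
have OO := reflection_orthogonal v0.
have [iGO inv] := sphere_invariant mu su cG pG OO.
have iS : P.-integrable setT (EFin \o (fun w => dot v (u w) * dot v (u w) * dot (u w) (u w))).
  apply: (integrable_sphere mu su (g := fun y => dot v y * dot v y * dot y y)).
    exact: (continuous_mul (continuous_mul (cl v) (cl v)) (@continuous_dot R d)).
  by apply: poly_bounded_mul; [exact: poly_bounded_mul|exact: poly_bounded_dot].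
have ES : E (fun y => dot v y * dot v y * dot y y) = dot v v / d%:R.
  rewrite -(sphere_square hd mu su v); apply: ae_eq_Rintegral.
  - exact: measurable_of_integrable iS.
  - by apply: measurable_funM; exact: (measurable_continuous_comp (cl v)).
  - by apply: filterS (sphere_ae su) => w ->; rewrite mulr1.
have H2 : 2 * E (fun y => r y * dot v y) <= M * nu ^+ 2 / enorm v * (dot v v / d%:R).
  (* One of the two copies of the expectation is evaluated at the mirror image, where [dot v]
     changes sign. *)
  rewrite mulr2n mulrDl !mul1r -{2}inv -RintegralD// -ES -RintegralZl//.
  apply: Rintegral_le.
  - exact: integrable_EFinD.
  - exact: integrable_EFinZ.
  move=> w; set y := u w.
  have -> : dot v (y *m reflection v) = - dot v y.
    by rewrite mul_reflection !dotE (dotC y v); field.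
  rewrite mulrN -mulrBl; apply: (le_trans (ler_norm _)); rewrite normrM.
  have := ler_wpM2r (normr_ge0 (dot v y)) (remainder_reflection y v0).
  move/le_trans; apply; rewrite -expr2 -(real_normK (num_real (dot v y))).
  by rewrite le_eqVlt; apply/orP; left; apply/eqP; ring.
rewrite eG; rewrite -enorm_sqr in H2.
have -> : M * nu ^+ 2 / 2 * enorm v = d%:R * ((M * nu ^+ 2 / enorm v * (enorm v ^+ 2 / d%:R)) / 2).
  by field; rewrite !gt_eqF.
by rewrite ler_pM2l//; lra.
Qed.

End sphere.
End single_direction.

(** * Averages of independent directions *)

Section several_directions.
Context {R : realType} {d N : nat} {dO : measure_display} {Omega : measurableType dO}
  (P : probability Omega R).

Lemma borel_vec_setT : borel_vec (setT : set 'rV[R]_d).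
Proof. exact: (borel_vec_continuous (@continuous_const R _ 0) measurableT). Qed.

Lemma indep_vectors_pair (u : 'I_N -> Omega -> 'rV[R]_d) (j k : 'I_N) (f g : 'rV[R]_d -> R) :
  indep_vectors P u -> continuous f -> continuous g -> j != k ->
  independent_maps P (fun w => f (u j w)) (fun w => g (u k w)).
Proof.
move=> iu cf cg jk A B mA mB.
pose C l := if l == j then f @^-1` A else if l == k then g @^-1` B else setT.
have mC l : borel_vec (C l).
  rewrite /C; case: ifP => _; first exact: borel_vec_continuous.
  by case: ifP => _; [exact: borel_vec_continuous|exact: borel_vec_setT].
have := iu C mC.
rewrite (bigD1 j)//= (bigD1 k)/=; last by rewrite eq_sym.
rewrite big1 ?mule1; last first.
  by move=> l /andP[/negPf lj /negPf lk]; rewrite /C lj lk; exact: probability_setT.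
rewrite /C eqxx eq_sym (negPf jk) eqxx => <-.
congr (P _); apply/seteqP; split => w /=.
  by move=> [fA gB] l; case: eqP => [->//|_]; case: eqP => [->//|].
by move=> H; split; [have := H j; rewrite eqxx|have := H k; rewrite eq_sym (negPf jk) eqxx].
Qed.

Hypotheses (hd : (0 < d)%N) (hN : (0 < N)%N).

(** Write [A = |a|] and [D = N + 9/2 d]. The diagonal terms of the mean of [|G|^2] contribute at
    most [(9/2 d A^2 + q) / N] and the cross terms at most [(A + b)^2], so the weight [N / (8 D)]
    leaves exactly [A^2 / 8] as leading term. This is the origin of the step ratio for independent
    directions. *)
Lemma independent_directions_bound (h : 'I_N -> Omega -> 'rV[R]_d) (a : 'rV[R]_d) (b q : R) :
  (forall j, square_integrable P (h j)) ->
  (forall j k, j != k -> forall i,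
    independent_maps P (fun w => h j w 0 i) (fun w => h k w 0 i)) ->
  0 <= b -> 0 <= q ->
  (forall j, enorm (mean P (h j) - a) <= b) ->
  (forall j, Rintegral P setT (fun w => dot (h j w) (h j w)) <= 9 / 2 * d%:R * dot a a + q) ->
  let G w := N%:R^-1 *: \sum_j h j w in
  square_integrable P G /\
  - dot a (mean P G) + N%:R / (N%:R + 9 / 2 * d%:R) / 8 * Rintegral P setT (fun w => dot (G w) (G w))
    <= - dot a a / 4 + (3 / 4 * b ^+ 2 + q / (8 * (N%:R + 9 / 2 * d%:R))).
Proof.
move=> ih ind b0 q0 bias sec G.
have iS := square_integrable_sum ih.
have iG : square_integrable P G.
  split.
    move=> i; rewrite /G; under eq_fun do rewrite mxE.
    by apply: measurable_funM => //; exact: iS.1.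
  have := integrable_EFinZ (N%:R^-1 ^+ 2) iS.2; congr (_.-integrable _ _).
  by apply/funext => w /=; rewrite /G !dotE; congr EFin; ring.
split=> //.
have n0 : 0 < N%:R :> R by rewrite ltr0n.
have d0 : 0 < d%:R :> R by rewrite ltr0n.
pose A := enorm a.
have A2 : dot a a = A ^+ 2 by rewrite enorm_sqr.
have A0 : 0 <= A by exact: enorm_ge0.
have mb j : enorm (mean P (h j)) <= A + b.
  rewrite -[mean P (h j)](subrK a) addrC; apply: (le_trans (enorm_triangle _ _)).
  by rewrite lerD2l.
have am j : A ^+ 2 - A * b <= dot a (mean P (h j)).
  rewrite -[mean P (h j)](subrK a) dotDr A2 addrC.
  have := dot_le_enorm (- a) (mean P (h j) - a); rewrite enormN dotNl.
  have := ler_wpM2l A0 (bias j); rewrite -/A; lra.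
have E1 : A ^+ 2 - A * b <= dot a (mean P G).
  have -> : dot a (mean P G) = N%:R^-1 * \sum_j dot a (mean P (h j)).
    rewrite -(Rintegral_dot_cst _ iG) -dot_sumr.
    have -> : \sum_j mean P (h j) = mean P (fun w => \sum_j h j w).
      apply/rowP => i; rewrite summxE mxE; under [RHS]eq_Rintegral do rewrite summxE.
      rewrite Rintegral_sum => [|j _]; last exact: square_integrable_coord.
      by apply: eq_bigr => j _; rewrite mxE.
    rewrite -(Rintegral_dot_cst _ iS) -RintegralZl//.
      by apply: eq_Rintegral => w _; rewrite /G dotZr.
    apply: integrable_EFin_sum => i _; apply: integrable_EFinZ.
    exact: square_integrable_coord.
  rewrite -(ler_pM2l n0) mulrA divff ?gt_eqF// mul1r mulr_natl -[X in _ *+ X]card_ord -sumr_const.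
  exact: ler_sum.
have E2 : Rintegral P setT (fun w => dot (G w) (G w)) <=
    N%:R^-1 ^+ 2 * (N%:R * (9 / 2 * d%:R * A ^+ 2 + q) + N%:R * (N%:R * (A + b) ^+ 2)).
  have -> : Rintegral P setT (fun w => dot (G w) (G w)) = N%:R^-1 ^+ 2 *
      Rintegral P setT (fun w => dot (\sum_j h j w) (\sum_j h j w)).
    rewrite -RintegralZl//; last exact: iS.2.
    by apply: eq_Rintegral => w _; rewrite /G !dotE; ring.
  rewrite ler_wpM2l ?exprn_ge0 ?invr_ge0 ?ler0n//.
  rewrite Rintegral_square_sum// -mulrDr mulr_natl -[X in _ *+ X]card_ord -sumr_const.
  apply: ler_sum => j _; apply: lerD; first by rewrite -A2; exact: sec.
  apply: (@le_trans _ _ (\sum_(k < N) (A + b) ^+ 2)).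
    rewrite [leRHS](bigD1 j)//= -[leLHS]add0r; apply: lerD; first exact: sqr_ge0.
    apply: ler_sum => k _; apply: (le_trans (dot_le_enorm _ _)).
    by rewrite expr2 ler_pM ?enorm_ge0.
  by rewrite sumr_const card_ord mulr_natl.
rewrite A2; set D := N%:R + 9 / 2 * d%:R.
have D0 : 0 < D by rewrite addr_gt0// mulr_gt0.
have c0 : 0 <= N%:R / D / 8 by rewrite !divr_ge0// ltW.
have := ler_wpM2l c0 E2.
have -> : N%:R / D / 8 * (N%:R^-1 ^+ 2 * (N%:R * (9 / 2 * d%:R * A ^+ 2 + q) + N%:R * (N%:R * (A + b) ^+ 2)))
   = (D * A ^+ 2 + N%:R * (2 * (A * b) + b ^+ 2)) / (8 * D) + q / (8 * D).
  have -> : 9 / 2 * d%:R = D - N%:R by rewrite /D; ring.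
  by field; rewrite !gt_eqF.
have : (D * A ^+ 2 + N%:R * (2 * (A * b) + b ^+ 2)) / (8 * D) <= (A ^+ 2 + 2 * (A * b) + b ^+ 2) / 8.
  rewrite ler_pdivrMr ?mulr_gt0//.
  have -> : (A ^+ 2 + 2 * (A * b) + b ^+ 2) / 8 * (8 * D) = D * A ^+ 2 + D * (2 * (A * b) + b ^+ 2).
    by field.
  rewrite lerD2l; apply: ler_wpM2r.
    by rewrite addr_ge0 ?sqr_ge0// mulr_ge0// mulr_ge0.
  by rewrite /D lerDl !mulr_ge0// ltW.
(* The mixed terms total [5/4 A b <= 5/8 (A^2 + b^2)]; then 7/8 - 5/8 = 1/4 is left for [A^2], and
   1/8 + 5/8 = 3/4 for [b^2]. *)
have := sqr_ge0 (A - b); rewrite sqrrB -mulr_natl.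
lra.
Qed.

End several_directions.

(** * Random subsets of an orthonormal basis *)

Section random_subset.
Context {R : realType} {d : nat} {dO : measure_display} {Omega : measurableType dO}
  (P : probability Omega R).

Lemma ae_exists (Q : Omega -> Prop) : {ae P, forall w, Q w} -> exists w, Q w.
Proof.
move=> [A [mA PA0 QA]]; apply: contrapT => nQ.
have : A = setT by apply/seteqP; split=> // w _; apply: QA => /= Qw; apply: nQ; exists w.
by move=> AT; move: PA0; rewrite AT probability_setT => /eqP; rewrite onee_eq0.
Qed.

Lemma mem_random_set (J : Omega -> {set 'I_d}) i w : (i \in J w)%:R =
  \sum_(A : {set 'I_d} | i \in A) \1_([set w | J w = A]) w :> R.
Proof.
have [iJ|iJ] := boolP (i \in J w).
  rewrite (bigD1 (J w))//= indicE mem_set// big1 ?addr0// => A /andP[_ AJ].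
  by rewrite indicE memNset//= => /esym/eqP; rewrite (negPf AJ).
rewrite big1// => A iA; rewrite indicE memNset//= => JA.
by move: iJ; rewrite JA iA.
Qed.

Lemma indicator_independent (A : set Omega) (Y : Omega -> R) : measurable A ->
  measurable_fun setT Y ->
  (forall B, measurable B -> P (A `&` Y @^-1` B) = P A * P (Y @^-1` B))%E ->
  independent_maps P (\1_A : Omega -> R) Y.
Proof.
move=> mA mY ind B C mB mC.
pose G : set (set Omega) := [set A; setT].
apply: (@independent_sigma _ _ _ P G).
- by move=> _ [->|->].
- by move=> _ _ [->|->] [->|->]; rewrite ?setIid ?setIT ?setTI; [left|left|left|right].
- by right.
- by rewrite -[X in measurable X]setTI; exact: mY.
- move=> _ [->|->]; first exact: ind.
  by rewrite setTI probability_setT mul1e.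
have mA' : @measurable _ (g_sigma_algebraType G) A by apply: sub_sigma_algebra; left.
have := @measurable_indic _ (g_sigma_algebraType G) R setT A mA' measurableT B mB.
by rewrite setTI.
Qed.

Variables (N : nat) (J : Omega -> {set 'I_d}).
Hypotheses (hd : (0 < d)%N) (uJ : uniform_subset P N J)
  (cJ : {ae P, forall w, #|J w| = N}).

Lemma uniform_subset_le : (N <= d)%N.
Proof. by have [w <-] := ae_exists cJ; rewrite -[X in (_ <= X)%N]card_ord max_card. Qed.

(** [uniform_subset] prescribes the probabilities of the sets of size [N]; the other sets are null
    because [J] has [N] elements almost surely. *)
Lemma uniform_subset_prob A : P [set w | J w = A] =
  (if #|A| == N then 'C(d, N)%:R^-1 else 0)%:E.
Proof.
case: ifPn => [/eqP/uJ.2//|AN].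
have [Z [mZ PZ0 JZ]] := cJ.
apply: (subset_measure0 (uJ.1 A) mZ _ PZ0) => w /= JA; apply: JZ => /=.
by rewrite JA => AN'; rewrite AN' eqxx in AN.
Qed.

(** The subsets that avoid [i] number C(d-1, N), so Pascal's rule leaves C(d-1, N-1) that contain
    it, and d C(d-1, N-1) = N C(d, N). *)
Lemma card_subsets_containing (i : 'I_d) :
  (#|[set A : {set 'I_d} | (i \in A) && (#|A| == N)]%SET| * d = N * 'C(d, N))%N.
Proof.
have := cards_draws (~: [set i])%SET N; rewrite cardsC1 card_ord => H1.
have := card_draws 'I_d N; rewrite card_ord => H2.
have : #|[set A : {set 'I_d} | #|A| == N]%SET| =
    (#|[set A : {set 'I_d} | (i \in A) && (#|A| == N)]%SET| +
     #|[set A : {set 'I_d} | (A \subset (~: [set i])%SET) && (#|A| == N)]%SET|)%N.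
  rewrite -(cardsID [set A : {set 'I_d} | i \in A]%SET).
  congr (_ + _)%N; apply: eq_card => A; first by rewrite !inE andbC.
  transitivity ((i \notin A) && (#|A| == N)); first by rewrite !inE.
  by rewrite inE finset.subsetC finset.sub1set inE.
rewrite H1 H2; set c := #|_|.
case: (d) hd c => // d' _ c /=; case: N => [|k].
  by rewrite !bin0 mul0n addn1 => -[<-].
move=> H; rewrite binS addnC in H; move/addIn: H => <-.
by rewrite mulnC -mul_bin_diag.
Qed.

(** The indicator of [i \in J] is a sum of indicators of the values of [J], each independent of [z];
    their probabilities add up to [N / d]. *)
Lemma uniform_subset_Rintegral (i : 'I_d) (z : Omega -> R) :
  P.-integrable setT (EFin \o z) ->
  (forall A B, measurable B ->
    P ([set w | J w = A] `&` z @^-1` B) = P [set w | J w = A] * P (z @^-1` B))%E ->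
  P.-integrable setT (EFin \o (fun w => (i \in J w)%:R * z w)) /\
  Rintegral P setT (fun w => (i \in J w)%:R * z w) = N%:R / d%:R * Rintegral P setT z.
Proof.
move=> iz ind.
have H A : P.-integrable setT (EFin \o (fun w => \1_([set w | J w = A]) w * z w)) /\
    Rintegral P setT (fun w => \1_([set w | J w = A]) w * z w) =
    (if #|A| == N then 'C(d, N)%:R^-1 else 0) * Rintegral P setT z.
  have iI : P.-integrable setT (EFin \o (\1_([set w | J w = A]) : Omega -> R)).
    exact: (integrable_indic _ (uJ.1 A)).
  have [|i1 ->] := @independent_mul _ _ _ P (\1_([set w | J w = A])) z _ iI iz.
    apply: indicator_independent; [exact: uJ.1|exact: measurable_of_integrable iz|].
    by move=> B mB; exact: ind.
  split=> //; congr (_ * _); rewrite /Rintegral.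
  have mA := uJ.1 A.
  by rewrite integral_indic// setIT [X in fine X](uniform_subset_prob A).
have E w : (i \in J w)%:R * z w = \sum_(A : {set 'I_d} | i \in A) \1_([set w | J w = A]) w * z w.
  by rewrite -mulr_suml mem_random_set.
split.
  under eq_fun do rewrite /= E.
  by apply: integrable_EFin_sum => A _; exact: (H A).1.
under eq_Rintegral do rewrite E.
rewrite Rintegral_sum => [|A _]; last exact: (H A).1.
under eq_bigr do rewrite (H _).2.
rewrite -mulr_suml; congr (_ * _).
rewrite -big_mkcondr/= sumr_const.
have C0 : 'C(d, N)%:R != 0 :> R by rewrite pnatr_eq0 -lt0n bin_gt0 uniform_subset_le.
have d0 : d%:R != 0 :> R by rewrite pnatr_eq0 -lt0n.
have := card_subsets_containing i; rewrite cardsE => /(congr1 (fun n => n%:R : R)).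
rewrite !natrM => cI; rewrite -[LHS]mulr_natl; apply: (mulIf d0).
rewrite divfK// mulrAC cI mulfK//.
Qed.

End random_subset.

Section directions.
Context {R : realType} {d N : nat}.
Hypotheses (hd : (0 < d)%N) (hN : (0 < N)%N).
Variables (phi : 'rV[R]_d -> R) (M nu : R) (x : 'rV[R]_d).
Hypothesis dphi : forall y, differentiable phi y.
Hypothesis dgrad : forall y, differentiable (grad phi) y.
Hypothesis lhess : hess_lipschitz M phi.
Hypotheses (M0 : 0 <= M) (nu0 : 0 < nu).
Context {dO : measure_display} {Omega : measurableType dO} (P : probability Omega R).
Notation cd := (central_diff phi nu x).
Notation a := (grad phi x).

Let ccd : continuous cd. Proof. exact: continuous_central_diff. Qed.

Lemma measurable_grad_est (u : 'I_N -> Omega -> 'rV[R]_d) gamma i :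
  (forall j, random_vector (u j)) ->
  measurable_fun setT (fun w => grad_est gamma nu (u ^~ w) phi x 0 i).
Proof.
move=> ru; rewrite /grad_est; under eq_fun do rewrite mxE summxE.
apply: measurable_funM => //; apply: measurable_sum => j; under eq_fun do rewrite mxE.
apply: measurable_funM; last exact: random_vector_coord.
by apply: (measurable_continuous_comp ccd) => k; exact: random_vector_coord.
Qed.

(** The rows [b i] form a square matrix with [B *m B^T = 1%:M], hence also [B^T *m B = 1%:M], and
    multiplication by [B^T] preserves length. *)
Lemma orthonormal_parseval (b : 'I_d -> 'rV[R]_d) (v : 'rV[R]_d) :
  (forall i j, b i *m (b j)^T = ((i == j)%:R)%:M) ->
  \sum_i dot v (b i) ^+ 2 = dot v v.
Proof.
move=> ob; pose B : 'M[R]_d := \matrix_i b i.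
have rB i : row i B = b i by rewrite rowK.
have BB : B *m B^T = 1%:M.
  apply/matrixP => i j; rewrite !mxE.
  have /matrixP/(_ 0 0) := ob i j; rewrite !mxE eqxx mulr1n => <-.
  by apply: eq_bigr => k _; rewrite !mxE.
have BB' : B^T *m B = 1%:M by exact: mulmx1C.
have : (v *m B^T) *m (v *m B^T)^T = v *m v^T.
  by rewrite trmx_mul trmxK mulmxA -(mulmxA v) BB' mulmx1.
rewrite !dot_mul_tr => /matrixP/(_ 0 0); rewrite !mxE eqxx !mulr1n => <-.
apply: eq_bigr => i _; rewrite expr2; congr (_ * _);
  by rewrite mxE; apply: eq_bigr => k _; rewrite !mxE.
Qed.

Section basis.
Variables (u : 'I_N -> Omega -> 'rV[R]_d) (b : 'I_d -> Omega -> 'rV[R]_d)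
  (J : Omega -> {set 'I_d}).
Hypotheses (ru : forall j, random_vector (u j)) (rb : random_basis b)
  (uJ : uniform_subset P N J).
Hypothesis ind : forall A E, vec_sigma b E ->
  (P ([set w | J w = A] `&` E) = P [set w | J w = A] * P E)%E.
Hypothesis ub : {ae P, forall w, perm_eq [seq u j w | j <- enum 'I_N]
                           [seq b i w | i <- enum (J w)]}.

Let p i w := cd (b i w).
Let y i w := dot a (b i w).
Let G w := grad_est (d%:R / N%:R) nu (u ^~ w) phi x.
(** The share of one basis vector in [Omega2]. *)
Let kappa := M ^+ 2 * nu ^+ 4 / 48.

Let mb i k : measurable_fun setT (fun w => b i w 0 k).
Proof. by apply: random_vector_coord; exact: rb.1. Qed.

Let dot_b w i j : dot (b i w) (b j w) = (i == j)%:R.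
Proof. by have := rb.2 w i j; rewrite dot_mul_tr => /matrixP/(_ 0 0); rewrite !mxE eqxx !mulr1n. Qed.

Let enorm_b w i : enorm (b i w) = 1.
Proof. by rewrite enormE dot_b eqxx sqrtr1. Qed.

Let card_J : {ae P, forall w, #|J w| = N}.
Proof. by apply: filterS ub => w /perm_size; rewrite !size_map -enumT size_enum_ord -cardE. Qed.

Let G_ae : {ae P, forall w, G w = (d%:R / N%:R) *: \sum_i (i \in J w)%:R *: (p i w *: b i w)}.
Proof.
apply: filterS ub => w ubw; rewrite /G /grad_est; congr (_ *: _).
transitivity (\sum_(v <- [seq u j w | j <- enum 'I_N]) cd v *: v).
  by rewrite big_map big_enum.
rewrite (perm_big _ ubw) big_map big_enum big_mkcond/=.
by apply: eq_bigr => i _; case: ifP; rewrite ?scale1r ?scale0r.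
Qed.

Let dot_J w : dot (\sum_i (i \in J w)%:R *: (p i w *: b i w))
    (\sum_i (i \in J w)%:R *: (p i w *: b i w)) = \sum_i (i \in J w)%:R * p i w ^+ 2.
Proof.
rewrite dot_suml; apply: eq_bigr => i _; rewrite dot_sumr (bigD1 i)//= big1 ?addr0.
  by rewrite !dotE dot_b eqxx; case: (i \in J w); rewrite /= ?mul0r// !mul1r mulr1 expr2.
by move=> j /negPf ji; rewrite !dotE dot_b eq_sym ji !mulr0.
Qed.

Let K := enorm a + M * nu ^+ 2 / 6.

Let p_le i w : `|p i w| <= K.
Proof.
have := central_diff_le x dphi dgrad lhess nu0 (b i w).
by rewrite enorm_b expr1n !mulr1.
Qed.

Let mp i : measurable_fun setT (p i).
Proof. exact: (measurable_continuous_comp ccd). Qed.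

Let my i : measurable_fun setT (y i).
Proof. exact: (measurable_continuous_comp (@continuous_dotl R d a)). Qed.

Let mJ i : measurable_fun setT (fun w => (i \in J w)%:R : R).
Proof.
under eq_fun do rewrite mem_random_set big_mkcond/=.
apply: measurable_sum => A; case: (i \in A) => //.
by apply: measurable_indic; exact: uJ.1.
Qed.

(** Orthonormality makes the whole left side the mean of [c = d / N] times the sum of
    [p_i^2 / 8 - p_i y_i] over the selected [i]. Each summand is at most [z_i = kappa - y_i^2 / 4];
    selection has probability [N / d], which cancels [c], and by Parseval the [z_i] sum to a
    constant. *)
Lemma random_basis_bound : square_integrable P G /\
  - dot a (mean P G) + N%:R / d%:R / 8 * Rintegral P setT (fun w => dot (G w) (G w))
    <= - dot a a / 4 + d%:R * kappa.
Proof.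
have n0 : 0 < N%:R :> R by rewrite ltr0n.
have d0 : 0 < d%:R :> R by rewrite ltr0n.
set c := d%:R / N%:R : R; have c0 : 0 < c by rewrite divr_gt0.
have mG i : measurable_fun setT (fun w => G w 0 i) by exact: measurable_grad_est.
have mGG : measurable_fun setT (fun w => dot (G w) (G w)) by exact: measurable_dot.
have GG : {ae P, forall w, dot (G w) (G w) = c ^+ 2 * \sum_i (i \in J w)%:R * p i w ^+ 2}.
  by apply: filterS G_ae => w ->; rewrite dotZl dotZr dot_J mulrA -expr2.
have K0 : 0 <= K.
  by rewrite /K addr_ge0 ?enorm_ge0// !mulr_ge0// ltW.
have iG : square_integrable P G.
  split=> //; apply: (@ae_bounded_integrable _ _ _ _ _ (c ^+ 2 * (d%:R * K ^+ 2))) => //.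
  have c2 := sqr_ge0 c.
  apply: filterS GG => w ->; rewrite normrM (ger0_norm c2).
  apply: ler_wpM2l => //; apply: (le_trans (ler_norm_sum _ _ _)).
  rewrite mulr_natl -[X in _ *+ X]card_ord -sumr_const; apply: ler_sum => i _.
  rewrite normrM -[leRHS]mul1r; apply: ler_pM => //.
    by case: (i \in J w); rewrite ?normr1 ?normr0.
  by rewrite normrX lerXn2r ?nnegrE// p_le.
split=> //.
have k0 : 0 <= kappa.
  by rewrite /kappa divr_ge0// mulr_ge0 ?sqr_ge0// exprn_even_ge0.
pose z i w := kappa - y i w ^+ 2 / 4.
have mz i : measurable_fun setT (z i).
  by apply: measurable_funB => //; apply: measurable_funM => //; exact: measurable_funX.
have y_le i w : y i w ^+ 2 <= enorm a ^+ 2.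
  rewrite -(real_normK (num_real (y i w))) lerXn2r ?nnegrE ?enorm_ge0//.
  by apply: (le_trans (normr_dot_le _ _)); rewrite enorm_b mulr1.
have iz i : P.-integrable setT (EFin \o z i).
  apply: (@integrable_bounded _ _ _ _ _ (kappa + enorm a ^+ 2)) => // w.
  rewrite /z ler_norml; have := y_le i w; have := sqr_ge0 (y i w); have := sqr_ge0 (enorm a).
  by move=> *; apply/andP; split; lra.
have Hz i : P.-integrable setT (EFin \o (fun w => (i \in J w)%:R * z i w)) /\
    Rintegral P setT (fun w => (i \in J w)%:R * z i w) = N%:R / d%:R * Rintegral P setT (z i).
  apply: uniform_subset_Rintegral => // A B mB; apply: ind; apply: sub_sigma_algebra.
  exists i, ((fun v => kappa - dot a v ^+ 2 / 4) @^-1` B); split=> //.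
  apply: borel_vec_continuous mB.
  have -> : (fun v : 'rV[R]_d => kappa - dot a v ^+ 2 / 4) =
      fun v => kappa + (- 4^-1) * (dot a v * dot a v).
    by apply/funext => v; rewrite expr2; ring.
  exact: (continuous_add (@continuous_const R _ kappa)
   (continuous_mul (@continuous_const R _ (- 4^-1))
     (continuous_mul (@continuous_dotl R d a) (@continuous_dotl R d a)))).
have iGG := iG.2.
have iaG : P.-integrable setT (EFin \o (fun w => dot a (G w))).
  by apply: integrable_EFin_sum => i _; apply: integrable_EFinZ; exact: square_integrable_coord.
pose s w := - dot a (G w) + N%:R / d%:R / 8 * dot (G w) (G w).
have is_ : P.-integrable setT (EFin \o s).
  have -> : s = fun w => N%:R / d%:R / 8 * dot (G w) (G w) - dot a (G w).
    by apply/funext => w; rewrite /s addrC.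
  by apply: integrable_EFinB => //; exact: integrable_EFinZ.
have -> : - dot a (mean P G) + N%:R / d%:R / 8 * Rintegral P setT (fun w => dot (G w) (G w)) =
    Rintegral P setT s.
  have -> : s = fun w => N%:R / d%:R / 8 * dot (G w) (G w) - dot a (G w).
    by apply/funext => w; rewrite /s addrC.
  rewrite RintegralB//; last exact: integrable_EFinZ.
  by rewrite RintegralZl// Rintegral_dot_cst// addrC.
pose t w := c * \sum_i (i \in J w)%:R * (p i w ^+ 2 / 8 - p i w * y i w).
have mt : measurable_fun setT t.
  apply: measurable_funM => //; apply: measurable_sum => i; apply: measurable_funM => //.
  by apply: measurable_funB; apply: measurable_funM => //; exact: measurable_funX.
have st : {ae P, forall w, s w = t w}.
  apply: filterS2 G_ae GG => w Gw GGw; rewrite /s GGw Gw dotZr dot_sumr /t.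
  rewrite -/c (_ : N%:R / d%:R = c^-1); last by rewrite invf_div.
  rewrite mulrA (_ : c^-1 / 8 * c ^+ 2 = c / 8); last by field; rewrite gt_eqF.
  rewrite -(mulrA c 8^-1) -(mulrN c) -(mulrDr c) mulr_sumr -sumrN -big_split/=; congr (_ * _).
  by apply: eq_bigr => i _; rewrite !dotZr -/(y i w); ring.
have it : P.-integrable setT (EFin \o t).
  by apply: (ae_eq_integrable mt is_); apply: filterS st => w ->.
rewrite (ae_eq_Rintegral (measurable_of_integrable is_) mt st).
apply: (@le_trans _ _ (Rintegral P setT (fun w => c * \sum_i (i \in J w)%:R * z i w))).
  apply: Rintegral_le => //.
    apply: integrable_EFinZ; apply: integrable_EFin_sum => i _; exact: (Hz i).1.
  move=> w; rewrite /t; apply: ler_wpM2l; first exact: ltW.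
  apply: ler_sum => i _; apply: ler_wpM2l => //; rewrite /z.
  have := central_diff_remainder x dphi dgrad lhess nu0 (b i w).
  rewrite enorm_b expr1n mulr1 -/(p i w) -/(y i w) => rle.
  have : (p i w - y i w) ^+ 2 <= (M * nu ^+ 2 / 6) ^+ 2.
    rewrite -(real_normK (num_real (p i w - y i w))) lerXn2r ?nnegrE//.
    by rewrite !mulr_ge0// ltW.
  have -> : (M * nu ^+ 2 / 6) ^+ 2 = kappa * (48 / 36) by rewrite /kappa; field.
  (* With [r = p - y], [5/8 y^2 + 3/4 y r] equals [(5 y + 3 r)^2 / 40 - 9/40 r^2]; together with
     [r^2 / 8] this leaves [7/20 r^2] to cover, which is below [kappa] since [r^2 <= 4/3 kappa]. *)
  have := sqr_ge0 (5 * y i w + 3 * (p i w - y i w)).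
  have := k0.
  by rewrite !expr2; move: (p i w) (y i w) => p' y'; nra.
rewrite RintegralZl//; last by apply: integrable_EFin_sum => i _; exact: (Hz i).1.
rewrite Rintegral_sum => [|i _]; last exact: (Hz i).1.
under eq_bigr do rewrite (Hz _).2.
rewrite -mulr_sumr mulrA (_ : c * (N%:R / d%:R) = 1) ?mul1r; last first.
  by rewrite /c; field; rewrite !gt_eqF.
rewrite -Rintegral_sum//.
have -> : (fun w => \sum_i z i w) = cst (- dot a a / 4 + d%:R * kappa).
  apply/funext => w; rewrite sumrB sumr_const card_ord -mulr_suml.
  rewrite (orthonormal_parseval _ (rb.2 w)) /= -[kappa *+ d]mulr_natl; ring.
by rewrite Rintegral_probability_cst.
Qed.

End basis.
End directions.

Definition step_ratio {R : realType} (d N : nat) (m : method) : R :=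
  match m with
  | cFD => 1
  | cGS | cSS => N%:R / (N%:R + 9 / 2 * d%:R)
  | cRC | cRS => N%:R / d%:R
  end.

(** * One bound for the five methods *)

Section method_directions.
Context {R : realType} {d N : nat}.
Hypotheses (hd : (0 < d)%N) (hN : (0 < N)%N).
Context {dO : measure_display} {Omega : measurableType dO} (P : probability Omega R).

(** For [N = d] there is a single subset of size [N], so the constant full index set is uniform. *)
Lemma cFD_cRC (u : 'I_N -> Omega -> 'rV[R]_d) :
  directions_law P cFD u -> N = d /\ directions_law P cRC u.
Proof.
move=> [Nd uE]; split=> //; exists (fun=> [set: 'I_d]%SET); split.
  split.
    move=> A; have [->|nA] := pselect ([set: 'I_d]%SET = A).
      by rewrite (_ : [set _ | _] = setT)//; apply/seteqP; split.
    by rewrite (_ : [set _ | _] = set0)//; apply/seteqP; split.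
  move=> A AN; have -> : A = [set: 'I_d]%SET.
    by apply/eqP; rewrite eqEcard finset.subsetT cardsT card_ord AN Nd leqnn.
  rewrite (_ : [set _ | _] = setT) ?probability_setT ?Nd ?binn ?invr1//.
  by apply/seteqP; split.
apply: aeW => w; move: u uE; rewrite Nd => u uE.
have -> : enum [set: 'I_d]%SET = enum 'I_d by apply: eq_enum => i; rewrite !inE.
rewrite (_ : [seq u j w | j <- _] = [seq delta_mx 0 i | i <- enum 'I_d])//.
apply: eq_map => j; rewrite uE; apply/rowP => i.
by rewrite !mxE eqxx.
Qed.

(** A deterministic basis generates the trivial sigma-algebra, of which every [J] is independent. *)
Lemma cRC_cRS (u : 'I_N -> Omega -> 'rV[R]_d) :
  directions_law P cRC u -> directions_law P cRS u.
Proof.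
move=> [J [uJ ub]]; exists (fun i _ => delta_mx 0 i), J; split=> //.
  split.
    move=> i C _; have [Ci|Ci] := pselect (C (delta_mx 0 i)).
      by rewrite (_ : _ @^-1` _ = setT)//; apply/seteqP; split.
    by rewrite (_ : _ @^-1` _ = set0)//; apply/seteqP; split.
  move=> _ i j; apply/matrixP => k l; rewrite !ord1 !mxE eqxx mulr1n.
  rewrite (bigD1 i)//= !mxE !eqxx mul1r big1 ?addr0; first by [].
  by move=> r /negPf ri; rewrite !mxE ri andbF mul0r.
move=> A E.
suff trivial : vec_sigma (fun i (_ : Omega) => delta_mx 0 i : 'rV[R]_d) `<=`
    [set E | E = set0 \/ E = setT].
  by move=> /trivial[->|->]; rewrite ?setI0 ?measure0 ?mule0// setIT probability_setT mule1.
apply: smallest_sub.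
  split; first by left.
    by move=> B [->|->]; [right; rewrite setD0|left; rewrite setDv].
  move=> F FE; have [[n Fn]|nF] := pselect (exists n, F n = setT).
    by right; apply/seteqP; split=> // w _; exists n => //; rewrite Fn.
  left; apply/seteqP; split=> // w [n _ Fw]; case: (FE n) => Fn.
    by rewrite Fn in Fw.
  by apply: nF; exists n.
move=> _ [i [C [_ ->]]]; have [Ci|Ci] := pselect (C (delta_mx 0 i)).
  by right; apply/seteqP; split.
by left; apply/seteqP; split.
Qed.

Variables (phi : 'rV[R]_d -> R) (M nu : R) (x : 'rV[R]_d).
Hypothesis dphi : forall y, differentiable phi y.
Hypothesis dgrad : forall y, differentiable (grad phi) y.
Hypothesis lhess : hess_lipschitz M phi.
Hypotheses (M0 : 0 <= M) (nu0 : 0 < nu).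
Notation cd := (central_diff phi nu x).
Notation a := (grad phi x).

Lemma scaled_directions_independent (k : R) (u : 'I_N -> Omega -> 'rV[R]_d) :
  indep_vectors P u -> forall j l, j != l -> forall i,
  independent_maps P (fun w => (k *: (cd (u j w) *: u j w)) 0 i)
    (fun w => (k *: (cd (u l w) *: u l w)) 0 i).
Proof.
move=> iu j l jl i.
have cf : continuous (fun v : 'rV[R]_d => (k *: (cd v *: v)) 0 i).
  have -> : (fun v : 'rV[R]_d => (k *: (cd v *: v)) 0 i) = fun v => k * (cd v * v 0 i).
    by apply/funext => v; rewrite !mxE.
  apply: continuous_mul; first exact: continuous_const.
  by apply: continuous_mul; [exact: continuous_central_diff|exact: coord_continuous].
exact: (indep_vectors_pair iu cf cf jl).
Qed.

Lemma direction_bound (m : method) (u : 'I_N -> Omega -> 'rV[R]_d) :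
  (forall j, random_vector (u j)) -> directions_law P m u ->
  let G w := grad_est (gamma_of m d N) nu (u ^~ w) phi x in
  square_integrable P G /\
  - dot a (mean P G) + step_ratio d N m / 8 * Rintegral P setT (fun w => dot (G w) (G w))
    <= - dot a a / 4 + chi_bar m d N M nu.
Proof.
move=> ru uT G.
have n0 : 0 < N%:R :> R by rewrite ltr0n.
have d0 : 0 < d%:R :> R by rewrite ltr0n.
have mu j i : measurable_fun setT (fun w => u j w 0 i) by exact: random_vector_coord.
have subset_case : directions_law P cRS u ->
    let G w := grad_est (d%:R / N%:R) nu (u ^~ w) phi x in
    square_integrable P G /\
    - dot a (mean P G) + N%:R / d%:R / 8 * Rintegral P setT (fun w => dot (G w) (G w))
      <= - dot a a / 4 + Omega2 d M nu.
  move=> [b [J [rb uJ ind ub]]].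
  have -> : Omega2 d M nu = d%:R * (M ^+ 2 * nu ^+ 4 / 48) by rewrite /Omega2; ring.
  exact: (random_basis_bound hd hN x dphi dgrad lhess M0 nu0 ru rb uJ ind ub).
have D0 : 0 < N%:R + 9 / 2 * d%:R :> R by rewrite addr_gt0// !mulr_gt0.
have q0 : 0 <= M ^+ 2 * nu ^+ 4 by rewrite mulr_ge0 ?sqr_ge0// exprn_even_ge0.
move: uT @G; case: m => uT.
- have [Nd /cRC_cRS/subset_case] := cFD_cRC uT.
  have e1 : d%:R / N%:R = 1 :> R by rewrite Nd divff// gt_eqF.
  have e2 : N%:R / d%:R = 1 :> R by rewrite Nd divff// gt_eqF.
  by rewrite /= e1 e2.
- case: uT => iu gu G.
  have GE : G = fun w => N%:R^-1 *: \sum_j 1 *: (cd (u j w) *: u j w).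
    by apply/funext => w; rewrite /G /grad_est; congr (_ *: _); apply: eq_bigr => j _; rewrite scale1r.
  have b0 : 0 <= M * nu ^+ 2 / 2 * d%:R by rewrite !mulr_ge0// ltW.
  have Q0 : 0 <= 3 * (M ^+ 2 * nu ^+ 4 / 36) * (d%:R * (d%:R + 2) * (d%:R + 4) * (d%:R + 6)).
    by rewrite !mulr_ge0// ?divr_ge0// ?addr_ge0// ltW.
  have := @independent_directions_bound R d N _ _ P hd hN
    (fun j w => 1 *: (cd (u j w) *: u j w)) a _ _
    (fun j => gaussian_square_integrable hd x dphi dgrad lhess M0 nu0 (mu j) (gu j))
    (scaled_directions_independent 1 iu) b0 Q0
    (fun j => gaussian_bias hd x dphi dgrad lhess M0 nu0 (mu j) (gu j))
    (fun j => gaussian_second_moment hd x dphi dgrad lhess M0 nu0 (mu j) (gu j)).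
  clearbody G; rewrite GE /= => -[iG H]; split=> //; apply: (le_trans H); rewrite lerD2l.
  rewrite /Omega2; set D := N%:R + 9 / 2 * d%:R in D0 *.
  (* The moment term [q / (8 D)] is reproduced exactly; the rest of [chi_bar] has to cover
     [3/4 b^2], which amounts to [18 D <= 72 N + 216 d]. The sphere below splits in the same way. *)
  have -> : (72 * N%:R * d%:R + 216 * d%:R ^+ 2 + (d%:R + 2) * (d%:R + 4) * (d%:R + 6)) /
      (2 * D) * (d%:R * M ^+ 2 * nu ^+ 4 / 48) =
    (72 * N%:R * d%:R + 216 * d%:R ^+ 2) / (96 * D) * (d%:R * (M ^+ 2 * nu ^+ 4)) +
    3 * (M ^+ 2 * nu ^+ 4 / 36) * (d%:R * (d%:R + 2) * (d%:R + 4) * (d%:R + 6)) / (8 * D).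
    by field; rewrite gt_eqF.
  rewrite lerD2r.
  have -> : 3 / 4 * (M * nu ^+ 2 / 2 * d%:R) ^+ 2 = 18 * d%:R / 96 * (d%:R * (M ^+ 2 * nu ^+ 4)).
    by field.
  apply: ler_wpM2r; first by rewrite mulr_ge0.
  rewrite ler_pdivlMr ?mulr_gt0//.
  have -> : 18 * d%:R / 96 * (96 * D) = 18 * d%:R * D by field.
  rewrite /D; nra.
- case: uT => iu su G.
  have GE : G = fun w => N%:R^-1 *: \sum_j d%:R *: (cd (u j w) *: u j w).
    apply/funext => w; rewrite /G /grad_est /gamma_of mulrC -scalerA; congr (_ *: _).
    by rewrite scaler_sumr.
  have b0 : 0 <= M * nu ^+ 2 / 2 by rewrite !mulr_ge0// ltW.
  have Q0 : 0 <= 3 * (M ^+ 2 * nu ^+ 4 / 36) * d%:R ^+ 2 :> R.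
    by rewrite !mulr_ge0// ?divr_ge0// ltW.
  have := @independent_directions_bound R d N _ _ P hd hN
    (fun j w => d%:R *: (cd (u j w) *: u j w)) a _ _
    (fun j => sphere_square_integrable x dphi dgrad lhess M0 nu0 (mu j) (su j))
    (scaled_directions_independent d%:R iu) b0 Q0
    (fun j => sphere_bias hd x dphi dgrad lhess M0 nu0 (mu j) (su j))
    (fun j => sphere_second_moment hd x dphi dgrad lhess M0 nu0 (mu j) (su j)).
  clearbody G; rewrite GE /= => -[iG H]; split=> //; apply: (le_trans H); rewrite lerD2l.
  rewrite /Omega2; set D := N%:R + 9 / 2 * d%:R in D0 *.
  have -> : (72 * N%:R + 216 * d%:R + d%:R ^+ 2) / (2 * d%:R * D) * (d%:R * M ^+ 2 * nu ^+ 4 / 48) =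
    (72 * N%:R + 216 * d%:R) / (96 * D) * (M ^+ 2 * nu ^+ 4) +
    3 * (M ^+ 2 * nu ^+ 4 / 36) * d%:R ^+ 2 / (8 * D).
    by field; rewrite !gt_eqF.
  rewrite lerD2r.
  have -> : 3 / 4 * (M * nu ^+ 2 / 2) ^+ 2 = 18 / 96 * (M ^+ 2 * nu ^+ 4) by field.
  apply: ler_wpM2r => //.
  rewrite ler_pdivlMr ?mulr_gt0//.
  have -> : 18 / 96 * (96 * D) = 18 * D by field.
  rewrite /D; lra.
- by move/cRC_cRS/subset_case: uT.
- exact: subset_case.
Qed.

End method_directions.

(** * Sampling and conditional expectations *)

Section fixed_point.
Context {R : realType} {d N : nat} {dXi : measure_display} {Xi : measurableType dXi}
  (Pz : probability Xi R) (f : 'rV[R]_d -> Xi -> R).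
Hypothesis hf : integrable_loss Pz f.
Variables (gamma nu : R) (u : 'I_N -> 'rV[R]_d) (x : 'rV[R]_d).

Lemma objectiveE y : objective Pz f y = Rintegral Pz setT (f y).
Proof. by rewrite /objective unlock. Qed.

Lemma measurable_loss y : measurable_fun setT (f y).
Proof. exact: measurable_of_integrable (hf y). Qed.

Lemma grad_est_coord (phi : 'rV[R]_d -> R) i : grad_est gamma nu u phi x 0 i =
  gamma * \sum_j (phi (x + nu *: u j) - phi (x - nu *: u j)) * (u j 0 i / (2 * nu)).
Proof.
rewrite /grad_est mxE summxE; congr (_ * _); apply: eq_bigr => j _.
by rewrite mxE /central_diff mulrAC mulrA.
Qed.

(** The estimator is linear in the function, so that of a sample average is the average of the
    single-sample ones. *)
Lemma grad_est_average (s : nat) (phi : 'I_s -> 'rV[R]_d -> R) (k : R) :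
  grad_est gamma nu u (fun y => k * \sum_j phi j y) x =
  k *: \sum_j grad_est gamma nu u (phi j) x.
Proof.
apply/rowP => i; rewrite grad_est_coord !mxE summxE.
under [in RHS]eq_bigr do rewrite grad_est_coord.
rewrite -mulr_sumr mulrCA; congr (_ * _); rewrite exchange_big/= mulr_sumr.
apply: eq_bigr => j _; rewrite -mulr_suml -mulrBr -sumrB; ring.
Qed.

Notation gz z := (grad_est gamma nu u (f ^~ z) x).
Notation ghat := (grad_est gamma nu u (objective Pz f) x).

Lemma integrable_grad_est_loss i : Pz.-integrable setT (EFin \o (fun z => gz z 0 i)).
Proof.
under eq_fun do rewrite /= grad_est_coord.
apply: integrable_EFinZ; apply: integrable_EFin_sum => j _.
under eq_fun do rewrite /= mulrC.
by apply: integrable_EFinZ; apply: integrable_EFinB; exact: hf.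
Qed.

Lemma Rintegral_grad_est_loss i : Rintegral Pz setT (fun z => gz z 0 i) = ghat 0 i.
Proof.
under eq_Rintegral do rewrite grad_est_coord.
have iB j : Pz.-integrable setT (EFin \o (fun z => f (x + nu *: u j) z - f (x - nu *: u j) z)).
  by apply: integrable_EFinB; exact: hf.
have iBm j : Pz.-integrable setT (EFin \o (fun z =>
    (f (x + nu *: u j) z - f (x - nu *: u j) z) * (u j 0 i / (2 * nu)))).
  by under eq_fun do rewrite /= mulrC; exact: integrable_EFinZ.
rewrite RintegralZl//; last exact: integrable_EFin_sum.
rewrite Rintegral_sum// grad_est_coord; congr (_ * _); apply: eq_bigr => j _.
by rewrite RintegralZr// RintegralB// ?objectiveE//; exact: hf.
Qed.

Definition grad_est_variance : \bar R :=
  (\int[Pz]_z (dot (gz z - ghat) (gz z - ghat))%:E)%E.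

Lemma measurable_grad_est_loss i : measurable_fun setT (fun z => gz z 0 i).
Proof. exact: measurable_of_integrable (integrable_grad_est_loss i). Qed.

Lemma measurable_centered_grad_est i : measurable_fun setT (fun z => (gz z - ghat) 0 i).
Proof.
under eq_fun do rewrite mxE [X in _ + X]mxE.
by apply: measurable_funB => //; exact: measurable_grad_est_loss.
Qed.

Lemma grad_est_variance_ge0 : (0 <= grad_est_variance)%E.
Proof. by apply: integral_ge0 => z _; rewrite lee_fin dot_ge0. Qed.

Section samples.
Context {dO : measure_display} {Omega : measurableType dO} (Q : probability Omega R).
Variables (s : nat) (Z : 'I_s -> Omega -> Xi).
Hypothesis s0 : (0 < s)%N.
Hypothesis mZ : forall j, measurable_fun setT (Z j).
Hypothesis lawZ : forall j C, measurable C -> Q (Z j @^-1` C) = Pz C.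
Hypothesis indZ : forall j k, j != k -> independent_maps Q (Z j) (Z k).
Notation gbar w := (grad_est gamma nu u (fun y => s%:R^-1 * \sum_j f y (Z j w)) x).

(** The sample estimator is [ghat] plus an average of independent centred terms: the linear part has
    mean zero, and the square adds the variance divided by [s]. *)
Lemma sample_average_bound (a : 'rV[R]_d) (r alpha c : R) : 0 < c ->
  (forall v, 0 <= r - alpha * dot a v + c * dot v v) ->
  (\int[Q]_w (r - alpha * dot a (gbar w) + c * dot (gbar w) (gbar w))%:E <=
   (r - alpha * dot a ghat + c * dot ghat ghat)%:E + (c / s%:R)%:E * grad_est_variance)%E.
Proof.
move=> c0 pos.
have s1 : 0 < s%:R :> R by rewrite ltr0n.
(* An infinite variance makes the right side [+oo], its coefficient being positive. *)
have [qoo|qoo] := eqVneq grad_est_variance +oo%E.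
  by rewrite qoo gt0_muley ?lte_fin ?divr_gt0// addey// leey.
have qfin : (grad_est_variance < +oo)%E by rewrite ltey.
pose h z := gz z - ghat.
have ih : Pz.-integrable setT (EFin \o (fun z => dot (h z) (h z))).
  apply/integrableP; split.
    by apply/measurable_EFinP; apply: measurable_dot; exact: measurable_centered_grad_est.
  by under eq_integral do rewrite /= ger0_norm ?dot_ge0//.
have hz0 i : Rintegral Pz setT (fun z => h z 0 i) = 0.
  under eq_Rintegral do rewrite mxE [X in _ + X]mxE.
  rewrite RintegralB//; last 2 first.
  - exact: integrable_grad_est_loss.
  - exact: finite_measure_integrable_cst.
  by rewrite Rintegral_grad_est_loss (Rintegral_probability_cst Pz) subrr.
pose Y j w := h (Z j w).
have lawY j : forall B, measurable B -> Pz (id @^-1` B) = Q (Z j @^-1` B).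
  by move=> B mB; rewrite lawZ.
have mhi i := measurable_centered_grad_est i.
have mhh : measurable_fun setT (fun z => dot (h z) (h z)) by exact: measurable_dot.
have iY j : square_integrable Q (Y j).
  split; first by move=> i; exact: (measurableT_comp (mhi i) (mZ j)).
  exact: (same_law_integrable (@measurable_id _ _ _) (mZ j) (lawY j) mhh ih).
have EY j : Rintegral Q setT (fun w => dot (Y j w) (Y j w)) = fine grad_est_variance.
  by rewrite -(same_law_Rintegral (@measurable_id _ _ _) (mZ j) (lawY j) mhh ih).
have mY j : mean Q (Y j) = 0.
  apply/rowP => i; rewrite !mxE -(hz0 i); apply/esym.
  apply: (same_law_Rintegral (@measurable_id _ _ _) (mZ j) (lawY j) (mhi i)).
  under eq_fun do rewrite /= mxE [X in _ + X]mxE.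
  by apply: integrable_EFinB; [exact: integrable_grad_est_loss|exact: finite_measure_integrable_cst].
pose S w := \sum_j Y j w.
have iS : square_integrable Q S by exact: square_integrable_sum.
have SE : Rintegral Q setT (fun w => dot (S w) (S w)) = s%:R * fine grad_est_variance.
  rewrite Rintegral_square_sum//.
    under eq_bigr => j _.
      rewrite EY big1 ?addr0; last by move=> k _; rewrite mY dot0l.
      over.
    by rewrite sumr_const card_ord mulr_natl.
  move=> j k jk i A B mA mB.
  have mp C : measurable C -> measurable ((fun z => h z 0 i) @^-1` C).
    by move=> mC; rewrite -[X in measurable X]setTI; exact: mhi.
  exact: (indZ jk (mp _ mA) (mp _ mB)).
have gE w : gbar w = ghat + s%:R^-1 *: S w.
  rewrite grad_est_average /S /Y /h sumrB sumr_const card_ord scalerBr -(scaler_nat s ghat) scalerA.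
  by rewrite mulVf ?gt_eqF// scale1r addrC subrK.
have S0 (b : 'rV[R]_d) : Q.-integrable setT (EFin \o (fun w => dot b (S w))) /\
    Rintegral Q setT (fun w => dot b (S w)) = 0.
  split.
    by apply: integrable_EFin_sum => i _; apply: integrable_EFinZ; exact: square_integrable_coord.
  rewrite Rintegral_dot_cst//.
  rewrite (_ : mean Q S = 0) 1?dotC ?dot0l//.
  apply/rowP => i; rewrite mxE; under eq_Rintegral do rewrite summxE.
  rewrite Rintegral_sum => [|j _]; last exact: square_integrable_coord.
  by rewrite big1 ?mxE// => j _; have /rowP/(_ i) := mY j; rewrite !mxE.
pose b := (2 * c) *: ghat - alpha *: a.
pose v0 := r - alpha * dot a ghat + c * dot ghat ghat.
have pE w : r - alpha * dot a (gbar w) + c * dot (gbar w) (gbar w) =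
    v0 + s%:R^-1 * dot b (S w) + c / s%:R ^+ 2 * dot (S w) (S w).
  rewrite gE /b /v0; move: ghat (S w) => g S'; rewrite !dotE (dotC S' g).
  by field; rewrite gt_eqF.
have iv : Q.-integrable setT (EFin \o (cst v0)) by exact: finite_measure_integrable_cst.
have [ib Eb] := S0 b.
have iSS := iS.2.
under eq_integral do rewrite pE.
rewrite EFin_Rintegral; last first.
  by apply: integrable_EFinD; [apply: integrable_EFinD => //; exact: integrable_EFinZ|exact: integrable_EFinZ].
rewrite RintegralD//; last 2 first.
- by apply: integrable_EFinD => //; exact: integrable_EFinZ.
- exact: integrable_EFinZ.
rewrite RintegralD//; last exact: integrable_EFinZ.
rewrite !RintegralZl// Eb SE (Rintegral_probability_cst Q) mulr0 addr0.
have qE : grad_est_variance = (fine grad_est_variance)%:E.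
  by rewrite fineK// ge0_fin_numE// grad_est_variance_ge0.
rewrite [in leRHS]qE -EFinM -EFinD lee_fin lerD2l le_eqVlt; apply/orP; left; apply/eqP.
by field; rewrite gt_eqF.
Qed.

End samples.
End fixed_point.

Section sub_sigma_algebras.
Context {R : realType} {d : nat} {dO : measure_display} {Omega : measurableType dO}.

Lemma sigma_algebra_sub (T : Type) (G H : set (set T)) : G `<=` <<s H >> -> <<s G >> `<=` <<s H >>.
Proof. by move=> GH; apply: smallest_sub => //; exact: smallest_sigma_algebra. Qed.

Lemma measurable_sub_sigma {dY} {Y : measurableType dY} (G H : set (set Omega)) (g : Omega -> Y) :
  <<s G >> `<=` <<s H >> ->
  measurable_fun [set: g_sigma_algebraType G] g ->
  measurable_fun [set: g_sigma_algebraType H] g.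
Proof. by move=> GH mg _ B mB; apply: GH; exact: mg. Qed.

Lemma measurable_of_sub_sigma {dY} {Y : measurableType dY} (G : set (set Omega)) (g : Omega -> Y) :
  <<s G >> `<=` measurable ->
  measurable_fun [set: g_sigma_algebraType G] g -> measurable_fun [set: Omega] g.
Proof. by move=> Gm mg _ B mB; apply: Gm; exact: mg. Qed.

Lemma measurable_id_sigma (G : set (set Omega)) : <<s G >> `<=` measurable ->
  measurable_fun [set: Omega] (id : Omega -> g_sigma_algebraType G).
Proof. by move=> Gm _ B mB; rewrite setTI preimage_id; exact: Gm. Qed.

Lemma measurable_fun_partition {dT dY} {U : measurableType dT} {Y : measurableType dY}
    (n : U -> nat) (g : nat -> U -> Y) :
  (forall s, measurable [set w | n w = s]) -> (forall s, measurable_fun setT (g s)) ->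
  measurable_fun setT (fun w => g (n w) w).
Proof.
move=> mn mg _ B mB; rewrite setTI.
have -> : (fun w => g (n w) w) @^-1` B = \bigcup_s ([set w | n w = s] `&` g s @^-1` B).
  by apply/seteqP; split => w /=; [move=> Bw; exists (n w)|move=> [s _ [<-]]].
apply: bigcupT_measurable => s; apply: measurableI => //.
by rewrite -[X in measurable X]setTI; exact: mg.
Qed.

Lemma measurable_grad_est_caratheodory {dY} {Y : measurableType dY} (N : nat)
    (phi : 'rV[R]_d -> Y -> R) (X : Y -> 'rV[R]_d) (U : 'I_N -> Y -> 'rV[R]_d) gamma nu i :
  (forall y, continuous (phi ^~ y)) -> (forall v, measurable_fun setT (phi v)) ->
  (forall i, measurable_fun setT (fun y => X y 0 i)) ->
  (forall j i, measurable_fun setT (fun y => U j y 0 i)) ->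
  measurable_fun setT (fun y => grad_est gamma nu (U ^~ y) (phi ^~ y) (X y) 0 i).
Proof.
move=> cphi mphi mX mU; under eq_fun do rewrite grad_est_coord.
apply: measurable_funM => //; apply: measurable_sum => j; apply: measurable_funM; last first.
  by apply: measurable_funM => //; exact: mU.
apply: measurable_funB.
  apply: (@measurable_caratheodory R d _ Y phi (fun y => X y + nu *: U j y)) => // i'.
  under eq_fun do rewrite mxE [X in _ + X]mxE.
  by apply: measurable_funD => //; exact: measurable_funM.
apply: (@measurable_caratheodory R d _ Y phi (fun y => X y - nu *: U j y)) => // i'.
under eq_fun do rewrite mxE [X in _ + X]mxE [X in - X]mxE.
by apply: measurable_funB => //; exact: measurable_funM.
Qed.

End sub_sigma_algebras.

(** * The filtration, and measurability of the iterates *)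

Section history.
Context {R : realType} {d : nat} {dXi : measure_display} {Xi : measurableType dXi}
  {Pz : probability Xi R} {f : 'rV[R]_d -> Xi -> R}
  {dO : measure_display} {Omega : measurableType dO} {P : probability Omega R} {N : nat}
  {T : nat -> 'I_N -> Omega -> 'rV[R]_d} {n : nat -> Omega -> nat}
  {zeta : nat -> nat -> Omega -> Xi}.
Hypothesis hA3 : assumption_A3 Pz P T n zeta.

(** The generating families are named so that [Omega] can carry each sigma-algebra as a type; being
    adapted is then plain measurability on [history_type k]. *)
Definition history_generator k : set (set Omega) := [set A | exists i, (i < k)%N /\
  (vec_sigma (T i) A \/
   exists j C, measurable C /\ A = [set w | (j < n i w)%N /\ C (zeta i j w)])].

Definition history_type k := g_sigma_algebraType (history_generator k).

Definition directions_generator k : set (set Omega) :=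
  [set A | exists i C, borel_vec C /\ A = T k i @^-1` C].

Definition directions_type k := g_sigma_algebraType (directions_generator k).

Definition half_history_generator k : set (set Omega) :=
  history T n zeta k `|` vec_sigma (T k).

Definition half_history_type k := g_sigma_algebraType (half_history_generator k).

Lemma history_le i k : (i <= k)%N -> history T n zeta i `<=` history T n zeta k.
Proof.
move=> ik; apply: sigma_algebra_sub => A [j [ji H]]; apply: sub_sigma_algebra.
by exists j; split=> //; exact: leq_trans ik.
Qed.

Lemma vec_sigma_measurable k : vec_sigma (T k) `<=` measurable.
Proof.
apply: smallest_sub; first exact: sigma_algebra_measurable.
by move=> _ [i [C [bC ->]]]; exact: (A3_T_random hA3).
Qed.

(** Strong induction: a generator at time [i] involves the event [j < n i], which is measurable only
    because it belongs to history [i]. *)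
Lemma history_measurable k : history T n zeta k `<=` measurable.
Proof.
elim/ltn_ind: k => k IH; apply: smallest_sub; first exact: sigma_algebra_measurable.
move=> A [i [ik [TA|[j [C [mC ->]]]]]]; first exact: vec_sigma_measurable TA.
have -> : [set w | (j < n i w)%N /\ C (zeta i j w)] =
    (\bigcup_(s in [set s | (j < s)%N]) [set w | n i w = s]) `&` zeta i j @^-1` C.
  apply/seteqP; split => w /=; first by move=> [jn Cw]; split=> //; exists (n i w).
  by move=> [[s /= js ns] Cw]; split=> //; rewrite ns.
apply: measurableI.
  by apply: bigcup_measurable => s _; apply: (IH i ik); exact: (A3_n_history hA3).
by rewrite -[X in measurable X]setTI; exact: (A3_zeta_random hA3).
Qed.

Lemma half_history_measurable k : half_history T n zeta k `<=` measurable.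
Proof.
apply: smallest_sub; first exact: sigma_algebra_measurable.
by move=> A [/history_measurable|/vec_sigma_measurable].
Qed.

Lemma history_half k : history T n zeta k `<=` half_history T n zeta k.
Proof. by move=> A HA; apply: sub_sigma_algebra; left. Qed.

Lemma half_history_next k : half_history T n zeta k `<=` history T n zeta k.+1.
Proof.
apply: sigma_algebra_sub => A [|TA]; first exact: history_le.
by apply: sub_sigma_algebra; exists k; split => //; left.
Qed.

Lemma measurable_direction_type k j i :
  measurable_fun [set: directions_type k] (fun w => T k j w 0 i).
Proof.
move=> _ B mB; rewrite setTI; apply: sub_sigma_algebra.
by exists j, [set v | B (v 0 i)]; split => //; exact: borel_vec_coord.
Qed.

Lemma measurable_direction_half k j i :
  measurable_fun [set: half_history_type k] (fun w => T k j w 0 i).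
Proof.
apply: measurable_sub_sigma (measurable_direction_type j i).
by move=> A TA; apply: sub_sigma_algebra; right.
Qed.

Lemma measurable_sample_average k (y : 'rV[R]_d) :
  (forall y, measurable_fun setT (f y)) ->
  measurable_fun [set: history_type k.+1] (fun w => sample_average f n zeta k w y).
Proof.
move=> mf; rewrite /sample_average.
(* Entries beyond the sample size are replaced by 0, since the history records [zeta k j] only where
   [j < n k]. *)
pose g (s : nat) (w : Omega) : R := s%:R^-1 * \sum_(j < s) (if (j < n k w)%N then f y (zeta k j w) else 0).
have -> : (fun w => (n k w)%:R^-1 * \sum_(j < n k w) f y (zeta k j w)) = fun w => g (n k w) w.
  apply/funext => w; rewrite /g; congr (_ * _); apply: eq_bigr => j _.
  by rewrite ltn_ord.
apply: (@measurable_fun_partition _ _ (history_type k.+1) _ (n k) g) => s.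
  apply: (history_le (leqnSn k)); exact: (A3_n_history hA3).
apply: measurable_funM => //; apply: measurable_sum => j.
move=> _ B mB; rewrite setTI.
have gen C : measurable C -> @measurable _ (history_type k.+1)
    [set w | (j < n k w)%N /\ C (zeta k j w)].
  by move=> mC; apply: sub_sigma_algebra; exists k; split => //; right; exists j, C.
have mC : measurable (f y @^-1` B) by rewrite -[X in measurable X]setTI; exact: mf.
have nj : @measurable _ (history_type k.+1) [set w | (j < n k w)%N].
  have -> : [set w | (j < n k w)%N] = [set w | (j < n k w)%N /\ setT (zeta k j w)].
    by apply/seteqP; split => w /=; tauto.
  exact: gen.
(* The event [n k <= j] belongs to the preimage exactly when [B] contains the filler value 0. *)
have [B0|B0] := pselect (B 0).
  have -> : (fun w => if (j < n k w)%N then f y (zeta k j w) else 0) @^-1` B =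
      [set w | (j < n k w)%N /\ (f y @^-1` B) (zeta k j w)] `|` ~` [set w | (j < n k w)%N].
    apply/seteqP; split => w /=; case: ifP => //.
    - by move=> ? ?; left.
    - by move=> ? ?; right.
    - by move=> jn [[]//|].
  by apply: measurableU; [exact: gen|exact: measurableC].
have -> : (fun w => if (j < n k w)%N then f y (zeta k j w) else 0) @^-1` B =
    [set w | (j < n k w)%N /\ (f y @^-1` B) (zeta k j w)].
  by apply/seteqP; split => w /=; case: ifP => // jn []//.
exact: gen.
Qed.

Section iterates.
Hypothesis hf : integrable_loss Pz f.
Hypothesis cf : forall z, continuous (f ^~ z).
Variables (gamma nu alpha : R) (x0 : 'rV[R]_d) (x : nat -> Omega -> 'rV[R]_d).
Hypothesis hx : generates f T n zeta gamma nu x x0 alpha.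

Lemma measurable_iterate k i : measurable_fun [set: history_type k] (fun w => x k w 0 i).
Proof.
elim: k i => [|k IH] i.
  by under eq_fun do rewrite hx.1; exact: measurable_cst.
have mx i' : measurable_fun [set: history_type k.+1] (fun w => x k w 0 i').
  exact: measurable_sub_sigma (history_le (leqnSn k)) (IH i').
have mT j i' : measurable_fun [set: history_type k.+1] (fun w => T k j w 0 i').
  exact: measurable_sub_sigma (@half_history_next k) (measurable_direction_half j i').
have mf y : measurable_fun setT (f y) by exact: (measurable_loss hf).
have cS w : continuous (sample_average f n zeta k w).
  move=> y; apply: (continuous_mul (@continuous_const R _ (n k w)%:R^-1)).
  apply: (@continuous_big R^o); first exact: (@add_continuous R^o).
  by move=> j _; exact: cf.
under eq_fun do rewrite hx.2 mxE [X in _ + X]mxE [X in - X]mxE.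
apply: measurable_funB => //; apply: measurable_funM => //.
apply: (@measurable_grad_est_caratheodory _ _ _ (history_type k.+1) N
  (fun y w => sample_average f n zeta k w y) (x k) (T k)) => // y.
exact: measurable_sample_average.
Qed.

End iterates.
End history.

Section sampling.
Context {R : realType} {d : nat} {dXi : measure_display} {Xi : measurableType dXi}
  {Pz : probability Xi R}
  {dO : measure_display} {Omega : measurableType dO} {P : probability Omega R} {N : nat}
  {T : nat -> 'I_N -> Omega -> 'rV[R]_d} {n : nat -> Omega -> nat}
  {zeta : nat -> nat -> Omega -> Xi}.
Hypothesis hA3 : assumption_A3 Pz P T n zeta.
Variables (k s : nat).
Notation half_type := (half_history_type (T := T) (n := n) (zeta := zeta) k).

Definition sample_size_event : set Omega := [set w | n k w = s].
Notation E := sample_size_event.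

Lemma sample_size_event_history : history T n zeta k E.
Proof. exact: (A3_n_history hA3). Qed.

Lemma measurable_sample_size_event : measurable E.
Proof. exact: (history_measurable hA3 sample_size_event_history). Qed.
Notation mE := measurable_sample_size_event.

(** Rectangles in the first [s] samples: the pi-system on which [A3_S_iid] gives a product
    formula. *)
Definition samples_generator : set (set Omega) := [set A | exists C : nat -> set Xi,
  (forall j, measurable (C j)) /\ A = [set w | forall j, (j < s)%N -> C j (zeta k j w)]].

Definition samples_type := g_sigma_algebraType samples_generator.

Lemma samples_generator_measurable : samples_generator `<=` measurable.
Proof.
move=> _ [C [mC ->]].
have -> : [set w | forall j, (j < s)%N -> C j (zeta k j w)] =
    \bigcap_(j in [set j | (j < s)%N]) (zeta k j @^-1` C j) by [].
apply: bigcap_measurableType => j _.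
by rewrite -[X in measurable X]setTI; exact: (A3_zeta_random hA3).
Qed.

Lemma samples_measurable : <<s samples_generator >> `<=` measurable.
Proof.
apply: smallest_sub; first exact: sigma_algebra_measurable.
exact: samples_generator_measurable.
Qed.

Lemma measurable_sample_type j : (j < s)%N ->
  measurable_fun [set: samples_type] (zeta k j).
Proof.
move=> js _ C mC; rewrite setTI; apply: sub_sigma_algebra.
exists (fun i => if i == j then C else setT); split; first by move=> i; case: ifP.
apply/seteqP; split => w /=; last by move/(_ j js); rewrite eqxx.
by move=> Cw i _; case: eqP => // ->.
Qed.

Hypothesis PE0 : P E != 0%E.
Notation Q := (cond_prob P mE).

Let PEinv : (P E * (fine (P E))^-1%:E = 1)%E.
Proof.
have PEf : P E = (fine (P E))%:E by rewrite fineK// fin_num_measure//; exact: mE.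
rewrite PEf -EFinM divff// -eqe -PEf; exact: PE0.
Qed.

Lemma cond_samples (C : nat -> set Xi) : (forall j, measurable (C j)) ->
  Q [set w | forall j, (j < s)%N -> C j (zeta k j w)] = \big[*%E/1%E]_(j < s) Pz (C j).
Proof.
move=> mC; rewrite cond_probE//; last first.
  by apply: samples_generator_measurable; exists C.
have hT : half_history T n zeta k setT := @measurableT _ (half_history_type k).
have := A3_S_iid hA3 s mC hT; rewrite setTI setIC => ->.
by rewrite muleAC PEinv mul1e.
Qed.

Lemma cond_sample j (C : set Xi) : (j < s)%N -> measurable C ->
  Q (zeta k j @^-1` C) = Pz C.
Proof.
move=> js mC.
have := @cond_samples (fun i => if i == j then C else setT).
rewrite (bigD1 (Ordinal js))//= eqxx big1 => [|i]; last first.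
  by rewrite -val_eqE/= => /negPf->; exact: probability_setT.
rewrite mule1 => <-; last by move=> i; case: ifP.
congr (Q _); apply/seteqP; split => w /=; last by move/(_ j js); rewrite eqxx.
by move=> Cw i _; case: eqP => // ->.
Qed.

Lemma cond_samples_pair j l : (j < s)%N -> (l < s)%N -> j != l ->
  independent_maps Q (zeta k j) (zeta k l).
Proof.
move=> js ls jl A B mA mB; rewrite (cond_sample js mA) (cond_sample ls mB).
have := @cond_samples (fun i => if i == j then A else if i == l then B else setT).
rewrite (bigD1 (Ordinal js))//= eqxx (bigD1 (Ordinal ls))/=; last first.
  by rewrite -val_eqE/= eq_sym.
rewrite eqxx (eq_sym l) (negPf jl) big1 => [|i]; last first.
  by rewrite -!val_eqE/= => /andP[/negPf-> /negPf->]; exact: probability_setT.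
rewrite mule1 => <-; last by move=> i; case: ifP => // _; case: ifP.
congr (Q _); apply/seteqP; split => w /=.
  by move=> [Aw Bw] i _; case: eqP => [->//|_]; case: eqP => // ->.
move=> H; split; first by have := H j js; rewrite eqxx.
by have := H l ls; rewrite eqxx (eq_sym l) (negPf jl).
Qed.

(** After division by the probability of the event, [A3_S_iid] is independence from rectangles of
    samples; the pi-system argument extends it to all sample events. *)
Lemma cond_history_samples : independent_maps Q (id : Omega -> half_type)
  (id : Omega -> samples_type).
Proof.
move=> A B hA sB; rewrite !preimage_id.
have mA : @measurable _ Omega A by exact: (half_history_measurable hA3 hA).
rewrite setIC muleC; apply: (@independent_sigma _ _ _ Q samples_generator) => //.
- exact: samples_generator_measurable.
- move=> _ _ [C [mC ->]] [D [mD ->]]; exists (fun j => C j `&` D j).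
  split; first by move=> j; exact: measurableI.
  apply/seteqP; split => w /=; first by move=> [H K] j js; split; [exact: H|exact: K].
  by move=> H; split => j js; case: (H j js).
- by exists (fun=> setT); split => //; apply/seteqP; split.
move=> _ [C [mC ->]]; rewrite cond_samples// !cond_probE//; last first.
  by apply: measurableI => //; apply: samples_generator_measurable; exists C.
rewrite (setIC _ A) setIAC (A3_S_iid hA3 s mC hA).
by rewrite (muleC (P _)) muleA.
Qed.

(* Under the conditional law given {n k = s} the samples are independent of the
   half history, so they can be redrawn. *)
Lemma sample_tonelli (H : half_type * samples_type -> \bar R) :
  measurable_fun setT H -> (forall y, 0 <= H y)%E ->
  (\int[P]_(w in E) H (w, w) = \int[P]_(w in E) \int[Q]_w' H (w, w'))%E.
Proof.
move=> mH H0.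
have mX := measurable_id_sigma (half_history_measurable hA3 (k := k)).
have mZ := measurable_id_sigma samples_measurable.
have XZ := cond_history_samples.
transitivity (P E * \int[Q]_w H (w, w))%E.
  by apply: cond_prob_integral => //; exact: (measurableT_comp mH (measurable_fun_pair mX mZ)).
transitivity (P E * \int[Q]_w \int[Q]_w' H (w, w'))%E.
  by congr (_ * _)%E; exact: (independent_tonelli mX mZ XZ mH H0).
apply/esym; apply: cond_prob_integral => //.
  exact: (measurableT_comp (measurable_independent_section Q mZ mH H0) mX).
by move=> w; exact: integral_ge0.
Qed.

End sampling.

Section sub_sigma_integrals.
Context {R : realType} {dO : measure_display} {Omega : measurableType dO}
  (P : probability Omega R).

Lemma null_of_integral_eq0 (A : set Omega) (g : Omega -> \bar R) : measurable A ->
  measurable_fun setT g -> (forall w, A w -> 0 < g w)%E ->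
  (\int[P]_(w in A) g w = 0)%E -> P A = 0%E.
Proof.
move=> mA mg g0 Ig.
have mgA : measurable_fun A g by exact: measurable_funTS.
have : (\int[P]_(w in A) `|g w| = 0)%E.
  rewrite -Ig; apply: eq_integral => w; rewrite inE => Aw.
  by rewrite gee0_abs// ltW// g0.
move/(ae_eq_integral_abs P mA mgA) => [B [mB PB AB]].
apply/eqP; rewrite -measure_le0 -PB; apply: le_measure; rewrite ?inE// => w Aw.
apply: AB => /= /(_ Aw) gw0; by have := g0 w Aw; rewrite gw0 ltxx.
Qed.

Lemma null_of_integral_eq (A : set Omega) (u v : Omega -> R) : measurable A ->
  measurable_fun setT u -> measurable_fun setT v ->
  P.-integrable A (EFin \o u) -> P.-integrable A (EFin \o v) ->
  (forall w, A w -> u w < v w) ->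
  (\int[P]_(w in A) (u w)%:E = \int[P]_(w in A) (v w)%:E)%E -> P A = 0%E.
Proof.
move=> mA mu mv iu iv uv Iuv.
apply: (@null_of_integral_eq0 A (fun w => (v w)%:E - (u w)%:E)%E) => //.
- by apply/measurable_EFinP; exact: measurable_funB.
- by move=> w Aw; rewrite -EFinB lte_fin subr_gt0 uv.
rewrite (integralB mA iv iu) /= Iuv subee//.
by have := integrable_fin_num mA iv.
Qed.

Variable G : set (set Omega).
Hypothesis Gm : <<s G >> `<=` measurable.

(** The set where [Y] is negative lies in the sigma-algebra, and over it [Y] has the same integral
    as [X], which is nonnegative; so this set is null. *)
Lemma cond_exp_ge0 (X Y : Omega -> \bar R) : is_cond_exp P <<s G >> X Y ->
  (forall w, 0 <= X w)%E -> {ae P, forall w, (0 <= Y w)%E}.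
Proof.
move=> [mY IY] X0; pose A := [set w | (Y w < 0)%E].
have GA : <<s G >> A.
  have -> : A = Y @^-1` [set y | (y < 0)%E] by [].
  by apply: mY; rewrite -[X in measurable X]setTI; exact: (measurable_lte measurableT (@measurable_id _ _ setT) (measurable_cst _)).
exists A; split; first exact: Gm.
  apply: (@null_of_integral_eq0 A (fun w => - Y w)%E); first exact: Gm.
  - apply: measurableT_comp => //.
    by move=> _ B mB; rewrite setTI; apply: Gm; exact: mY.
  - by move=> w Yw; rewrite oppe_gt0.
  have nY0 w : A w -> (0 <= - Y w)%E by move=> Yw; rewrite oppe_ge0 ltW.
  apply/eqP; rewrite eq_le; apply/andP; split; last exact: integral_ge0.
  rewrite -oppe_ge0 -(integral_ge0N P nY0).
  under eq_integral do rewrite oppeK.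
  by rewrite (IY _ GA); exact: integral_ge0.
by move=> w /=; rewrite leNgt => /negP; rewrite negbK.
Qed.

(** Uniqueness of conditional expectation, localised to [B]: the parts of [B] where [u < v] or
    [v < u] are admissible test sets, and boundedness keeps the integrals over them finite. *)
Lemma ae_eq_of_sigma (B : set Omega) (c : R) (u v : Omega -> R) :
  <<s G >> B -> measurable_fun [set: g_sigma_algebraType G] u ->
  measurable_fun [set: g_sigma_algebraType G] v ->
  (forall w, B w -> `|u w| <= c) -> (forall w, B w -> `|v w| <= c) ->
  (forall A, <<s G >> A -> A `<=` B ->
     (\int[P]_(w in A) (u w)%:E = \int[P]_(w in A) (v w)%:E)%E) ->
  {ae P, forall w, B w -> u w = v w}.
Proof.
move=> GB mu mv uc vc Iuv.
have mu' := measurable_of_sub_sigma Gm mu; have mv' := measurable_of_sub_sigma Gm mv.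
have bnd (g : Omega -> R) A : measurable_fun setT g -> <<s G >> A -> A `<=` B ->
    (forall w, B w -> `|g w| <= c) -> P.-integrable A (EFin \o g).
  move=> mg GA AB gc.
  apply: (@le_integrable _ _ _ P _ (Gm GA) _ (EFin \o cst c)).
  - by apply/measurable_EFinP; exact: measurable_funTS.
  - by move=> w Aw; rewrite lee_fin /= (le_trans (gc _ (AB _ Aw)))// ler_norm.
  - by apply: finite_measure_integrable_cst; exact: Gm.
have null (g h : Omega -> R) : measurable_fun [set: g_sigma_algebraType G] g ->
    measurable_fun [set: g_sigma_algebraType G] h ->
    (forall w, B w -> `|g w| <= c) -> (forall w, B w -> `|h w| <= c) ->
    (forall A, <<s G >> A -> A `<=` B ->
       (\int[P]_(w in A) (g w)%:E = \int[P]_(w in A) (h w)%:E)%E) ->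
    measurable (B `&` [set w | g w < h w]) /\ P (B `&` [set w | g w < h w]) = 0%E.
  move=> mg mh gc hc Igh.
  have GA : <<s G >> (B `&` [set w | g w < h w]).
    have mlt : @measurable _ (g_sigma_algebraType G) [set w | g w < h w].
      rewrite -[X in measurable X]setTI.
      by apply: (@measurable_lte _ (g_sigma_algebraType G) R _ measurableT (EFin \o g) (EFin \o h));
        exact/measurable_EFinP.
    exact: (@measurableI _ (g_sigma_algebraType G)).
  have mA := Gm GA; split => //.
  apply: (@null_of_integral_eq _ g h) => //.
  - exact: measurable_of_sub_sigma mg.
  - exact: measurable_of_sub_sigma mh.
  - by apply: (bnd g) => //; exact: measurable_of_sub_sigma mg.
  - by apply: (bnd h) => //; exact: measurable_of_sub_sigma mh.
  - by move=> w [].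
  - by apply: Igh => // w [].
have [m1 P1] := null u v mu mv uc vc Iuv.
have [m2 P2] := null v u mv mu vc uc (fun A GA AB => esym (Iuv A GA AB)).
have N12 := negligibleU ((negligibleP P m1).2 P1) ((negligibleP P m2).2 P2).
apply: negligibleS N12.
by move=> w /= /not_implyP[Bw /eqP]; rewrite neq_lt => /orP[|] ?; [left|right].
Qed.

End sub_sigma_integrals.

Section sampled_integrals.
Context {R : realType} {d : nat} {dXi : measure_display} {Xi : measurableType dXi}
  {Pz : probability Xi R}
  {dO : measure_display} {Omega : measurableType dO} {P : probability Omega R} {N : nat}
  {T : nat -> 'I_N -> Omega -> 'rV[R]_d} {n : nat -> Omega -> nat}
  {zeta : nat -> nat -> Omega -> Xi}.
Hypothesis hA3 : assumption_A3 Pz P T n zeta.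
Variables (k s : nat).
Notation half_type := (half_history_type (T := T) (n := n) (zeta := zeta) k).
Notation E := (sample_size_event (n := n) k s).

Lemma measurable_of_half {dY} {Y : measurableType dY} (g : Omega -> Y) :
  measurable_fun [set: half_type] g -> measurable_fun [set: Omega] g.
Proof. exact: measurable_of_sub_sigma (half_history_measurable hA3 (k := k)). Qed.

Lemma measurable_sampled {dY} {Y : measurableType dY} (h : half_type * Xi -> Y) j :
  measurable_fun setT h -> measurable_fun [set: Omega] (fun w => h (w, zeta k j w)).
Proof.
move=> mh; apply: (measurableT_comp mh).
exact: measurable_fun_pair (measurable_id_sigma (half_history_measurable hA3 (k := k)))
  (A3_zeta_random hA3 k j).
Qed.

Lemma sample_integral (h : half_type * Xi -> \bar R) j : (j < s)%N ->
  measurable_fun setT h -> (forall y, 0 <= h y)%E ->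
  (\int[P]_(w in E) h (w, zeta k j w) = \int[P]_(w in E) \int[Pz]_z h (w, z))%E.
Proof.
move=> js mh h0.
have mE := measurable_sample_size_event hA3 k s.
have mIh : measurable_fun [set: half_type] (fun w => \int[Pz]_z h (w, z))%E.
  exact: measurable_fun_fubini_tonelli_F.
have [PE0|PE0] := eqVneq (P E) 0%E.
  rewrite !null_set_integral//; apply: measurable_funTS; first exact: measurable_of_half.
  exact: measurable_sampled.
pose H (p : half_type * samples_type (zeta := zeta) k s) := h (p.1, zeta k j p.2).
have mH : measurable_fun setT H.
  apply: (measurableT_comp mh); apply: measurable_fun_pair; first exact: measurable_fst.
  have mz : measurable_fun [set: samples_type (zeta := zeta) k s] (zeta k j).
    by apply: measurable_sample_type.
  exact: (measurableT_comp mz measurable_snd).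
rewrite (sample_tonelli hA3 PE0 mH (fun y => h0 (y.1, zeta k j y.2))).
apply: eq_integral => w _; apply/esym.
have law B : measurable B -> Pz (id @^-1` B) =
    cond_prob P (measurable_sample_size_event hA3 k s) (zeta k j @^-1` B).
  by move=> mB; rewrite preimage_id (cond_sample hA3 PE0 js mB).
apply: (same_law_integral (@measurable_id _ _ _) (A3_zeta_random hA3 k j) law
  (H := fun z => h (w, z))) => //.
exact: measurableT_comp mh (pair1_measurable _).
Qed.

(** The indicator of [A] is determined by the half history, so it is absorbed into the integrand. *)
Lemma sample_integral_sub (h : half_type * Xi -> \bar R) (A : set Omega) j : (j < s)%N ->
  half_history T n zeta k A -> A `<=` E ->
  measurable_fun setT h -> (forall y, 0 <= h y)%E ->
  (\int[P]_(w in A) h (w, zeta k j w) = \int[P]_(w in A) \int[Pz]_z h (w, z))%E.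
Proof.
move=> js hA AE mh h0.
pose h' (p : half_type * Xi) := ((\1_A p.1)%:E * h p)%E.
have mh' : measurable_fun setT h'.
  apply: emeasurable_funM => //; apply/measurable_EFinP.
  have m1 : measurable_fun [set: half_type] (\1_A : half_type -> R) by exact: measurable_indic.
  exact: (measurableT_comp m1 measurable_fst).
have h'0 y : (0 <= h' y)%E by rewrite mule_ge0 ?lee_fin// ler0n.
have mA : @measurable _ Omega A := half_history_measurable hA3 hA.
have mE := measurable_sample_size_event hA3 k s.
have restr (g : Omega -> \bar R) : (\int[P]_(w in A) g w = \int[P]_(w in E) ((\1_A w)%:E * g w))%E.
  rewrite integral_mkcond [RHS]integral_mkcond; apply: eq_integral => w _.
  rewrite /patch /= indicE; case: ifPn => [wA|wA].
    by rewrite mul1e ifT// inE; apply: AE; rewrite inE in wA.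
  by rewrite mul0e; case: ifP.
rewrite restr (sample_integral js mh' h'0) restr; apply: eq_integral => w _.
rewrite /h' /= ge0_integralZl_EFin//; exact: measurableT_comp mh (pair1_measurable _).
Qed.

(** The uniform bound [c] on the conditional absolute moment makes the positive and negative parts
    integrable over [A], so a signed integrand can be redrawn too. *)
Lemma sample_fubini (h : half_type * Xi -> R) (A : set Omega) (c : R) j : (j < s)%N ->
  half_history T n zeta k A -> A `<=` E -> measurable_fun setT h ->
  (forall w, A w -> (\int[Pz]_z `|h (w, z)|%:E <= c%:E)%E) ->
  P.-integrable A (fun w => (h (w, zeta k j w))%:E) /\
  (\int[P]_(w in A) (h (w, zeta k j w))%:E = \int[P]_(w in A) \int[Pz]_z (h (w, z))%:E)%E.
Proof.
move=> js hA AE mh hc.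
have mA : @measurable _ Omega A := half_history_measurable hA3 hA.
have meh : measurable_fun setT (EFin \o h) by exact/measurable_EFinP.
have mah : measurable_fun setT (fun p => `|h p|%:E) by exact/measurable_EFinP/measurableT_comp.
have mI (g : half_type * Xi -> \bar R) : measurable_fun setT g -> (forall y, 0 <= g y)%E ->
    measurable_fun [set: Omega] (fun w => \int[Pz]_z g (w, z))%E.
  by move=> mg g0; apply: measurable_of_half; exact: measurable_fun_fubini_tonelli_F.
have icst : P.-integrable A (EFin \o cst c) by exact: finite_measure_integrable_cst.
have ipart (g : half_type * Xi -> \bar R) : measurable_fun setT g -> (forall y, 0 <= g y)%E ->
    (forall y, g y <= `|h y|%:E)%E ->
    P.-integrable A (fun w => \int[Pz]_z g (w, z))%E.
  move=> mg g0 gh; apply: (le_integrable mA _ _ icst).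
    by apply: measurable_funTS; exact: mI.
  move=> w Aw; rewrite gee0_abs ?integral_ge0//=.
  apply: le_trans (le_trans (hc w Aw) _); last by rewrite lee_fin ler_norm.
  apply: ge0_le_integral => //.
  - exact: measurableT_comp mg (pair1_measurable _).
  - exact: measurableT_comp mah (pair1_measurable _).
split.
  apply/integrableP; split.
    by apply: measurable_funTS; exact: (measurable_sampled j meh).
  under eq_integral do rewrite abse_EFin.
  rewrite (sample_integral_sub js hA AE mah)//.
  have := ipart _ mah (fun y => normr_ge0 _) (fun y => lexx _).
  move=> /integrableP[_]; under eq_integral do rewrite gee0_abs ?integral_ge0//.
  by [].
pose hp (p : half_type * Xi) : \bar R := maxe (h p)%:E 0%E.
pose hm (p : half_type * Xi) : \bar R := maxe (- (h p)%:E)%E 0%E.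
have mp : measurable_fun setT hp by exact: measurable_maxe.
have mm : measurable_fun setT hm by apply: measurable_maxe => //; exact: measurableT_comp.
have hp0 y : (0 <= hp y)%E by rewrite le_max lexx orbT.
have hm0 y : (0 <= hm y)%E by rewrite le_max lexx orbT.
have parts d' (Y : measurableType d') (mu : measure Y R) (D : set Y) (g : Y -> half_type * Xi) :
    (\int[mu]_(y in D) (h (g y))%:E =
     \int[mu]_(y in D) hp (g y) - \int[mu]_(y in D) hm (g y))%E.
  rewrite integralE; congr (_ - _)%E; apply: eq_integral => y _.
    by rewrite funeposE.
  by rewrite funenegE.
rewrite (parts _ _ P A (fun w => (w, zeta k j w))).
rewrite (sample_integral_sub js hA AE mp hp0) (sample_integral_sub js hA AE mm hm0).
rewrite -integralB//.
- by apply: eq_integral => w _; rewrite (parts _ _ Pz setT (fun z => (w, z))).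
- apply: ipart => // y.
  by rewrite /hp maxEle; case: ifP => // _; rewrite lee_fin ?ler_norm.
- apply: ipart => // y.
  by rewrite /hm maxEle; case: ifP => // _; rewrite lee_fin// -normrN ler_norm.
Qed.

End sampled_integrals.

(** * The norm condition as an inequality between integrals *)

Section norm_condition.
Context {R : realType} {d : nat} {dXi : measure_display} {Xi : measurableType dXi}
  {Pz : probability Xi R} {f : 'rV[R]_d -> Xi -> R}
  {dO : measure_display} {Omega : measurableType dO} {P : probability Omega R} {N : nat}
  {T : nat -> 'I_N -> Omega -> 'rV[R]_d} {n : nat -> Omega -> nat}
  {zeta : nat -> nat -> Omega -> Xi}.
Hypothesis hA3 : assumption_A3 Pz P T n zeta.
Hypothesis hf : integrable_loss Pz f.
Hypothesis cf : forall z, continuous (f ^~ z).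
Hypothesis cF : continuous (objective Pz f).
Variables (gamma nu : R) (x : nat -> Omega -> 'rV[R]_d) (k : nat).
Notation half_type := (half_history_type (T := T) (n := n) (zeta := zeta) k).
Hypothesis mx : forall i, measurable_fun [set: half_type] (fun w => x k w 0 i).
Notation E s := (sample_size_event (n := n) k s).
Notation gz := (g_zT f T gamma nu x k).
Notation gST := (g_ST f T n zeta gamma nu x k).

(** The explicit candidate for the conditional mean over the samples: by linearity of the estimator,
    averaging over one sample replaces the loss by the objective. *)
Definition smoothed_grad (w : Omega) : 'rV[R]_d :=
  grad_est gamma nu (directions T k w) (objective Pz f) (x k w).
Notation ghat := smoothed_grad.

Definition sample_variance (w : Omega) : \bar R :=
  grad_est_variance Pz f gamma nu (directions T k w) (x k w).

Lemma measurable_g_zT i : measurable_fun [set: half_type * Xi] (fun p => gz p.1 p.2 0 i).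
Proof.
apply: (@measurable_grad_est_caratheodory _ _ _ (half_type * Xi)%type N
  (fun v p => f v p.2) (fun p => x k p.1) (fun j p => T k j p.1)) => [y|v|i'|j i'].
- exact: cf.
- exact: (measurableT_comp (measurable_loss hf v) measurable_snd).
- exact: (measurableT_comp (mx i') measurable_fst).
- have mT : measurable_fun [set: half_type] (fun w => T k j w 0 i').
    exact: measurable_direction_half.
  exact: (measurableT_comp mT measurable_fst).
Qed.

Lemma measurable_smoothed_grad i : measurable_fun [set: half_type] (fun w => ghat w 0 i).
Proof.
apply: (@measurable_grad_est_caratheodory _ _ _ half_type N
  (fun v _ => objective Pz f v) (x k) (T k)) => // j i'.
exact: measurable_direction_half.
Qed.

Lemma g_STE s w : n k w = s -> gST w = s%:R^-1 *: \sum_(j < s) gz w (zeta k j w).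
Proof. by move=> <-; rewrite /g_ST /sample_average grad_est_average. Qed.

Section version.
Variable g_T : Omega -> 'rV[R]_d.
Hypothesis hg : forall i, is_cond_exp P (half_history T n zeta k)
  (fun w => (gST w 0 i)%:E) (fun w => (g_T w 0 i)%:E).

Lemma measurable_g_T i : measurable_fun [set: half_type] (fun w => g_T w 0 i).
Proof.
apply/measurable_EFinP => _ B mB; rewrite setTI.
exact: (hg i).1.
Qed.

(* g_ST need not be integrable, so the two versions of the conditional expectation
   are compared on events of the half history on which everything is bounded. *)
Lemma g_T_ae_on i s (c : R) : (0 < s)%N -> {ae P, forall w,
  [/\ E s w, (\int[Pz]_z `|gz w z 0 i|%:E <= c%:E)%E & `|g_T w 0 i| <= c] ->
  g_T w 0 i = ghat w 0 i}.
Proof.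
move=> s0.
pose B := E s `&` ([set w | (\int[Pz]_z `|gz w z 0 i|%:E <= c%:E)%E] `&`
  [set w | `|g_T w 0 i| <= c]).
have mab : measurable_fun [set: half_type * Xi] (fun p => `|gz p.1 p.2 0 i|%:E).
  by apply/measurable_EFinP; apply: measurableT_comp => //; exact: measurable_g_zT.
have mI : measurable_fun [set: half_type] (fun w => \int[Pz]_z `|gz w z 0 i|%:E)%E.
  exact: (@measurable_fun_fubini_tonelli_F _ _ _ _ _ Pz _ mab (fun p => normr_ge0 (gz p.1 p.2 0 i))).
have hB : half_history T n zeta k B.
  apply: (@measurableI _ half_type).
    exact: (history_half (sample_size_event_history hA3 s)).
  apply: (@measurableI _ half_type).
    by rewrite -[X in measurable X]setTI; exact: (emeasurable_fun_infty_c measurableT mI).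
  have mg : measurable_fun [set: half_type] (fun w => `|g_T w 0 i|%:E).
    by apply/measurable_EFinP; apply: measurableT_comp => //; exact: measurable_g_T.
  have := emeasurable_fun_infty_c measurableT mg c%:E; rewrite setTI.
  by under eq_set do rewrite lee_fin.
have iz w := integrable_grad_est_loss hf gamma nu (directions T k w) (x k w) i.
have Ez w : (\int[Pz]_z (gz w z 0 i)%:E = (ghat w 0 i)%:E)%E.
  by rewrite -(Rintegral_grad_est_loss hf) -EFin_Rintegral.
have key : {ae P, forall w, B w -> g_T w 0 i = ghat w 0 i}.
  apply: (ae_eq_of_sigma (half_history_measurable hA3 (k := k)) hB (c := c)).
  - exact: measurable_g_T.
  - exact: measurable_smoothed_grad.
  - by move=> w [_ []].
  - move=> w [_ [bw _]]; rewrite -lee_fin; apply: le_trans bw.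
    rewrite -abse_EFin -Ez; apply: (le_trans (le_abse_integral _ _ _)) => //.
    exact: measurable_int (iz w).
  move=> A hA AB.
  have mA : @measurable _ Omega A := half_history_measurable hA3 hA.
  have AE : A `<=` E s by move=> w /AB[].
  have Ac w : A w -> (\int[Pz]_z `|gz w z 0 i|%:E <= c%:E)%E by move=> /AB[_ []].
  have sf (j : 'I_s) := sample_fubini hA3 (ltn_ord j) hA AE (measurable_g_zT i) Ac.
  rewrite ((hg i).2 A hA).
  (* On [n k = s] the estimator is the mean of [s] single-sample estimators, each with the integral
     of [ghat] over [A]. *)
  transitivity (\int[P]_(w in A) ((s%:R^-1)%:E * \sum_(j < s) (gz w (zeta k j w) 0 i)%:E))%E.
    apply: eq_integral => w; rewrite inE => Aw.
    by rewrite (g_STE (AE _ Aw)) mxE summxE EFinM sumEFin.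
  rewrite integralZl//; last by apply: integrable_sum => // j _; exact: (sf j).1.
  rewrite integral_sum//; last by move=> j; exact: (sf j).1.
  under eq_bigr => j _.
    rewrite (sf j).2/=.
    under eq_integral do rewrite Ez.
    over.
  have iA : P.-integrable A (EFin \o (fun w => ghat w 0 i)).
    have icst : P.-integrable A (EFin \o cst c) by exact: finite_measure_integrable_cst.
    apply: (le_integrable mA _ _ icst).
      apply/measurable_EFinP/measurable_funTS.
      exact: (measurable_of_half hA3 (measurable_smoothed_grad i)).
    move=> w Aw.
    have -> : (EFin \o (fun w => ghat w 0 i)) w = (\int[Pz]_z (gz w z 0 i)%:E)%E by rewrite Ez.
    apply: (le_trans (le_abse_integral _ _ _)) => //.
      exact: measurable_int (iz w).
    by apply: (le_trans (Ac _ Aw)); rewrite lee_fin ler_norm.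
  have := integrable_fin_num mA iA.
  move=> /fineK/= <-; rewrite sumEFin -EFinM sumr_const card_ord; congr EFin; rewrite -[X in _ * X]mulr_natl mulKf//.
  by rewrite pnatr_eq0 -lt0n.
by apply: filterS key => w Bw [Ew cw gw]; apply: Bw.
Qed.

(** Integer sample sizes and integer bounds [c] produce only countably many null sets, and every
    outcome satisfies the bounds for some [c]. *)
Lemma g_T_ae : {ae P, forall w, g_T w = ghat w}.
Proof.
have key : {ae P, forall w, forall i, g_T w 0 i = ghat w 0 i}.
  apply: filter_forall => i.
  have := ae_foralln (fun s => ae_foralln (fun c => g_T_ae_on i c%:R (ltn0Sn s))).
  apply: filterS => w H.
  have iz := integrable_grad_est_loss hf gamma nu (directions T k w) (x k w) i.
  have [_] := integrableP _ _ _ iz; rewrite -ge0_fin_numE ?integral_ge0// => fz.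
  pose b := fine (\int[Pz]_z `|gz w z 0 i|%:E)%E.
  pose c := (Num.truncn (Num.max b `|g_T w 0 i|)).+1.
  have cb : Num.max b `|g_T w 0 i| <= c%:R by rewrite ltW// truncnS_gt.
  have nk : n k w = (n k w).-1.+1 by rewrite prednK// (A3_n_gt0 hA3).
  apply: (H (n k w).-1 c); split => //.
    rewrite -(fineK fz) lee_fin; apply: le_trans cb; by rewrite le_max lexx.
  by apply: le_trans cb; rewrite le_max lexx orbT.
by apply: filterS key => w H; apply/rowP.
Qed.

End version.
Lemma measurable_sample_deviation (v : Omega -> 'rV[R]_d) :
  (forall i, measurable_fun [set: half_type] (fun w => v w 0 i)) ->
  measurable_fun [set: half_type]
    (fun w => \int[Pz]_z (dot (gz w z - v w) (gz w z - v w))%:E)%E.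
Proof.
move=> mv.
have mD : measurable_fun [set: half_type * Xi]
    (fun p => (dot (gz p.1 p.2 - v p.1) (gz p.1 p.2 - v p.1))%:E).
  have mc i : measurable_fun [set: half_type * Xi] (fun p => (gz p.1 p.2 - v p.1) 0 i).
    under eq_fun do rewrite mxE [X in _ + X]mxE.
    apply: measurable_funB; first exact: measurable_g_zT.
    exact: (measurableT_comp (mv i) measurable_fst).
  by apply/measurable_EFinP; exact: measurable_dot.
exact: (@measurable_fun_fubini_tonelli_F _ _ _ _ _ Pz _ mD
  (fun p => dot_ge0 (gz p.1 p.2 - v p.1))).
Qed.

(** The event [n k = s] belongs to the history, so over it [V] and [W] have the integrals of the
    quantities they average; in these [g_T] is then exchanged for [ghat]. *)
Lemma norm_condition_integral theta s : (0 < s)%N ->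
  norm_condition Pz f P T n zeta gamma nu x theta k ->
  ((s%:R^-1)%:E * \int[P]_(w in E s) sample_variance w <=
   (theta ^+ 2)%:E * \int[P]_(w in E s) (dot (ghat w) (ghat w))%:E)%E.
Proof.
move=> s0 [g_T [V [W [hg hV hW VW]]]].
have gae := g_T_ae hg.
have hE := sample_size_event_history hA3 (k := k) s.
have mE := measurable_sample_size_event hA3 k s.
have mgT := measurable_g_T hg.
have dotE2 (v : 'rV[R]_d) : enorm v ^+ 2 = dot v v by exact: enorm_sqr.
have VE w : ('E_Pz[(fun z => enorm (gz w z - g_T w) ^+ 2)%R])%E =
    (\int[Pz]_z (dot (gz w z - g_T w) (gz w z - g_T w))%:E)%E.
  by rewrite unlock; apply: eq_integral => z _; rewrite dotE2.
(* [V] and [W] are nonnegative only almost everywhere; their positive parts have the same integrals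
   and obey the rules for nonnegative integrands. *)
have pos (Y : Omega -> \bar R) : (forall B, measurable B -> history T n zeta k (Y @^-1` B)) ->
    {ae P, forall w, (0 <= Y w)%E} ->
    measurable_fun [set: Omega] (fun w => maxe (Y w) 0%E) /\
    (\int[P]_(w in E s) Y w = \int[P]_(w in E s) maxe (Y w) 0)%E.
  move=> mY Y0.
  have mY' : measurable_fun [set: Omega] Y.
    by move=> _ B mB; rewrite setTI; apply: (history_measurable hA3); exact: mY.
  have mM : measurable_fun [set: Omega] (fun w => maxe (Y w) 0%E) by exact: measurable_maxe.
  split => //; apply: ae_eq_integral => //; try exact: measurable_funTS.
  by apply: filterS Y0 => w Yw _; rewrite max_l.
have V0 : {ae P, forall w, (0 <= V w)%E}.
  apply: (cond_exp_ge0 (history_measurable hA3 (k := k)) hV) => w.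
  by rewrite VE; apply: integral_ge0 => z _; rewrite lee_fin dot_ge0.
have W0 : {ae P, forall w, (0 <= W w)%E}.
  apply: (cond_exp_ge0 (history_measurable hA3 (k := k)) hW) => w.
  by rewrite lee_fin exprn_ge0// enorm_ge0.
have [mV EV] := pos V hV.1 V0; have [mW EW] := pos W hW.1 W0.
have -> : (\int[P]_(w in E s) sample_variance w = \int[P]_(w in E s) maxe (V w) 0)%E.
  rewrite -EV (hV.2 _ hE).
  under [RHS]eq_integral do rewrite VE.
  apply: ae_eq_integral => //.
  - apply: measurable_funTS; apply: (measurable_of_half hA3).
    exact: (measurable_sample_deviation measurable_smoothed_grad).
  - apply: measurable_funTS; apply: (measurable_of_half hA3).
    exact: measurable_sample_deviation.
  - by apply: filterS gae => w -> _.
have -> : (\int[P]_(w in E s) (dot (ghat w) (ghat w))%:E = \int[P]_(w in E s) maxe (W w) 0)%E.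
  rewrite -EW (hW.2 _ hE).
  under [RHS]eq_integral do rewrite dotE2.
  apply: ae_eq_integral => //.
  - apply: measurable_funTS; apply: (measurable_of_half hA3).
    by apply/measurable_EFinP; apply: measurable_dot => i; exact: measurable_smoothed_grad.
  - apply: measurable_funTS; apply: (measurable_of_half hA3).
    by apply/measurable_EFinP; apply: measurable_dot => i; exact: mgT.
  - by apply: filterS gae => w -> _.
rewrite -!ge0_integralZl_EFin ?invr_ge0 ?sqr_ge0//; last 4 first.
- by move=> w _; rewrite le_max lexx orbT.
- exact: measurable_funTS.
- by move=> w _; rewrite le_max lexx orbT.
- exact: measurable_funTS.
apply: ae_ge0_le_integral => //.
- by move=> w _; rewrite mule_ge0 ?lee_fin ?invr_ge0// le_max lexx orbT.
- by apply: measurable_funTS; apply: emeasurable_funM.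
- by move=> w _; rewrite mule_ge0 ?lee_fin ?sqr_ge0// le_max lexx orbT.
- by apply: measurable_funTS; apply: emeasurable_funM.
apply: filterS3 VW V0 W0 => w VWw V0w W0w Ew.
by rewrite !max_l// muleC; move: VWw; rewrite Ew.
Qed.

End norm_condition.

(** * Descent and convergence *)

Section descent_model.
Context {R : realType} {d : nat} (phi : 'rV[R]_d -> R) (F0 L alpha : R).
Hypothesis dphi : forall y, differentiable phi y.
Hypothesis dgrad : forall y, differentiable (grad phi) y.
Hypothesis lphi : grad_lipschitz L phi.
Hypothesis lbF : forall y, F0 <= phi y.

(** The right side of the descent lemma, shifted by [F0]; the quadratic coefficient is left free so
    that it can absorb the sampling variance. *)
Definition descent_model (c : R) (y v : 'rV[R]_d) : R :=
  phi y - F0 - alpha * dot (grad phi y) v + c * dot v v.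

Lemma descent_model_ub c y v : L / 2 * alpha ^+ 2 <= c ->
  phi (y - alpha *: v) - F0 <= descent_model c y v.
Proof.
move=> Lc; have := grad_lipschitz_descent dphi y (- (alpha *: v)) lphi.
rewrite !dotE => H.
have : L / 2 * alpha ^+ 2 * dot v v <= c * dot v v by rewrite ler_wpM2r// dot_ge0.
rewrite /descent_model; move: H; move: (dot v v) (dot _ v) => p q; nra.
Qed.

(** The model dominates a nonnegative quantity for every [v], which is the sign that Tonelli
    requires. *)
Lemma descent_model_ge0 c y v : L / 2 * alpha ^+ 2 <= c -> 0 <= descent_model c y v.
Proof. by move=> Lc; apply: le_trans (descent_model_ub y v Lc); rewrite subr_ge0. Qed.

Lemma measurable_descent_model {dY} {Y : measurableType dY} (X V : Y -> 'rV[R]_d) c :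
  (forall i, measurable_fun setT (fun y => X y 0 i)) ->
  (forall i, measurable_fun setT (fun y => V y 0 i)) ->
  measurable_fun setT (fun y => descent_model c (X y) (V y)).
Proof.
move=> mX mV.
have mg i : measurable_fun setT (fun y => grad phi (X y) 0 i).
  exact: measurable_grad_comp.
apply: measurable_funD; last by apply: measurable_funM => //; exact: measurable_dot.
apply: measurable_funB; last by apply: measurable_funM => //; exact: measurable_dot.
apply: measurable_funB => //; apply: measurable_continuous_comp => // v.
exact: differentiable_continuous.
Qed.

End descent_model.

Lemma ge0_le_integral_partition {R : realType} {dO : measure_display} {Omega : measurableType dO}
    (P : probability Omega R) (n : Omega -> nat) (g h : Omega -> \bar R) :
  (forall s, measurable [set w | n w = s]) ->
  measurable_fun setT g -> measurable_fun setT h ->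
  (forall w, 0 <= g w)%E -> (forall w, 0 <= h w)%E ->
  (forall s, \int[P]_(w in [set w | n w = s]) g w <= \int[P]_(w in [set w | n w = s]) h w)%E ->
  (\int[P]_w g w <= \int[P]_w h w)%E.
Proof.
move=> mn mg mh g0 h0 gh.
have nT : [set: Omega] = \bigcup_s [set w | n w = s].
  by apply/seteqP; split => // w _; exists (n w).
have tn : trivIset setT (fun s => [set w | n w = s]).
  by move=> i j _ _ [w [/= <- <-]].
rewrite nT !ge0_integral_bigcup//.
- by apply: lee_nneseries => [s _ _|s _]; [exact: integral_ge0|exact: gh].
- by rewrite -nT.
- by rewrite -nT.
Qed.

Section iteration.
Context {R : realType} {d : nat} {dXi : measure_display} {Xi : measurableType dXi}
  {Pz : probability Xi R} {f : 'rV[R]_d -> Xi -> R}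
  {dO : measure_display} {Omega : measurableType dO} {P : probability Omega R} {N : nat}
  {T : nat -> 'I_N -> Omega -> 'rV[R]_d} {n : nat -> Omega -> nat}
  {zeta : nat -> nat -> Omega -> Xi}.
Hypothesis hA3 : assumption_A3 Pz P T n zeta.
Hypothesis hf : integrable_loss Pz f.
Hypothesis cf : forall z, continuous (f ^~ z).
Notation phi := (objective Pz f).
Variables (F0 L alpha gamma nu : R) (x0 : 'rV[R]_d) (x : nat -> Omega -> 'rV[R]_d).
Hypothesis dphi : forall y, differentiable phi y.
Hypothesis dgrad : forall y, differentiable (grad phi) y.
Hypothesis lphi : grad_lipschitz L phi.
Hypothesis lbF : forall y, F0 <= phi y.
Hypotheses (L0 : 0 < L) (alpha0 : 0 < alpha).
Hypothesis hx : generates f T n zeta gamma nu x x0 alpha.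
Variable k : nat.
Notation hist_type := (history_type (T := T) (n := n) (zeta := zeta) k).
Notation half_type := (half_history_type (T := T) (n := n) (zeta := zeta) k).
Notation E s := (sample_size_event (n := n) k s).
Notation model := (descent_model phi F0 alpha).
Notation ghat := (smoothed_grad (Pz := Pz) (f := f) (T := T) gamma nu x k).

Let mxk i : measurable_fun [set: hist_type] (fun w => x k w 0 i).
Proof. exact: (measurable_iterate hA3 hf cf hx). Qed.

Let mxh i : measurable_fun [set: half_type] (fun w => x k w 0 i).
Proof. exact: (measurable_sub_sigma (@history_half _ _ _ _ _ _ _ T n zeta k)) (mxk i). Qed.

Let mxO j i : measurable_fun [set: Omega] (fun w => x j w 0 i).
Proof.
apply: (measurable_of_sub_sigma (history_measurable hA3 (k := j))).
exact: (measurable_iterate hA3 hf cf hx).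
Qed.

Let cF : continuous phi.
Proof. by move=> y; exact: differentiable_continuous. Qed.

Let c0 := L / 2 * alpha ^+ 2.

Let c00 : 0 < c0.
Proof. by rewrite /c0 mulr_gt0 ?exprn_gt0// divr_gt0. Qed.

Let model0 c y v : c0 <= c -> 0 <= model c y v.
Proof. exact: descent_model_ge0. Qed.

Let mghat i : measurable_fun [set: half_type] (fun w => ghat w 0 i).
Proof. exact: measurable_smoothed_grad. Qed.

Let mghatO i : measurable_fun [set: Omega] (fun w => ghat w 0 i).
Proof. exact: (measurable_of_half hA3). Qed.

Section sample_step.
Variable s : nat.
Hypothesis s0 : (0 < s)%N.

(** With [x_k] and [T_k] frozen, the samples are redrawn under the law conditioned on [n k = s], and
    [sample_average_bound] is applied outcome by outcome. *)
Lemma sample_step :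
  (\int[P]_(w in E s) (phi (x k.+1 w) - F0)%:E <=
   \int[P]_(w in E s) (model c0 (x k w) (ghat w))%:E +
   (c0 / s%:R)%:E * \int[P]_(w in E s) sample_variance (Pz := Pz) (f := f) (T := T) gamma nu x k w)%E.
Proof.
have mE := measurable_sample_size_event hA3 k s.
have mphi j : measurable_fun [set: Omega] (fun w => (phi (x j w) - F0)%:E).
  apply/measurable_EFinP; apply: measurable_funB => //.
  exact: measurable_continuous_comp.
have mmod : measurable_fun [set: Omega] (fun w => (model c0 (x k w) (ghat w))%:E).
  by apply/measurable_EFinP; exact: measurable_descent_model.
have mvar : measurable_fun [set: Omega] (sample_variance (Pz := Pz) (f := f) (T := T) gamma nu x k).
  apply: (measurable_of_half hA3).
  exact: (measurable_sample_deviation hf cf gamma nu mxh mghat).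
have var0 w : (0 <= sample_variance (Pz := Pz) (f := f) (T := T) gamma nu x k w)%E.
  exact: grad_est_variance_ge0.
have mod0 w : 0 <= model c0 (x k w) (ghat w) by exact: model0.
(* Conditioning on a null event is excluded; there the left side is zero. *)
have [PE0|PE0] := eqVneq (P (E s)) 0%E.
  rewrite null_set_integral//; last exact: measurable_funTS.
  apply: adde_ge0; first by apply: integral_ge0 => w _; rewrite lee_fin.
  by apply: mule_ge0; [rewrite lee_fin divr_ge0// ltW|exact: integral_ge0].
pose samp := samples_type (zeta := zeta) k s.
pose G (p : half_type * samp) := grad_est gamma nu (directions T k p.1)
  (fun y => s%:R^-1 * \sum_(j < s) f y (zeta k j p.2)) (x k p.1).
pose H p := (model c0 (x k p.1) (G p))%:E.
have mxp i : measurable_fun [set: half_type * samp] (fun p => x k p.1 0 i).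
  exact: (measurableT_comp (mxh i) measurable_fst).
have mH : measurable_fun [set: half_type * samp] H.
  apply/measurable_EFinP; apply: measurable_descent_model => // i.
  apply: (@measurable_grad_est_caratheodory _ _ _ (half_type * samp)%type N
    (fun v p => s%:R^-1 * \sum_(j < s) f v (zeta k j p.2)) (fun p => x k p.1)
    (fun j p => T k j p.1)) => // [y v|v|j i'].
  - apply: (continuous_mul (@continuous_const R _ s%:R^-1)).
    apply: (@continuous_big R^o); first exact: (@add_continuous R^o).
    by move=> j _; exact: cf.
  - apply: measurable_funM => //; apply: measurable_sum => j.
    have mz : measurable_fun [set: samp] (zeta k j) by apply: measurable_sample_type.
    exact: (measurableT_comp (measurable_loss hf v) (measurableT_comp mz measurable_snd)).
  - have mT : measurable_fun [set: half_type] (fun w => T k j w 0 i').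
      exact: measurable_direction_half.
    exact: (measurableT_comp mT measurable_fst).
have H0 p : (0 <= H p)%E by rewrite lee_fin model0.
have mHO : measurable_fun [set: Omega] (fun w => H (w, w)).
  apply: (measurableT_comp mH).
  exact: measurable_fun_pair (measurable_id_sigma (half_history_measurable hA3 (k := k)))
    (measurable_id_sigma (samples_measurable hA3 (k := k) (s := s))).
apply: (@le_trans _ _ (\int[P]_(w in E s) H (w, w))%E).
  apply: ge0_le_integral => //.
  - by move=> w _; rewrite lee_fin subr_ge0.
  - exact: measurable_funTS.
  - exact: measurable_funTS.
  move=> w Ew; rewrite lee_fin hx.2 /g_ST /sample_average Ew.
  exact: descent_model_ub.
rewrite (sample_tonelli hA3 PE0 mH H0).
rewrite -ge0_integralZl_EFin//; last 2 first.
- exact: measurable_funTS.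
- by rewrite divr_ge0// ltW.
rewrite -ge0_integralD//; last 4 first.
- by move=> w _; rewrite lee_fin.
- exact: measurable_funTS.
- by move=> w _; rewrite mule_ge0// lee_fin divr_ge0// ltW.
- by apply: measurable_funTS; apply: emeasurable_funM.
apply: ge0_le_integral => //.
- by move=> w _; apply: integral_ge0.
- apply: measurable_funTS; apply: (measurable_of_half hA3).
  apply: (measurable_independent_section _ _ mH H0).
  exact: measurable_id_sigma (samples_measurable hA3 (k := k) (s := s)).
- by apply: measurable_funTS; apply: emeasurable_funD => //; apply: emeasurable_funM.
move=> w _.
have lawZ (j : 'I_s) C : measurable C ->
    cond_prob P (measurable_sample_size_event hA3 k s) (zeta k j @^-1` C) = Pz C.
  exact: (cond_sample hA3 PE0).
have indZ (j l : 'I_s) : j != l ->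
    independent_maps (cond_prob P (measurable_sample_size_event hA3 k s)) (zeta k j) (zeta k l).
  exact: (cond_samples_pair hA3 PE0 (ltn_ord j) (ltn_ord l)).
have mod_pos v : 0 <= model c0 (x k w) v by exact: model0.
exact: (sample_average_bound hf gamma nu (directions T k w) (x k w)
  s0 (fun j : 'I_s => A3_zeta_random hA3 k j) lawZ indZ c00 mod_pos).
Qed.

(** By the norm condition the variance term is at most [c0 * theta ^+ 2] times the integral of
    [|ghat|^2], which merges with the quadratic term of the model. *)
Lemma sample_step_norm theta : norm_condition Pz f P T n zeta gamma nu x theta k ->
  (\int[P]_(w in E s) (phi (x k.+1 w) - F0)%:E <=
   \int[P]_(w in E s) (model (c0 * (1 + theta ^+ 2)) (x k w) (ghat w))%:E)%E.
Proof.
move=> hn; apply: (le_trans sample_step).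
have mE := measurable_sample_size_event hA3 k s.
have mmod c : measurable_fun [set: Omega] (fun w => (model c (x k w) (ghat w))%:E).
  by apply/measurable_EFinP; exact: measurable_descent_model.
have mod0 w : 0 <= model c0 (x k w) (ghat w) by exact: model0.
have msq : measurable_fun [set: Omega] (fun w => (dot (ghat w) (ghat w))%:E).
  by apply/measurable_EFinP; exact: measurable_dot.
have -> : (\int[P]_(w in E s) (model (c0 * (1 + theta ^+ 2)) (x k w) (ghat w))%:E =
    \int[P]_(w in E s) (model c0 (x k w) (ghat w))%:E +
    c0%:E * ((theta ^+ 2)%:E * \int[P]_(w in E s) (dot (ghat w) (ghat w))%:E))%E.
  rewrite muleA -EFinM -ge0_integralZl_EFin//; last 3 first.
  - by move=> w _; rewrite lee_fin dot_ge0.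
  - exact: measurable_funTS.
  - by rewrite mulr_ge0 ?sqr_ge0// ltW.
  rewrite -ge0_integralD//; last 4 first.
  - by move=> w _; rewrite lee_fin.
  - exact: measurable_funTS.
  - by move=> w _; rewrite lee_fin mulr_ge0 ?dot_ge0// mulr_ge0 ?sqr_ge0// ltW.
  - by apply: measurable_funTS; apply: emeasurable_funM.
  apply: eq_integral => w _; rewrite -EFinM -EFinD /descent_model; congr EFin.
  by move: (dot _ (ghat w)) (dot _ _) => p q; ring.
apply: leeD2l; rewrite EFinM -muleA lee_pmul2l ?lte_fin//.
exact: (norm_condition_integral hA3 hf cf cF mxh s0 hn).
Qed.

End sample_step.

Lemma iterate_step theta : norm_condition Pz f P T n zeta gamma nu x theta k ->
  (\int[P]_w (phi (x k.+1 w) - F0)%:E <=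
   \int[P]_w (model (c0 * (1 + theta ^+ 2)) (x k w) (ghat w))%:E)%E.
Proof.
move=> hn; apply: (ge0_le_integral_partition (n := n k)).
- by move=> s; exact: (measurable_sample_size_event hA3 k s).
- apply/measurable_EFinP; apply: measurable_funB => //.
  exact: measurable_continuous_comp.
- by apply/measurable_EFinP; exact: measurable_descent_model.
- by move=> w; rewrite lee_fin subr_ge0.
- by move=> w; rewrite lee_fin model0// ler_peMr ?(ltW c00)// lerDl sqr_ge0.
case=> [|s]; last exact: sample_step_norm.
(* Sample sizes are positive, so the piece [s = 0] is empty. *)
rewrite (_ : [set w | n k w = 0%N] = set0) ?integral_set0//.
by apply/seteqP; split => // w /= n0; have := A3_n_gt0 hA3 k w; rewrite n0.
Qed.

End iteration.

Section direction_step.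
Context {R : realType} {d : nat} (hd : (0 < d)%N) {dXi : measure_display}
  {Xi : measurableType dXi} {Pz : probability Xi R} {f : 'rV[R]_d -> Xi -> R}
  {dO : measure_display} {Omega : measurableType dO} {P : probability Omega R}
  {N : nat} (hN : (0 < N)%N)
  {T : nat -> 'I_N -> Omega -> 'rV[R]_d} {n : nat -> Omega -> nat}
  {zeta : nat -> nat -> Omega -> Xi}.
Hypothesis hA3 : assumption_A3 Pz P T n zeta.
Notation phi := (objective Pz f).
Variables (m : method) (F0 L M alpha nu c : R) (x : nat -> Omega -> 'rV[R]_d) (k : nat).
Hypothesis dphi : forall y, differentiable phi y.
Hypothesis dgrad : forall y, differentiable (grad phi) y.
Hypothesis lphi : grad_lipschitz L phi.
Hypothesis hphi : hess_lipschitz M phi.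
Hypothesis lbF : forall y, F0 <= phi y.
Hypotheses (M0 : 0 <= M) (nu0 : 0 < nu) (alpha0 : 0 < alpha).
Hypothesis hT : directions_law P m (T k).
Notation hist_type := (history_type (T := T) (n := n) (zeta := zeta) k).
Hypothesis mx : forall i, measurable_fun [set: hist_type] (fun w => x k w 0 i).
Hypothesis cE : c = alpha * step_ratio d N m / 8.
Hypothesis Lc : L / 2 * alpha ^+ 2 <= c.
Notation model := (descent_model phi F0 alpha c).
Notation ghat := (smoothed_grad (Pz := Pz) (f := f) (T := T) (gamma_of m d N) nu x k).

(** At a fixed point everything is integrable, and [alpha] factors out because [c] is [alpha] times
    the weight of the second moment in [direction_bound]. *)
Lemma direction_step_pointwise y :
  (\int[P]_w (model y (grad_est (gamma_of m d N) nu (directions T k w) phi y))%:E <=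
   (phi y - F0 - alpha / 4 * dot (grad phi y) (grad phi y)
     + alpha * chi_bar m d N M nu)%:E)%E.
Proof.
have [iG bG] := direction_bound hd hN y dphi dgrad hphi M0 nu0
  (fun j => A3_T_random hA3 k j) hT.
set G := (fun w : Omega => _) in iG bG.
have iaG : P.-integrable setT (EFin \o (fun w => dot (grad phi y) (G w))).
  have icst : square_integrable P (fun _ : Omega => grad phi y).
    by split => [i|]; [exact: measurable_cst|exact: finite_measure_integrable_cst].
  exact: integrable_dot.
rewrite EFin_Rintegral; last first.
  apply: integrable_EFinD; last by apply: integrable_EFinZ; exact: iG.2.
  apply: integrable_EFinB; last exact: integrable_EFinZ.
  exact: finite_measure_integrable_cst.
rewrite lee_fin [leLHS](_ : _ = phi y - F0 + alpha * (- dot (grad phi y) (mean P G) +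
    step_ratio d N m / 8 * Rintegral P setT (fun w => dot (G w) (G w)))).
  have := ler_wpM2l (ltW alpha0) bG.
  by move: (dot _ (grad phi y)) (_ + _ * _) => p q; lra.
rewrite RintegralD//; last 2 first.
- apply: integrable_EFinB; last exact: integrable_EFinZ.
  exact: finite_measure_integrable_cst.
- by apply: integrable_EFinZ; exact: iG.2.
rewrite RintegralB//; last 2 first.
- exact: finite_measure_integrable_cst.
- exact: integrable_EFinZ.
rewrite !RintegralZl//; last exact: iG.2.
rewrite (Rintegral_probability_cst P) (Rintegral_dot_cst _ iG) cE.
by rewrite -/G; field.
Qed.

(** [x_k] is determined by the history and [T_k] is independent of it, so the directions are redrawn
    at a frozen point. *)
Lemma direction_step :
  (\int[P]_w (model (x k w) (ghat w))%:E <=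
   \int[P]_w (phi (x k w) - F0 - alpha / 4 * dot (grad phi (x k w)) (grad phi (x k w))
     + alpha * chi_bar m d N M nu)%:E)%E.
Proof.
pose dir := directions_type (T := T) k.
pose G (p : hist_type * dir) := grad_est (gamma_of m d N) nu (directions T k p.2) phi (x k p.1).
pose H p := (model (x k p.1) (G p))%:E.
have mxp i : measurable_fun [set: hist_type * dir] (fun p => x k p.1 0 i).
  exact: (measurableT_comp (mx i) measurable_fst).
have mT j i : measurable_fun [set: dir] (fun w => T k j w 0 i).
  exact: measurable_direction_type.
have cF : continuous phi by move=> y; exact: (differentiable_continuous (dphi y)).
have mH : measurable_fun [set: hist_type * dir] H.
  apply/measurable_EFinP; apply: measurable_descent_model => // i.
  apply: (@measurable_grad_est_caratheodory _ _ _ (hist_type * dir)%type N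
    (fun v _ => phi v) (fun p => x k p.1) (fun j p => T k j p.2)) => // j i'.
  exact: (measurableT_comp (mT j i') measurable_snd).
have H0 p : (0 <= H p)%E by rewrite lee_fin; exact: descent_model_ge0.
have mh : measurable_fun [set: Omega] (id : Omega -> hist_type).
  exact: measurable_id_sigma (history_measurable hA3 (k := k)).
have md : measurable_fun [set: Omega] (id : Omega -> dir).
  exact: measurable_id_sigma (vec_sigma_measurable hA3 (k := k)).
have ind : independent_maps P (id : Omega -> hist_type) (id : Omega -> dir).
  by move=> A B hA dB; rewrite !preimage_id; exact: (A3_T_fresh hA3 hA dB).
have -> : (\int[P]_w (model (x k w) (ghat w))%:E = \int[P]_w H (w, w))%E by [].
have -> : (\int[P]_w H (w, w) = \int[P]_w \int[P]_w' H (w, w'))%E.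
  exact: (independent_tonelli mh md ind mH H0).
have pw w : (\int[P]_w' H (w, w') <= (phi (x k w) - F0
    - alpha / 4 * dot (grad phi (x k w)) (grad phi (x k w)) + alpha * chi_bar m d N M nu)%:E)%E.
  exact: (direction_step_pointwise (x k w)).
have mxO i : measurable_fun [set: Omega] (fun w => x k w 0 i).
  exact: (measurable_of_sub_sigma (history_measurable hA3 (k := k))).
have I0 w : (0 <= \int[P]_w' H (w, w'))%E by exact: integral_ge0.
apply: ge0_le_integral => //.
- exact: (measurableT_comp (measurable_independent_section P md mH H0) mh).
apply/measurable_EFinP; apply: measurable_funD => //; apply: measurable_funB.
  by apply: measurable_funB => //; exact: measurable_continuous_comp.
have mg i : measurable_fun [set: Omega] (fun w => grad phi (x k w) 0 i).
  exact: measurable_grad_comp.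
by apply: measurable_funM => //; exact: measurable_dot.
Qed.

End direction_step.

(** * From a sum over the iterations to its smallest term *)

Section minimum_bounds.
Context {R : realType} {dO : measure_display} {Omega : measurableType dO}
  (P : probability Omega R).
Variables (K : nat) (B : R).
Hypothesis K0 : (0 < K)%N.

Lemma bigmin_le_of_sum (q : 'I_K -> \bar R) : (\sum_k q k <= (K%:R * B)%:E)%E ->
  (\big[Order.min/+oo]_k q k <= B%:E)%E.
Proof.
move=> sq; rewrite leNgt; apply/negP => Bq.
(* A real level above [B] and below every [q k]; when the minimum is [+oo], [B + 1] serves. *)
have [r Br rq] : exists2 r, B < r & forall k, (r%:E <= q k)%E.
  have mq k : (\big[Order.min/+oo]_k q k <= q k)%E by exact: bigmin_le.
  move: Bq mq; case: (\big[Order.min/+oo]_k q k)%E => [r|_ mq|//].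
    by rewrite lte_fin => Br mq; exists r.
  by exists (B + 1); [rewrite ltrDl|move=> k; apply: le_trans (mq k); rewrite leey].
have : ((K%:R * r)%:E <= (K%:R * B)%:E)%E.
  apply: le_trans sq; rewrite (_ : (K%:R * r)%:E = \sum_(k < K) r%:E)%E.
    by apply: lee_sum => k _.
  by rewrite sumEFin sumr_const card_ord mulr_natl.
by rewrite lee_fin ler_pM2l ?ltr0n// leNgt Br.
Qed.

(** Outside the event every [Z k] exceeds [B / p], so the sum exceeds [K * (B / p)]; Markov's
    inequality for the sum gives this probability at most [p]. *)
Lemma markov_bigmin (Z : 'I_K -> Omega -> R) (p : R) : 0 < B -> 0 < p ->
  (forall k, measurable_fun setT (Z k)) -> (forall k w, 0 <= Z k w) ->
  (\sum_k \int[P]_w (Z k w)%:E <= (K%:R * B)%:E)%E ->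
  ((1 - p)%:E <= P [set w | (\big[Order.min/+oo]_k (Z k w)%:E <= (B / p)%:E)%E])%E.
Proof.
move=> B0 p0 mZ Z0 sZ; set S := [set w | _].
have mS : measurable S.
  have -> : S = \bigcup_(k in [set: 'I_K]) [set w | (Z k w)%:E <= (B / p)%:E]%E.
    apply/seteqP; split => w; last by move=> [k _ /= Zk]; exact: bigmin_inf Zk.
    move=> Sw; apply: contrapT => nS; move: Sw; rewrite /S /= leNgt => /negP; apply.
    apply: lt_bigmin; first exact: ltry.
    by move=> k _; rewrite ltNge; apply/negP => Zk; apply: nS; exists k.
  apply: fin_bigcup_measurable => // k _.
  rewrite -[X in measurable X]setTI; apply: emeasurable_fun_infty_c => //.
  exact/measurable_EFinP.
pose c := K%:R * (B / p).
have c0 : 0 < c by rewrite mulr_gt0 ?divr_gt0// ltr0n.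
have sumE : (\sum_k \int[P]_w (Z k w)%:E = \int[P]_w (\sum_k Z k w)%:E)%E.
  rewrite -ge0_integral_sum//; first by apply: eq_integral => w _; rewrite sumEFin.
    by move=> k; exact/measurable_EFinP.
  by move=> k w _; rewrite lee_fin.
have msum : measurable_fun setT (fun w => (\sum_k Z k w)%:E).
  by apply/measurable_EFinP; exact: measurable_sum.
have : (c%:E * P (~` S) <= c%:E * p%:E)%E.
  rewrite -EFinM (_ : c * p = K%:R * B); last by rewrite /c -mulrA divfK// gt_eqF.
  apply: le_trans sZ; rewrite sumE -(integral_cst P (measurableC mS)).
  apply: (@le_trans _ _ (\int[P]_(w in ~` S) (\sum_k Z k w)%:E)%E).
    apply: ge0_le_integral => //.
    - exact: measurableC.
    - by move=> w _; rewrite lee_fin ltW.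
    - exact: measurable_funTS.
    rewrite /S => w /= /negP; rewrite -ltNge => Sw; rewrite lee_fin /c.
    rewrite (_ : K%:R * (B / p) = \sum_(k < K) (B / p)); last first.
      by rewrite sumr_const card_ord mulr_natl.
    apply: ler_sum => k _; rewrite -lee_fin ltW// (lt_le_trans Sw)//.
    exact: bigmin_le.
  apply: ge0_subset_integral => //; first exact: measurableC.
  by move=> w _; rewrite lee_fin sumr_ge0.
rewrite lee_pmul2l ?lte_fin// probability_setC// => H.
have /fineK <- : P S \is a fin_num by exact: fin_num_measure.
move: H; have /fineK <- : P S \is a fin_num by exact: fin_num_measure.
by rewrite -EFinB !lee_fin => H; lra.
Qed.

End minimum_bounds.

Lemma integral_probability_cst {R : realType} {dO : measure_display}
    {Omega : measurableType dO} (P : probability Omega R) (c : R) :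
  (\int[P]_w c%:E = c%:E)%E.
Proof.
have ic : P.-integrable setT (EFin \o cst c) by exact: finite_measure_integrable_cst.
by rewrite (EFin_Rintegral ic) (Rintegral_probability_cst P).
Qed.

(** Every term is added and none is subtracted, so the induction remains valid for infinite [e] and
    [q]. *)
Lemma telescope_bound {R : realType} (e q : nat -> \bar R) (b r : R) : 0 <= b ->
  (forall k, 0 <= q k)%E ->
  (forall k, e k.+1 + b%:E * q k <= e k + r%:E)%E ->
  forall K, (e K + b%:E * \sum_(k < K) q k <= e 0%N + (K%:R * r)%:E)%E.
Proof.
move=> b0 q0 H; elim=> [|K IH]; first by rewrite big_ord0 mule0 adde0 mul0r adde0.
rewrite big_ord_recr /= ge0_muleDr//; last exact: sume_ge0.
rewrite [X in (e K.+1 + X)%E]addeC addeA.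
apply: le_trans (leeD2r _ (H K)) _; rewrite addeAC.
apply: le_trans (leeD2r _ IH) _.
by rewrite -addeA -EFinD -[in leRHS]addn1 natrD mulrDl mul1r.
Qed.

Section constants.
Context {R : realType} (d N : nat) (m : method).
Hypotheses (hd : (0 < d)%N) (hN : (0 < N)%N).

Lemma alpha_barE (theta L : R) : alpha_bar m d N theta L = step_ratio d N m * Omega1 theta L.
Proof. by case: m; rewrite /= ?mul1r. Qed.

Lemma step_ratio_gt0 : 0 < step_ratio d N m :> R.
Proof.
have d0 : 0 < d%:R :> R by rewrite ltr0n.
have n0 : 0 < N%:R :> R by rewrite ltr0n.
by case: m => //=; rewrite divr_gt0// addr_gt0// mulr_gt0.
Qed.

Lemma Omega1_gt0 (theta L : R) : 0 < L -> 0 < Omega1 theta L.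
Proof. by move=> L0; rewrite invr_gt0 !mulr_gt0// ltr_pwDl// sqr_ge0. Qed.

Lemma alpha_bar_gt0 (theta L : R) : 0 < L -> 0 < alpha_bar m d N theta L.
Proof. by move=> L0; rewrite alpha_barE mulr_gt0 ?step_ratio_gt0 ?Omega1_gt0. Qed.

(** The 4 in [Omega1] produces the 8: one factor [alpha] stays, and in the other [Omega1] cancels
    [L] and [1 + theta ^+ 2], leaving the step ratio over 4. *)
Lemma descent_coefficient (theta L : R) : 0 < L ->
  L / 2 * alpha_bar m d N theta L ^+ 2 * (1 + theta ^+ 2) =
  alpha_bar m d N theta L * step_ratio d N m / 8.
Proof.
move=> L0; rewrite alpha_barE /Omega1; set t := 1 + _.
have t0 : t != 0 by rewrite gt_eqF// ltr_pwDl// sqr_ge0.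
by field; rewrite t0 gt_eqF.
Qed.

(** Strict positivity keeps the level in [markov_bigmin] positive even when [x0] is already
    optimal. *)
Lemma chi_bar_gt0 (M nu : R) : 0 < M -> 0 < nu -> 0 < chi_bar m d N M nu.
Proof.
move=> M0 nu0.
have d0 : 0 < d%:R :> R by rewrite ltr0n.
have n0 : 0 < N%:R :> R by rewrite ltr0n.
have O0 : 0 < Omega2 d M nu by rewrite divr_gt0// !mulr_gt0// exprn_gt0.
by case: m => //=; rewrite mulr_gt0// divr_gt0// ?mulr_gt0// ?addr_gt0// ?mulr_gt0// ?addr_gt0// ?mulr_gt0 ?exprn_gt0.
Qed.

End constants.

Theorem theorem1 (R : realType) (d : nat) (hd : (0 < d)%N)
  (dXi : measure_display) (Xi : measurableType dXi) (Pz : probability Xi R)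
  (f : 'rV[R]_d -> Xi -> R)
  (dO : measure_display) (Omega : measurableType dO) (P : probability Omega R)
  (m : method) (N : nat) (hN : (0 < N)%N)
  (T : nat -> 'I_N -> Omega -> 'rV[R]_d)
  (n : nat -> Omega -> nat) (zeta : nat -> nat -> Omega -> Xi)
  (L_f M_f L_F M_F beta1 beta2 theta nu : R)
  (x0 : 'rV[R]_d) (x : nat -> Omega -> 'rV[R]_d)
  (hf : integrable_loss Pz f)
  (hA1 : assumption_A1 Pz f L_f M_f L_F M_F)
  (hA2 : assumption_A2 Pz f beta1 beta2)
  (hA3 : assumption_A3 Pz P T n zeta)
  (hT : forall k, directions_law P m (T k))
  (htheta : 0 < theta) (hnu : 0 < nu)
  (hx : generates f T n zeta (gamma_of m d N) nu x x0
          (alpha_bar m d N theta L_F))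
  (hnorm : forall k,
     norm_condition Pz f P T n zeta (gamma_of m d N) nu x theta k) :
  (forall K : nat, (0 < K)%N ->
    (\big[Order.min/+oo]_(k < K)
       'E_P[(fun w => enorm (grad (objective Pz f) (x k w)) ^+ 2)%R]
     <= (4 * (objective Pz f x0 - Fstar Pz f)
           / (K%:R * alpha_bar m d N theta L_F)
         + 4 * chi_bar m d N M_F nu)%R%:E)%E)
  /\
  (forall (p : R) (K : nat), 0 < p <= 1 -> (0 < K)%N ->
    ((1 - p)%R%:E <=
     P [set w |
         \big[Order.min/+oo]_(k < K)
           (enorm (grad (objective Pz f) (x k w)) ^+ 2)%R%:E
         <= (4 * (objective Pz f x0 - Fstar Pz f)
               / (K%:R * alpha_bar m d N theta L_F * p)
             + 4 * chi_bar m d N M_F nu / p)%R%:E])%E).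
Proof.
have [[dphi dgrad _] bF Cf _ _ /andP[L0 _] /andP[M0 _] lphi hphi] := hA1.
have cf z : continuous (f ^~ z).
  by have [dfz _ _] := Cf z; move=> y; exact: (differentiable_continuous (dfz y)).
set phi := objective Pz f in dphi dgrad bF lphi hphi *.
set F0 := Fstar Pz f; set alpha := alpha_bar m d N theta L_F in hx *.
set chi := chi_bar m d N M_F nu.
have a0 : 0 < alpha by exact: alpha_bar_gt0.
have chi0 : 0 < chi by exact: chi_bar_gt0.
have lbF y : F0 <= phi y by apply: ge_inf => //; exists y.
have mx k i : measurable_fun [set: history_type (T := T) (n := n) (zeta := zeta) k]
    (fun w => x k w 0 i) by exact: (measurable_iterate hA3 hf cf hx).
have mxO k i : measurable_fun [set: Omega] (fun w => x k w 0 i).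
  exact: (measurable_of_sub_sigma (history_measurable hA3 (k := k)) (mx k i)).
pose Z k w := dot (grad phi (x k w)) (grad phi (x k w)).
have mZ k : measurable_fun [set: Omega] (Z k).
  have mg i : measurable_fun [set: Omega] (fun w => grad phi (x k w) 0 i).
    exact: measurable_grad_comp.
  exact: measurable_dot.
have Z0 k w : 0 <= Z k w by exact: dot_ge0.
have mD k : measurable_fun [set: Omega] (fun w => phi (x k w) - F0).
  apply: measurable_funB => //; apply: measurable_continuous_comp => // v.
  exact: (differentiable_continuous (dphi v)).
pose e k := (\int[P]_w (phi (x k w) - F0)%:E)%E.
pose q k := (\int[P]_w (Z k w)%:E)%E.
have q0 k : (0 <= q k)%E by apply: integral_ge0 => w _; rewrite lee_fin.
have step k : (e k.+1 + (alpha / 4)%:E * q k <= e k + (alpha * chi)%:E)%E.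
  have Lc : L_F / 2 * alpha ^+ 2 <= L_F / 2 * alpha ^+ 2 * (1 + theta ^+ 2).
    by rewrite ler_peMr ?lerDl ?sqr_ge0// mulr_ge0 ?sqr_ge0// divr_ge0 ?ltW.
  have cE := descent_coefficient d N m theta L0.
  have bd := direction_step hd hN hA3 dphi dgrad lphi hphi lbF (ltW M0) hnu a0 (hT k) (mx k) cE Lc.
  have bi := iterate_step hA3 hf cf dphi dgrad lphi lbF L0 a0 hx (hnorm k).
  (* Despite its negative term [rest] is nonnegative, since it dominates the mean of a nonnegative
     model; hence the decrease can be added back under the integral without subtracting infinite
     values. *)
  pose rest w := phi (x k w) - F0 - alpha / 4 * Z k w + alpha * chi.
  have rest0 w : 0 <= rest w.
    rewrite -lee_fin; apply: le_trans (direction_step_pointwise hd hN hA3 F0 dphi dgrad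
      hphi (ltW M0) hnu a0 (hT k) cE (x k w)).
    by apply: integral_ge0 => w' _; rewrite lee_fin; exact: descent_model_ge0.
  have mrest : measurable_fun [set: Omega] rest.
    by apply: measurable_funD => //; apply: measurable_funB => //; exact: measurable_funM.
  apply: (@le_trans _ _ ((\int[P]_w (rest w)%:E) + (alpha / 4)%:E * q k)%E).
    by apply: leeD2r; exact: le_trans bi bd.
  rewrite /q -ge0_integralZl_EFin//; last 3 first.
  - by move=> w _; rewrite lee_fin.
  - exact/measurable_EFinP.
  - by rewrite divr_ge0 ?ltW.
  rewrite -ge0_integralD//; last 4 first.
  - by move=> w _; rewrite lee_fin.
  - exact/measurable_EFinP.
  - by move=> w _; rewrite mule_ge0 ?lee_fin// divr_ge0// ltW.
  - by apply: emeasurable_funM => //; exact/measurable_EFinP.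
  rewrite -(integral_probability_cst P (alpha * chi)).
  rewrite /e -ge0_integralD//; last 3 first.
  - by move=> w _; rewrite lee_fin subr_ge0.
  - exact/measurable_EFinP.
  - by move=> w _; rewrite lee_fin mulr_ge0 ?ltW.
  rewrite le_eqVlt; apply/orP; left; apply/eqP.
  apply: eq_integral => w _; rewrite -EFinM -!EFinD; congr EFin.
  by rewrite /rest; ring.
have qK K : (0 < K)%N -> (\sum_(k < K) q k <=
    (K%:R * (4 * (phi x0 - F0) / (K%:R * alpha) + 4 * chi))%:E)%E.
  move=> K0.
  have K1 : 0 < K%:R :> R by rewrite ltr0n.
  have e0 k : (0 <= e k)%E by apply: integral_ge0 => w _; rewrite lee_fin subr_ge0.
  have a4 : 0 < alpha / 4 by rewrite divr_gt0.
  have := telescope_bound (ltW a4) q0 step K.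
  have -> : e 0%N = (phi x0 - F0)%:E.
    by rewrite /e; under eq_integral do rewrite hx.1; exact: integral_probability_cst.
  (* Multiplication by [alpha / 4] brings the claim to telescoped form, from which the nonnegative
     [e K] is dropped. *)
  move=> H; rewrite -(@lee_pmul2l _ (alpha / 4)%:E) ?lte_fin//.
  apply: (le_trans (le_trans (leeDr _ (e0 K)) H)).
  rewrite -EFinD -EFinM lee_fin le_eqVlt; apply/orP; left; apply/eqP.
  by field; rewrite !gt_eqF.
split=> [K K0|p K /andP[p0 _] K0].
  apply: (bigmin_le_of_sum K0); apply: le_trans (qK K K0).
  apply: lee_sum => k _; rewrite unlock /q.
  by under eq_integral do rewrite enorm_sqr.
(* The level is the bound of the first claim divided by [p], as Markov's inequality gives it. *)
rewrite (_ : _ + _ = (4 * (phi x0 - F0) / (K%:R * alpha) + 4 * chi) / p); last first.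
  by field; rewrite !gt_eqF// ltr0n.
have B0 : 0 < 4 * (phi x0 - F0) / (K%:R * alpha) + 4 * chi.
  by rewrite ltr_wpDl ?mulr_gt0// divr_ge0 ?mulr_ge0 ?subr_ge0 ?ler0n// ltW.
apply: le_trans (markov_bigmin K0 B0 p0 (fun k : 'I_K => mZ k) (fun k => Z0 k) (qK K K0)) _.
rewrite le_eqVlt; apply/orP; left; apply/eqP; congr (P _); apply: eq_set => w.
by under [in RHS]eq_bigr do rewrite enorm_sqr.
Qed.
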